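(* Let $\alpha>1/2$ and $L>0$ be fixed, let $n,p\to\infty$, and let $\varphi=\varphi_{n,p}>0$ satisfy $\varphi\to0$, $p\,\varphi^{1/\alpha}\to\infty$ and $n^2p\,b^2(\varphi)\asymp1$. Then the test statistic $\widehat{\mathcal D}_n$ is asymptotically normal: $$n\sqrt p\,\big(\widehat{\mathcal D}_n-\mathbb E_\Sigma(\widehat{\mathcal D}_n)\big)\ \overset{d}{\longrightarrow}\ \mathcal N(0,1)$$ under $\mathbb P_\Sigma$, for any $\Sigma$ (depending on $n,p$) in $Q(\alpha,L,\varphi)$ such that $\mathbb E_\Sigma(\widehat{\mathcal D}_n)=O(b(\varphi))$.
   Context: Model: $X_1,\dots,X_n$ are i.i.d. $p$-dimensional Gaussian vectors $\mathcal N_p(0,\Sigma)$, $X_k=(X_{k,1},\dots,X_{k,p})^\top$, where $\Sigma=[\sigma_{ij}]_{1\le i,j\le p}$ is a covariance matrix with $\sigma_{ii}=1$ for all $i$. $\mathbb P_\Sigma,\mathbb E_\Sigma$ denote the corresponding probability and expectation. All asymptotics are as $n\to\infty$ and $p\to\infty$; $u\asymp v$ means that $c\le\liminf u/v\le\limsup u/v\le C$ for some constants $0<c\le C<\infty$. Classes: $\mathcal F(\alpha,L)$ is the set of $p\times p$ symmetric non-negative definite matrices $\Sigma$ with $\sigma_{ii}=1$ for all $i$ and $\frac1p\sum_{1\le i<j\le p}\sigma_{ij}^2|i-j|^{2\alpha}\le L$. For $\varphi>0$, $Q(\alpha,L,\varphi)=\{\Sigma\in\mathcal F(\alpha,L):\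 \frac1p\sum_{1\le i<j\le p}\sigma_{ij}^2\ge\varphi^2\}$. Test statistic: $$\widehat{\mathcal D}_n=\frac1{n(n-1)p}\sum_{1\le k\ne l\le n}\ \sum_{1\le i<j\le p}w^*_{ij}X_{k,i}X_{k,j}X_{l,i}X_{l,j},\qquad w^*_{ij}=\frac{\lambda}{2b(\varphi)}\Big(1-\Big(\frac{|i-j|}{T}\Big)^{2\alpha}\Big)_+,$$ where $T=\lfloor C_T(\alpha,L)\varphi^{-1/\alpha}\rfloor$, $\lambda=C_\lambda(\alpha,L)\varphi^{(2\alpha+1)/\alpha}$, $b(\varphi)=C^{1/2}(\alpha,L)\varphi^{2+\frac1{2\alpha}}$, and $$C_T(\alpha,L)=((4\alpha+1)L)^{\frac1{2\alpha}},\quad C_\lambda(\alpha,L)=\frac{2\alpha+1}{2\alpha}((4\alpha+1)L)^{-\frac1{2\alpha}},\quad C(\alpha,L)=\frac{2\alpha+1}{(4\alpha+1)^{1+1/(2\alpha)}}L^{-\frac1{2\alpha}} .$$ *)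

(* Defs.v *)
From HB Require Import structures.
From mathcomp Require Import all_boot all_order all_algebra.
From mathcomp Require Import all_classical all_reals all_analysis.

Set Implicit Arguments.
Unset Strict Implicit.
Unset Printing Implicit Defensive.
Import Order.TTheory GRing.Theory Num.Theory.
Import numFieldNormedType.Exports.
Local Open Scope classical_set_scope.
Local Open Scope ring_scope.

Section asymptotics.
Context {R : realType}.

Definition asymp (u v : nat -> R) : Prop :=
  exists c C : R, [/\ 0 < c, c <= C,
    (c%:E <= limn_einf (fun m => (u m / v m)%:E))%E &
    (limn_esup (fun m => (u m / v m)%:E) <= C%:E)%E].

End asymptotics.

Definition mutually_independent (R : realType) d d' (T : measurableType d)
    (S : measurableType d') (P : probability T R) (I : finType)
    (X : I -> {RV P >-> S}) : Prop :=
  forall (J : {set I}) (A : I -> set S),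
    (forall k, k \in J -> measurable (A k)) ->
    P (\bigcap_(k in [set` J]) (X k @^-1` A k)) =
      (\prod_(k in J) P (X k @^-1` A k))%E.
Arguments mutually_independent {R d d' T S} P {I} X.

(* The law N(0, v). The case v = 0 is separate because the library's
   [normal_prob 0 0] is not the Dirac mass at 0. *)
Definition centered_normal (R : realType) (v : R) (A : set R) : \bar R :=
  if v == 0 then dirac (0 : R) A else normal_prob 0 (Num.sqrt v) A.

(* X ~ N_p(0, S), possibly degenerate: every linear combination u X of the
   coordinates has law N(0, u S u^T). *)
Definition gaussian_vector (R : realType) d (T : measurableType d)
    (P : probability T R)
    (p : nat) (S : 'M[R]_p) (X : {RV P >-> p.-tuple R}) : Prop :=
  forall (u : 'rV[R]_p) (A : set R), measurable A ->
    P [set w | A (\sum_(i < p) u 0 i * tnth (X w) i)] =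
      centered_normal ((u *m S *m u^T) 0 0) A.
Arguments gaussian_vector {R d T} P {p} S X.

Definition iid_gaussian (R : realType) d (T : measurableType d)
    (P : probability T R)
    (n p : nat) (S : 'M[R]_p) (X : 'I_n -> {RV P >-> p.-tuple R}) : Prop :=
  mutually_independent P X /\ forall k, gaussian_vector P S (X k).
Arguments iid_gaussian {R d T} P {n p} S X.

(* Convergence in distribution of Z m, each on its own probability space, to
   the law mu: convergence of the distribution functions at every continuity
   point of the limit. *)
Definition cvg_in_distribution (R : realType) (d : nat -> measure_display)
    (T : forall m, measurableType (d m)) (P : forall m, probability (T m) R)
    (Z : forall m, T m -> R)
    (mu : probability (measurableTypeR R) R) : Prop :=
  forall x : R, {for x, continuous (fun y : R => mu `]-oo, y]%classic)} ->
    P m (Z m @^-1` `]-oo, x]%classic) @[m --> \oo] --> mu `]-oo, x]%classic.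

Section covariance_classes.
Context {R : realType}.
Implicit Types (alpha L phi : R) (p : nat).

Definition class_F alpha L p : set 'M[R]_p :=
  [set S | [/\ S^T = S,
    forall u : 'rV[R]_p, 0 <= (u *m S *m u^T) 0 0,
    forall i, S i i = 1 &
    p%:R^-1 * (\sum_(i < p) \sum_(j < p | (i < j)%N)
      S i j ^+ 2 * `|i%:R - j%:R| `^ (2 * alpha)) <= L]].

Definition class_Q alpha L phi p : set 'M[R]_p :=
  [set S | class_F alpha L S /\
    phi ^+ 2 <= p%:R^-1 * (\sum_(i < p) \sum_(j < p | (i < j)%N) S i j ^+ 2)].

End covariance_classes.

Section test_statistic.
Context {R : realType}.
Implicit Types (alpha L phi : R).

Definition const_CT alpha L : R :=
  ((4 * alpha + 1) * L) `^ (2 * alpha)^-1.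

Definition const_Clambda alpha L : R :=
  (2 * alpha + 1) / (2 * alpha) * ((4 * alpha + 1) * L) `^ (- (2 * alpha)^-1).

Definition const_C alpha L : R :=
  (2 * alpha + 1) / (4 * alpha + 1) `^ (1 + (2 * alpha)^-1) *
  L `^ (- (2 * alpha)^-1).

Definition T_phi alpha L phi : int :=
  Num.floor (const_CT alpha L * phi `^ (- alpha^-1)).

Definition lambda_phi alpha L phi : R :=
  const_Clambda alpha L * phi `^ ((2 * alpha + 1) / alpha).

Definition b_phi alpha L phi : R :=
  Num.sqrt (const_C alpha L) * phi `^ (2 + (2 * alpha)^-1).

Definition weight alpha L phi (i j : nat) : R :=
  lambda_phi alpha L phi / (2 * b_phi alpha L phi) *
  Num.max 0
    (1 - (`|i%:R - j%:R| / (T_phi alpha L phi)%:~R) `^ (2 * alpha)).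

Definition Dhat alpha L phi (n p : nat) (Omega : Type)
    (X : 'I_n -> Omega -> p.-tuple R) (w : Omega) : R :=
  (n%:R * (n%:R - 1) * p%:R)^-1 *
  \sum_(k < n) \sum_(l < n | k != l) \sum_(i < p) \sum_(j < p | (i < j)%N)
    weight alpha L phi i j *
    tnth (X k w) i * tnth (X k w) j * tnth (X l w) i * tnth (X l w) j.

End test_statistic.

(* Main.v *)
(* Centring X_k X_k^T at Sigma splits n sqrt(p) (Dhat - E Dhat) into
   U = c sum_(k <> l) <Y_k, Y_l>, where Y_k has the coordinates
   sqrt(w_ij) (X_ki X_kj - sigma_ij) with i < j, and a linear term.  The variance
   of the linear term is controlled by E Dhat = O(b) and tends to 0.

   U is handled by Stein's method, with the explicit Stein solution of a
   piecewise linear test function.  Replacing U by the sum U - H_l that omits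
   the l-th observation and expanding to second order, the error only involves
   the traces of G^2 and G^4, where G is the covariance operator of Y_k, and the
   fourth moments of linear forms in Y_k.  The latter are hypercontractive,
   E Q^4 <= 27 (E Q^2)^2 for a centred Gaussian quadratic form Q, by Gaussian
   integration by parts; this is where Gaussianity enters.

   G differs from the diagonal matrix of the weights by a term whose squared
   Hilbert-Schmidt norm is at most a multiple of D + w_max^2 D^2, D being the sum
   of the squared off-diagonal entries of Sigma.  Close to the diagonal D is
   bounded by E Dhat, away from it by the class F, so D = O(p phi^2) and the term
   is o(p).  Hence tr G^2 ~ sum_(i < j) w_ij^2 ~ p / 2 and tr G^4 = o(p^2). *)

Require Import Defs.
From HB Require Import structures.
From mathcomp Require Import all_boot all_order all_algebra.
From mathcomp Require Import all_classical all_reals all_analysis.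
From mathcomp Require Import measurable_realfun zify ring lra.
From mathcomp Require Import -(notations) mpoly.

Set Implicit Arguments.
Unset Strict Implicit.
Unset Printing Implicit Defensive.
Import Order.TTheory GRing.Theory Num.Theory.
Import numFieldNormedType.Exports.
Local Open Scope classical_set_scope.
Local Open Scope ring_scope.

(** * Random variables with all moments *)

(** [gaussian_vector] prescribes only the laws of linear combinations and Sigma may be singular, so
    there is no joint density to integrate by parts against. The moment recursion E Z^(m+1) = m v E
    Z^(m-1) of a linear combination Z says that the Ornstein-Uhlenbeck generator has mean zero on
    powers of linear forms; these span the polynomials, so it has mean zero on all of them.
    Covariances, the Isserlis formula and hypercontractivity follow by applying this to products.
    The Stein solution of an indicator has a discontinuous derivative, while leaving one observation
    out requires a Lipschitz one; hence ramps that sandwich the indicator. The expansion works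
    because sum_l H_l = 2 U and, given the other observations, H_l has mean 0 and variance 4 c^2 <S,
    G S>, S being the sum of the other Y_k. With c = 1 / ((n - 1) sqrt p) the variance 2 c^2 n (n -
    1) tr G^2 of U tends to 1 because tr G^2 ~ p / 2; the constants C_T, C_lambda and C of the
    weights are calibrated for the value 1/2. *)

Section moments.
Context d (T : measurableType d) (R : realType) (P : probability T R).
Implicit Types (Z W : T -> R).

(** [C] generates the sigma-algebra for which [Z] is measurable, so that the same predicate also
    says that a variable depends only on some of the observations. Asking for all moments makes the
    class an algebra. *)
Definition mom (C : set (set T)) Z : Prop :=
  measurable_fun [set: g_sigma_algebraType C] (Z : g_sigma_algebraType C -> R)
  /\ forall m, P.-integrable setT (EFin \o (fun w => `|Z w| ^+ m)).

Definition E Z : R := \int[P]_w Z w.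

Section mom_closure.
Variable C : set (set T).
Hypothesis hC : C `<=` measurable.

Lemma measurable_gen Z :
  measurable_fun [set: g_sigma_algebraType C] (Z : g_sigma_algebraType C -> R) ->
  measurable_fun [set: T] Z.
Proof.
move=> mZ _ B mB; have := mZ measurableT B mB.
apply: (@smallest_sub _ (sigma_algebra setT) _ _ _ hC).
exact: sigma_algebra_measurable.
Qed.

Lemma mom_measurable Z : mom C Z -> measurable_fun [set: T] Z.
Proof. by case=> /measurable_gen. Qed.

Lemma mom_le Z (g : nat -> T -> R) :
  measurable_fun [set: g_sigma_algebraType C] (Z : g_sigma_algebraType C -> R) ->
  (forall k, P.-integrable setT (EFin \o g k)) ->
  (forall k w, `|Z w| ^+ k <= g k w) -> mom C Z.
Proof.
move=> mZ ig hg; split => // k.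
apply: (le_integrable _ _ _ (ig k)) => //.
  apply/measurable_EFinP; apply: measurable_funX.
  apply: measurableT_comp => //; exact: measurable_gen mZ.
move=> w _ /=; rewrite lee_fin normrX normr_id (le_trans (hg k w))//.
exact: ler_norm.
Qed.

Lemma mom_bounded Z (M : R) :
  measurable_fun [set: g_sigma_algebraType C] (Z : g_sigma_algebraType C -> R) ->
  (forall w, `|Z w| <= M) -> mom C Z.
Proof.
move=> mZ hM; apply: (@mom_le _ (fun k _ => M ^+ k)) => // [k|k w].
  exact: finite_measure_integrable_cst.
by rewrite lerXn2r ?nnegrE ?(le_trans _ (hM w)).
Qed.

Lemma mom_cst c : mom C (fun=> c).
Proof. by apply: (@mom_bounded _ `|c|). Qed.

Lemma momD Z W : mom C Z -> mom C W -> mom C (fun w => Z w + W w).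
Proof.
move=> [mZ iZ] [mW iW].
apply: (@mom_le _ (fun k w => 2 ^+ k * (`|Z w| ^+ k + `|W w| ^+ k))).
- exact: measurable_funD.
- move=> k.
  have := integrableZl measurableT (2 ^+ k) (integrableD measurableT (iZ k) (iW k)).
  exact: eq_integrable.
- move=> k w; have h : `|Z w + W w| <= 2 * Num.max `|Z w| `|W w|.
    rewrite (le_trans (ler_normD _ _))// mulr2n mulrDl mul1r lerD//.
      by rewrite le_max lexx.
    by rewrite le_max lexx orbT.
  rewrite (@le_trans _ _ ((2 * Num.max `|Z w| `|W w|) ^+ k))//.
    by rewrite lerXn2r// nnegrE mulr_ge0// le_max normr_ge0.
  rewrite exprMn ler_wpM2l ?exprn_ge0//.
  by case: (leP `|Z w| `|W w|) => _; rewrite ?lerDr ?lerDl exprn_ge0.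
Qed.

Lemma momM Z W : mom C Z -> mom C W -> mom C (fun w => Z w * W w).
Proof.
move=> [mZ iZ] [mW iW].
apply: (@mom_le _ (fun k w => `|Z w| ^+ (2 * k) + `|W w| ^+ (2 * k))).
- exact: measurable_funM.
- move=> k; have := integrableD measurableT (iZ (2 * k)%N) (iW (2 * k)%N).
  exact: eq_integrable.
- move=> k w; rewrite normrM exprMn mulnC !exprM.
  have /= := sqr_ge0 (`|Z w| ^+ k - `|W w| ^+ k).
  have := mulr_ge0 (exprn_ge0 k (normr_ge0 (Z w))) (exprn_ge0 k (normr_ge0 (W w))).
  nra.
Qed.

Lemma momZ c Z : mom C Z -> mom C (fun w => c * Z w).
Proof. by move=> h; apply: momM => //; exact: mom_cst. Qed.

Lemma momN Z : mom C Z -> mom C (fun w => - Z w).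
Proof.
move=> h; rewrite (_ : (fun _ => _) = (fun w => -1 * Z w)); first exact: momZ.
by apply/funext => w; rewrite mulN1r.
Qed.

Lemma momB Z W : mom C Z -> mom C W -> mom C (fun w => Z w - W w).
Proof. by move=> hZ hW; apply: momD => //; exact: momN. Qed.

Lemma momX Z m : mom C Z -> mom C (fun w => Z w ^+ m).
Proof.
move=> h; elim: m => [|m IH].
  by under eq_fun do rewrite expr0; exact: mom_cst.
by under eq_fun do rewrite exprS; exact: momM.
Qed.

Lemma mom_sum (I : Type) (r : seq I) (Q : pred I) (F : I -> T -> R) :
  (forall i, Q i -> mom C (F i)) -> mom C (fun w => \sum_(i <- r | Q i) F i w).
Proof.
move=> h; elim: r => [|i r IH].
  by under eq_fun do rewrite big_nil; exact: mom_cst.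
under eq_fun do rewrite big_cons; case: (boolP (Q i)) => Qi //.
by apply: momD => //; exact: h.
Qed.

Lemma mom_prod (I : Type) (r : seq I) (Q : pred I) (F : I -> T -> R) :
  (forall i, Q i -> mom C (F i)) -> mom C (fun w => \prod_(i <- r | Q i) F i w).
Proof.
move=> h; elim: r => [|i r IH].
  by under eq_fun do rewrite big_nil; exact: mom_cst.
under eq_fun do rewrite big_cons; case: (boolP (Q i)) => Qi //.
by apply: momM => //; exact: h.
Qed.

Lemma mom_norm Z : mom C Z -> mom C (fun w => `|Z w|).
Proof.
move=> [mZ iZ]; split; first exact: measurableT_comp.
by move=> m; apply: eq_integrable (iZ m) => // w _ /=; rewrite normr_id.
Qed.

Lemma mom_comp (g : R -> R) (M : R) Z : continuous g ->
  (forall x, `|g x| <= M) -> mom C Z -> mom C (g \o Z).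
Proof.
move=> cg gM [mZ _]; apply: (@mom_bounded _ M) => [|w]; last exact: gM.
apply: measurableT_comp => //; exact: continuous_measurable_fun.
Qed.

Lemma mom_integrable Z : mom C Z -> P.-integrable setT (EFin \o Z).
Proof.
move=> hZ; have [_ /(_ 1%N)] := hZ.
apply: le_integrable => //.
  by apply/measurable_EFinP; exact: mom_measurable hZ.
by move=> w _ /=; rewrite expr1 normr_id.
Qed.

End mom_closure.

Local Notation momT := (mom (@measurable _ T)).

Lemma momT_sub C Z : C `<=` measurable -> mom C Z -> momT Z.
Proof.
move=> hC hZ; split; last by case: hZ.
move=> _ B mB; rewrite setTI; apply: sub_sigma_algebra.
by rewrite -[X in measurable X]setTI; apply: (mom_measurable hC hZ).
Qed.

Let momTi Z : momT Z -> P.-integrable setT (EFin \o Z).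
Proof. exact: mom_integrable. Qed.

Lemma ED Z W : momT Z -> momT W -> E (fun w => Z w + W w) = E Z + E W.
Proof. by move=> hZ hW; rewrite /E RintegralD//; exact: momTi. Qed.

Lemma EB Z W : momT Z -> momT W -> E (fun w => Z w - W w) = E Z - E W.
Proof. by move=> hZ hW; rewrite /E RintegralB//; exact: momTi. Qed.

Lemma EZ c Z : momT Z -> E (fun w => c * Z w) = c * E Z.
Proof. by move=> hZ; rewrite /E RintegralZl//; exact: momTi. Qed.

Lemma E_cst c : E (fun=> c) = c.
Proof. by rewrite /E Rintegral_cst// [X in fine X](@probability_setT _ _ _ P)/= mulr1. Qed.

Lemma eqE Z W : (forall w, Z w = W w) -> E Z = E W.
Proof. by move=> h; congr E; apply/funext. Qed.

Lemma leE Z W : momT Z -> momT W -> (forall w, Z w <= W w) -> E Z <= E W.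
Proof. by move=> hZ hW h; apply: le_Rintegral => //; exact: momTi. Qed.

Lemma E_ge0 Z : (forall w, 0 <= Z w) -> 0 <= E Z.
Proof. by move=> h; apply: Rintegral_ge0. Qed.

Lemma normE Z : momT Z -> `|E Z| <= E (fun w => `|Z w|).
Proof. by move=> hZ; apply: le_normr_Rintegral => //; exact: momTi. Qed.

Lemma Esum (I : Type) (r : seq I) (Q : pred I) (F : I -> T -> R) :
  (forall i, Q i -> momT (F i)) ->
  E (fun w => \sum_(i <- r | Q i) F i w) = \sum_(i <- r | Q i) E (F i).
Proof.
move=> h; elim: r => [|i r IH].
  by under eq_fun do rewrite big_nil; rewrite big_nil E_cst.
under eq_fun do rewrite big_cons; rewrite big_cons; case: ifP => Qi //.
by rewrite ED ?IH//; [exact: h|exact: mom_sum].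
Qed.

(** The discriminant of the nonnegative polynomial E (Z - t W)^2 in t is nonpositive. *)
Lemma E_CS Z W : momT Z -> momT W ->
  E (fun w => Z w * W w) ^+ 2 <= E (fun w => Z w ^+ 2) * E (fun w => W w ^+ 2).
Proof.
move=> hZ hW.
have h t : 0 <= E (fun w => W w ^+ 2) * t ^+ 2
    + (- 2 * E (fun w => Z w * W w)) * t + E (fun w => Z w ^+ 2).
  have -> : E (fun w => W w ^+ 2) * t ^+ 2
      + (- 2 * E (fun w => Z w * W w)) * t + E (fun w => Z w ^+ 2) =
      E (fun w => (Z w - t * W w) ^+ 2).
    rewrite mulrC -EZ; last exact: momX.
    rewrite mulrAC -EZ; last exact: momM.
    rewrite -ED; [|by apply: momZ => //; exact: momX|by apply: momZ => //; exact: momM].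
    rewrite -ED; last exact: momX; last first.
      by apply: momD => //; apply: momZ => //; [exact: momX|exact: momM].
    by apply: eqE => w; ring.
  by apply: E_ge0 => w; exact: sqr_ge0.
have W0 : 0 <= E (fun w => W w ^+ 2) by apply: E_ge0 => w; exact: sqr_ge0.
have Z0 : 0 <= E (fun w => Z w ^+ 2) by apply: E_ge0 => w; exact: sqr_ge0.
move: h W0 Z0; set a := E (fun w => W w ^+ 2); set b := E (fun w => Z w * W w).
set c := E (fun w => Z w ^+ 2) => h; rewrite le_eqVlt => /orP[/eqP a0|a0] c0.
  (* If E W^2 = 0 the polynomial is affine, and unless b = 0 it would take the value -1 at t = (c +
     1) / (2 b). *)
  rewrite -a0 mulr0; have [->|b0] := eqVneq b 0; first by rewrite expr0n.
  have := h ((c + 1) / (2 * b)); rewrite -a0 mul0r add0r.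
  have -> : -2 * b * ((c + 1) / (2 * b)) + c = -1 by field.
  by rewrite oppr_ge0 ler10.
have := h (b / a); have -> : a * (b / a) ^+ 2 + -2 * b * (b / a) + c = (c * a - b ^+ 2) / a.
  by field; rewrite gt_eqF.
by rewrite pmulr_lge0 ?invr_gt0// subr_ge0.
Qed.

End moments.

(** * Expectation of a product of two independent variables *)

Section independence.
Context d (T : measurableType d) (R : realType) (P : probability T R).
Local Notation E := (E P).
Local Notation momT := (mom P measurable).

Definition indep2 (U V : T -> R) : Prop := forall A B : set R,
  measurable A -> measurable B ->
  P (U @^-1` A `&` V @^-1` B) = (P (U @^-1` A) * P (V @^-1` B))%E.

(** The joint law agrees with the product of the marginals on rectangles, hence everywhere; Fubini
    then factors the integral of x y. *)
Lemma E_indep2 (U V : T -> R) : momT U -> momT V -> indep2 U V ->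
  E (fun w => U w * V w) = E U * E V.
Proof.
move=> hU hV UV.
have mU := mom_measurable (@subset_refl _ _) hU.
have mV := mom_measurable (@subset_refl _ _) hV.
have iUV := mom_integrable (@subset_refl _ _) (momM (@subset_refl _ _) hU hV).
have iU := mom_integrable (@subset_refl _ _) hU.
have iV := mom_integrable (@subset_refl _ _) hV.
have mUV : measurable_fun setT (fun w => (U w, V w)) by exact: measurable_fun_pair.
pose U' : {RV P >-> R} := mfun_Sub (mem_set mU).
pose V' : {RV P >-> R} := mfun_Sub (mem_set mV).
pose W' : {mfun T >-> (R * R)%type} := mfun_Sub (mem_set mUV).
pose m1 := distribution P U'. pose m2 := distribution P V'.
pose m := distribution P W'.
have mE : forall X, measurable X -> (m1 \x m2)%E X = m X.
  apply: product_measure_unique => A B mA mB.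
  rewrite /m /m1 /m2 /distribution /pushforward /=.
  by rewrite -UV//.
pose f := (fun z : R * R => (z.1 * z.2)%:E).
have mf : measurable_fun setT f.
  by apply/measurable_EFinP; apply: measurable_funM.
have intf : (m1 \x m2)%E.-integrable setT f.
  apply/integrableP; split => //.
  rewrite (eq_measure_integral m); last by move=> A mA _; exact: mE.
  rewrite ge0_integral_distribution//; last exact: measurableT_comp.
  by have /integrableP[] := iUV.
have H : (\int[m]_z f z = (\int[P]_w (U w)%:E) * (\int[P]_w (V w)%:E))%E.
  have -> : (\int[m]_z f z = \int[m1 \x m2]_z f z)%E.
    by apply: eq_measure_integral => A mA _; exact/esym/mE.
  rewrite -integral12_prod_meas1//.
  rewrite /fubini_F /f /=.
  have e2 : (\int[m2]_y y%:E = \int[P]_w (V w)%:E)%E.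
    by rewrite (@integral_distribution _ _ _ _ _ P V' EFin).
  have e1 : (\int[m1]_y y%:E = \int[P]_w (U w)%:E)%E.
    by rewrite (@integral_distribution _ _ _ _ _ P U' EFin).
  have j2 : m2.-integrable setT EFin.
    apply/integrableP; split => //.
    rewrite ge0_integral_distribution//; last exact: measurableT_comp.
    by have /integrableP[] := iV.
  have j1 : m1.-integrable setT EFin.
    apply/integrableP; split => //.
    rewrite ge0_integral_distribution//; last exact: measurableT_comp.
    by have /integrableP[] := iU.
  rewrite -e1 -e2.
  under eq_integral.
    move=> x _; under eq_integral do rewrite EFinM.
    rewrite integralZl//; over.
  have : (\int[m2]_y y%:E)%E \is a fin_num by exact: integrable_fin_num.
  move=> /fineK <-.
  by rewrite integralZr.
rewrite /E /Rintegral -fineM; [|exact: integrable_fin_num..].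
rewrite -H integral_distribution//.
Qed.

End independence.

(** * Blocks of independent observations *)

Section blocks.
Context d d' (T : measurableType d) (S : measurableType d') (R : realType)
  (P : probability T R) (I : finType) (X : I -> {RV P >-> S}).
Local Notation E := (E P).
Local Notation momT := (mom P measurable).
Hypothesis iX : mutually_independent P X.

(** A pi-system generating the sigma-algebra of the [X k] with k in [J]. *)
Definition cyl (J : {set I}) : set (set T) :=
  [set B | exists A : I -> set S, (forall k, k \in J -> measurable (A k)) /\
     B = \bigcap_(k in [set` J]) (X k @^-1` A k)].

Lemma cyl_measurable J : cyl J `<=` measurable.
Proof.
move=> _ [A [mA ->]]; apply: fin_bigcap_measurable => // k kJ.
rewrite -[X in measurable X]setTI.
by apply: (measurable_funPT (X k)) => //; exact: mA.
Qed.

Lemma cyl_setI J : setI_closed (cyl J).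
Proof.
move=> _ _ [A [mA ->]] [B [mB ->]]; exists (fun k => A k `&` B k); split.
  by move=> k kJ; apply: measurableI; [exact: mA|exact: mB].
by rewrite -bigcapI; apply: eq_bigcapr => k _; rewrite preimage_setI.
Qed.

(** As functions of [B] both sides are finite measures. They agree on the pi-system [cyl J] by
    mutual independence over [l |: J], hence on the sigma-algebra it generates. *)
Lemma cyl_indep (J : {set I}) l (A : set S) (B : set T) : l \notin J -> measurable A ->
  <<s cyl J >> B -> P ((X l @^-1` A) `&` B) = (P (X l @^-1` A) * P B)%E.
Proof.
move=> lJ mA.
have mXA : measurable (X l @^-1` A).
  by rewrite -[X in measurable X]setTI; exact: (measurable_funPT (X l)).
pose c := fine (P (X l @^-1` A)).
have c0 : 0 <= c by rewrite fine_ge0.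
have cE : P (X l @^-1` A) = c%:E by rewrite fineK// fin_num_measure.
pose m1 := mrestr P mXA.
pose m2 := mscale (NngNum c0) P.
have H C : cyl J C -> m1 C = m2 C.
  move=> [F [mF ->]].
  rewrite /m1 /m2 /mrestr /mscale /= -cE setIC.
  (* Prescribing [A] at index [l] turns the intersection into a cylinder over [l |: J]. *)
  pose F' k := if k == l then A else F k.
  have -> : X l @^-1` A `&` \bigcap_(k in [set` J]) X k @^-1` F k =
     \bigcap_(k in [set` (l |: J)%SET]) X k @^-1` F' k.
    apply/seteqP; split => w /=.
      move=> [lA h] k; rewrite /= !inE /F'; case: eqP => [-> //|_ /= kJ].
      exact: h.
    move=> h; split; first by have := h l; rewrite /F' /= !inE eqxx; exact.
    move=> k /= kJ; have := h k; rewrite /F' /= !inE kJ orbT.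
    by case: eqP => [kl|_]; [move: lJ; rewrite -kl kJ|exact].
  rewrite iX; last first.
    by move=> k; rewrite !inE /F'; case: eqP => // _ /= kJ; exact: mF.
  rewrite iX//.
  rewrite big_setU1//= /F' eqxx; congr (_ * _)%E.
  apply: eq_bigr => k kJ; case: eqP => // kl; move: lJ; by rewrite -kl kJ.
move=> sB.
rewrite [LHS](_ : _ = m1 B); last by rewrite /m1 /mrestr /= setIC.
rewrite cE -[RHS]/(m2 B).
apply: (@g_sigma_algebra_measure_unique _ R T (cyl J) _ (fun=> setT)) => //.
- exact: cyl_measurable.
- move=> _; exists (fun=> setT); split => //; apply/seteqP; by split.
- by apply/seteqP; split => // w _; exists 0%N.
- exact: cyl_setI.
- move=> _; rewrite /= /mrestr setTI; exact: (le_lt_trans (probability_le1 _ mXA) (ltry _)).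
Qed.

Lemma mom_block (J : {set I}) l (g : S -> R) : l \in J -> measurable_fun setT g ->
  momT (g \o X l) -> mom P (cyl J) (g \o X l).
Proof.
move=> lJ mg [_ ig]; split => // _ B mB; rewrite setTI.
apply: sub_sigma_algebra; exists (fun k => if k == l then g @^-1` B else setT).
have mgB : measurable (g @^-1` B) by rewrite -[X in measurable X]setTI; exact: mg.
split; first by move=> k _; case: eqP.
apply/seteqP; split => w /=; first by move=> h k _ /=; case: eqP => // ->.
by move=> /(_ l lJ) /=; rewrite eqxx.
Qed.

Lemma E_block (J : {set I}) l (g : S -> R) V : l \notin J -> measurable_fun setT g ->
  momT (g \o X l) -> mom P (cyl J) V ->
  E (fun w => g (X l w) * V w) = E (g \o X l) * E V.
Proof.
move=> lJ mg hg hV; apply: E_indep2 => //.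
  exact: momT_sub (@cyl_measurable J) hV.
move=> A B mA mB.
have -> : (g \o X l) @^-1` A = X l @^-1` (g @^-1` A) by [].
apply: (@cyl_indep J) => //.
  by rewrite -[X in measurable X]setTI; exact: mg.
by have [/(_ measurableT B mB)] := hV; rewrite setTI.
Qed.

End blocks.

Section sums.
Context (R : realType) (I : finType).

Lemma sumM2 (u v : I -> R) :
  (\sum_a u a) * (\sum_b v b) = \sum_a \sum_b u a * v b.
Proof. by rewrite big_distrlr. Qed.

Lemma sumM4 (u v x y : I -> R) :
  (\sum_a u a) * (\sum_a v a) * ((\sum_a x a) * (\sum_a y a)) =
  \sum_a \sum_b \sum_e \sum_f u a * v b * (x e * y f).
Proof.
rewrite (sumM2 u v) (sumM2 x y) mulr_suml; apply: eq_bigr => a _.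
rewrite mulr_suml; apply: eq_bigr => b _; rewrite mulr_sumr.
by apply: eq_bigr => e _; rewrite mulr_sumr.
Qed.

(** Lagrange's identity: the defect is half the sum of the squares of the 2 x 2 minors. *)
Lemma sum_CS (u v : I -> R) :
  (\sum_a u a * v a) ^+ 2 <= (\sum_a u a ^+ 2) * (\sum_a v a ^+ 2).
Proof.
have : 0 <= \sum_a \sum_b (u a * v b - u b * v a) ^+ 2.
  by apply: sumr_ge0 => a _; apply: sumr_ge0 => b _; exact: sqr_ge0.
have -> : \sum_a \sum_b (u a * v b - u b * v a) ^+ 2 =
   \sum_a \sum_b u a ^+ 2 * v b ^+ 2 + \sum_a \sum_b v a ^+ 2 * u b ^+ 2
   - 2 * (\sum_a \sum_b (u a * v a) * (u b * v b)).
  rewrite mulr_sumr -sumrN -!big_split/=; apply: eq_bigr => a _.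
  rewrite mulr_sumr -sumrN -!big_split/=; apply: eq_bigr => b _; ring.
rewrite -!sumM2; nra.
Qed.
End sums.

(** * Mixed fourth moments of a random vector *)

Section gram.
Context d (T : measurableType d) (R : realType) (P : probability T R) (I : finType).
Local Notation E := (E P).
Local Notation momT := (mom P measurable).
Local Notation hT := (@subset_refl _ (@measurable _ T)).

Lemma Esum4 (F : I -> I -> I -> I -> T -> R) :
  (forall a b e f, momT (F a b e f)) ->
  E (fun w => \sum_a \sum_b \sum_e \sum_f F a b e f w) =
  \sum_a \sum_b \sum_e \sum_f E (F a b e f).
Proof.
move=> h; rewrite Esum; last first.
  by move=> a _; do 3 (apply: mom_sum => // ? _).
apply: eq_bigr => a _; rewrite Esum; last by move=> b _; do 2 (apply: mom_sum => // ? _).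
apply: eq_bigr => b _; rewrite Esum; last by move=> e _; apply: mom_sum => // ? _.
by apply: eq_bigr => e _; rewrite Esum.
Qed.

Lemma Esum2 (F : I -> I -> T -> R) : (forall a b, momT (F a b)) ->
  E (fun w => \sum_a \sum_b F a b w) = \sum_a \sum_b E (F a b).
Proof.
move=> h; rewrite Esum; last by move=> a _; apply: mom_sum => // ? _.
by apply: eq_bigr => a _; rewrite Esum.
Qed.

Lemma mom_sum2 C (F : I -> I -> T -> R) : C `<=` measurable ->
  (forall a b, mom P C (F a b)) -> mom P C (fun w => \sum_a \sum_b F a b w).
Proof. by move=> hC h; do 2 (apply: mom_sum => // ? _). Qed.

Lemma E_norm_sqrt Z : momT Z -> E (fun w => `|Z w|) <= Num.sqrt (E (fun w => Z w ^+ 2)).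
Proof.
move=> hZ; have h := E_CS (mom_norm hZ) (mom_cst P hT 1).
rewrite -(@ger0_norm _ (E (fun w => `|Z w|))); last exact: E_ge0.
rewrite -sqrtr_sqr ler_wsqrtr// (le_trans _ (le_trans h _))//.
  by under eq_fun do rewrite -[`|_|]mulr1.
rewrite expr1n E_cst mulr1; apply: leE; [|exact: momX|].
  by apply: momX => //; exact: mom_norm.
by move=> w; rewrite real_normK ?num_real.
Qed.

(* Two independent copies of [Z] would turn the left-hand side into
   E (Z.X)^2 (Z'.X)^2; instead the quartic inequality is integrated once in
   each of its two arguments. *)
Lemma gram_le (Z : I -> T -> R) (G Gam : I -> I -> R) (M : I -> I -> I -> I -> R)
    (K : R) :
  (forall a, momT (Z a)) ->
  (forall a b, E (fun w => Z a w * Z b w) = G a b) ->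
  (forall c c' : I -> R,
    \sum_a \sum_b \sum_e \sum_f c a * c b * (c' e * c' f) * M a b e f <=
    K * (\sum_a \sum_b c a * c b * Gam a b) * (\sum_a \sum_b c' a * c' b * Gam a b)) ->
  \sum_a \sum_b \sum_e \sum_f G a b * G e f * M a b e f <=
  K * (\sum_a \sum_b G a b * Gam a b) ^+ 2.
Proof.
move=> hZ hG hM.
have EG (N : I -> I -> R) :
    E (fun w => \sum_a \sum_b Z a w * Z b w * N a b) = \sum_a \sum_b G a b * N a b.
  rewrite Esum2; last by move=> a b; do ?apply: momM => //; exact: mom_cst.
  apply: eq_bigr => a _; apply: eq_bigr => b _; rewrite -hG mulrC.
  rewrite -EZ; last exact: momM.
  by apply: eqE => w; rewrite mulrC.
have mG (N : I -> I -> R) : momT (fun w => \sum_a \sum_b Z a w * Z b w * N a b).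
  by apply: mom_sum2 => // a b; do ?apply: momM => //; exact: mom_cst.
have h1 c' : \sum_a \sum_b \sum_e \sum_f G a b * (c' e * c' f) * M a b e f <=
    K * (\sum_a \sum_b G a b * Gam a b) * (\sum_a \sum_b c' a * c' b * Gam a b).
  rewrite -EG mulrAC -EZ; last exact: mG.
  rewrite [leLHS](_ : _ = E (fun w => \sum_a \sum_b Z a w * Z b w *
      \sum_e \sum_f c' e * c' f * M a b e f)); last first.
    rewrite EG; apply: eq_bigr => a _; apply: eq_bigr => b _.
    rewrite mulr_sumr; apply: eq_bigr => e _.
    by rewrite mulr_sumr; apply: eq_bigr => f _; rewrite !mulrA.
  apply: leE; [exact: mG|by apply: momZ|move=> w].
  apply: le_trans (le_trans (hM (Z^~ w) c') _); last by rewrite mulrAC.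
  apply: ler_sum => a _; apply: ler_sum => b _.
  rewrite mulr_sumr; apply: ler_sum => e _.
  by rewrite mulr_sumr; apply: ler_sum => f _; rewrite !mulrA.
rewrite expr2 mulrA -[X in _ <= _ * X]EG -EZ; last exact: mG.
rewrite [leLHS](_ : _ = E (fun w => \sum_e \sum_f Z e w * Z f w *
      \sum_a \sum_b G a b * M a b e f)); last first.
  rewrite EG.
  transitivity (\sum_a \sum_b \sum_e \sum_f G e f * G a b * M e f a b).
    rewrite pair_big/= [RHS]pair_big/=.
    under eq_bigr do rewrite pair_big/=.
    under [RHS]eq_bigr do rewrite pair_big/=.
    by rewrite exchange_big.
  apply: eq_bigr => a _; apply: eq_bigr => b _.
  rewrite mulr_sumr; apply: eq_bigr => e _.
  by rewrite mulr_sumr; apply: eq_bigr => f _; ring.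
apply: leE; [exact: mG|by apply: momZ|move=> w].
apply: le_trans (h1 (Z^~ w)).
have -> : \sum_a \sum_b \sum_e \sum_f G a b * (Z e w * Z f w) * M a b e f =
    \sum_a \sum_b \sum_e \sum_f G e f * (Z a w * Z b w) * M e f a b.
  rewrite pair_big/= [RHS]pair_big/=.
  under eq_bigr do rewrite pair_big/=.
  under [RHS]eq_bigr do rewrite pair_big/=.
  by rewrite exchange_big.
apply: ler_sum => a _; apply: ler_sum => b _.
rewrite mulr_sumr; apply: ler_sum => e _.
rewrite mulr_sumr; apply: ler_sum => f _; rewrite le_eqVlt; apply/orP; left; apply/eqP; ring.
Qed.

Section quartic.
Variables (X : I -> T -> R) (Gam : I -> I -> R) (K : R).
Hypothesis hX : forall a, momT (X a).
Hypothesis hGam : forall a b, E (fun w => X a w * X b w) = Gam a b.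
Hypothesis K0 : 0 <= K.
Hypothesis hyper : forall c : I -> R, E (fun w => (\sum_a c a * X a w) ^+ 4) <=
  K * (\sum_a \sum_b c a * c b * Gam a b) ^+ 2.

Definition quart a b e f := E (fun w => X a w * X b w * (X e w * X f w)).

Lemma E_sqr_lin (c : I -> R) :
  E (fun w => (\sum_a c a * X a w) ^+ 2) = \sum_a \sum_b c a * c b * Gam a b.
Proof.
under eq_fun do rewrite expr2 sumM2.
rewrite Esum2; last by move=> a b; do ?apply: momM => //; exact: mom_cst.
apply: eq_bigr => a _; apply: eq_bigr => b _; rewrite -hGam -EZ; last exact: momM.
by apply: eqE => w; ring.
Qed.

(** The left-hand side is E (c X)^2 (c' X)^2; Cauchy-Schwarz splits it into two fourth moments, each
    controlled by [hyper]. This is the quartic inequality that [gram_le] takes as hypothesis. *)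
Lemma quart_le (c c' : I -> R) :
  \sum_a \sum_b \sum_e \sum_f c a * c b * (c' e * c' f) * quart a b e f <=
  K * (\sum_a \sum_b c a * c b * Gam a b) * (\sum_a \sum_b c' a * c' b * Gam a b).
Proof.
have mc (k : I -> R) : momT (fun w => \sum_a k a * X a w).
  by apply: mom_sum => // a _; apply: momZ.
have q0 (k : I -> R) : 0 <= \sum_a \sum_b k a * k b * Gam a b.
  by rewrite -E_sqr_lin; apply: E_ge0 => w; exact: sqr_ge0.
have -> : \sum_a \sum_b \sum_e \sum_f c a * c b * (c' e * c' f) * quart a b e f =
    E (fun w => (\sum_a c a * X a w) ^+ 2 * (\sum_a c' a * X a w) ^+ 2).
  under [RHS]eqE do rewrite !expr2 sumM4.
  rewrite Esum4; last by move=> a b e f; do ?apply: momM => //; exact: mom_cst.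
  apply: eq_bigr => a _; apply: eq_bigr => b _.
  apply: eq_bigr => e _; apply: eq_bigr => f _.
  rewrite /quart -EZ; last by do ?apply: momM.
  by apply: eqE => w; ring.
apply: le_trans (ler_norm _) _.
rewrite -sqrtr_sqr -[leRHS]ger0_norm; last by rewrite !mulr_ge0.
rewrite -[leRHS]sqrtr_sqr ler_wsqrtr//.
apply: le_trans (E_CS _ _) _; [exact: momX|exact: momX|].
under eq_fun do rewrite -exprM.
under [X in _ * E X]eq_fun do rewrite -exprM.
have := hyper c; have := hyper c'.
have := @E_ge0 _ _ _ P (fun w => (\sum_a c a * X a w) ^+ 4) (fun w => @exprn_even_ge0 _ 4 _ isT).
have := @E_ge0 _ _ _ P (fun w => (\sum_a c' a * X a w) ^+ 4) (fun w => @exprn_even_ge0 _ 4 _ isT).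
move: (E _) (E _) => x y x0 y0 hx hy.
apply: le_trans (ler_pM y0 x0 hy hx) _.
by rewrite le_eqVlt; apply/orP; left; apply/eqP; ring.
Qed.
End quartic.

End gram.

(** * Normal approximation of degenerate quadratic forms *)

(** Second moments of sums over the sample are computed by adding one observation at a time,
    independent of those already present. *)
Lemma setU1_ind (I : finType) (Q : {set I} -> Prop) : Q finset.set0 ->
  (forall (J : {set I}) l, l \notin J -> Q J -> Q (l |: J)%SET) -> forall J, Q J.
Proof.
move=> Q0 QU J; have [m] := ubnP #|J|; elim: m J => // m IH J.
have [->//|[l lJ]] := set_0Vmem J.
by rewrite (cardsD1 l) lJ ltnS => h; rewrite -(finset.setD1K lJ); apply: QU; [rewrite !inE eqxx|exact: IH].
Qed.

Section degenerate_form.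
Context d (T : measurableType d) (R : realType) (P : probability T R).
Context (I : finType) (n : nat).
(** [off l] generates the events that depend on the observations other than [l]. [hI1], [hI2] and
    [hI4] express through mixed moments that [Y l] is centred, has covariance [Gam] and is
    independent of these events. *)
Variables (Y : 'I_n -> I -> T -> R) (off : 'I_n -> set (set T)).
Variables (Gam : I -> I -> R) (K : R).
Local Notation E := (E P).
Local Notation momT := (mom P measurable).
Local Notation hT := (@subset_refl _ (@measurable _ T)).
Local Notation quart l := (quart P (Y l)).
Hypothesis hoff : forall l, off l `<=` measurable.
Hypothesis hY : forall l a, momT (Y l a).
Hypothesis hYoff : forall k l a, k != l -> mom P (off l) (Y k a).
Hypothesis hI1 : forall l a V, mom P (off l) V -> E (fun w => Y l a w * V w) = 0.
Hypothesis hI2 : forall l a b V, mom P (off l) V ->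
  E (fun w => Y l a w * Y l b w * V w) = Gam a b * E V.
Hypothesis hI4 : forall l a b e f V, mom P (off l) V ->
  E (fun w => Y l a w * Y l b w * (Y l e w * Y l f w) * V w) =
  quart l a b e f * E V.
Hypothesis K0 : 0 <= K.
Hypothesis hyper : forall l (c : I -> R), E (fun w => (\sum_a c a * Y l a w) ^+ 4) <=
  K * (\sum_a \sum_b c a * c b * Gam a b) ^+ 2.
Implicit Types (J : {set 'I_n}) (l : 'I_n).

Let offT l V : mom P (off l) V -> momT V.
Proof. by apply: momT_sub; exact: hoff. Qed.

Let hGam l a b : E (fun w => Y l a w * Y l b w) = Gam a b.
Proof.
have := @hI2 l a b _ (mom_cst P (@hoff l) 1); rewrite E_cst mulr1 => <-.
by apply: eqE => w; rewrite mulr1.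
Qed.

Definition quad (y : I -> R) : R := \sum_a \sum_b y a * y b * Gam a b.

Definition dot (x y : I -> R) : R := \sum_a x a * y a.

(** As [Gam] is symmetric, [tr2] and [tr4] are the traces of Gam^2 and Gam^4, written as squared
    Hilbert-Schmidt norms of [Gam] and of its square [sq]. *)
Definition tr2 : R := \sum_a \sum_b Gam a b ^+ 2.
Definition sq (a b : I) : R := \sum_e Gam a e * Gam e b.
Definition tr4 : R := \sum_a \sum_b sq a b ^+ 2.

(** A covariance is symmetric; [l] provides an observation whose covariance is [Gam]. *)
Lemma GamC l a b : Gam a b = Gam b a.
Proof. by rewrite -!(hGam l); apply: eqE => w; rewrite mulrC. Qed.

Lemma mom_quad C (Z : I -> T -> R) : C `<=` measurable ->
  (forall a, mom P C (Z a)) -> mom P C (fun w => quad (Z^~ w)).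
Proof.
move=> hC h; apply: mom_sum2 => // a b.
by do ?apply: momM => //; exact: mom_cst.
Qed.

Lemma mom_dot C (Z W : I -> T -> R) : C `<=` measurable ->
  (forall a, mom P C (Z a)) -> (forall a, mom P C (W a)) ->
  mom P C (fun w => dot (Z^~ w) (W^~ w)).
Proof. by move=> hC h h'; apply: mom_sum => // a _; apply: momM. Qed.

Lemma E_dot_off l (Z : I -> T -> R) V : (forall a, mom P (off l) (Z a)) ->
  mom P (off l) V -> E (fun w => dot (Y l ^~ w) (Z^~ w) * V w) = 0.
Proof.
move=> hZ hV; under eq_fun do rewrite /dot mulr_suml.
have hTZ a := offT (hZ a); have hTV := offT hV.
rewrite Esum; last by move=> a _; do ?apply: momM.
apply: big1 => a _; under eq_fun do rewrite -mulrA.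
by apply: hI1; exact: momM.
Qed.

Lemma E_quad_off l V : mom P (off l) V ->
  E (fun w => quad (Y l ^~ w) * V w) = tr2 * E V.
Proof.
move=> hV; have hTV := offT hV.
under eq_fun do rewrite /quad mulr_suml.
under eq_fun do under eq_bigr do rewrite mulr_suml.
rewrite Esum2; last by move=> a b; do ?apply: momM => //; exact: mom_cst.
rewrite /tr2 mulr_suml; apply: eq_bigr => a _; rewrite mulr_suml; apply: eq_bigr => b _.
transitivity (E (fun w => Gam a b * (Y l a w * Y l b w * V w))).
  by apply: eqE => w; ring.
rewrite EZ; last by do ?apply: momM.
by rewrite hI2// expr2 mulrA.
Qed.

(** Given the other observations [Z] is fixed, and the variance of <Y_l, Z> is <Z, Gam Z>. *)
Lemma E_sqr_dot_off l (Z : I -> T -> R) V : (forall a, mom P (off l) (Z a)) ->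
  mom P (off l) V ->
  E (fun w => dot (Y l ^~ w) (Z^~ w) ^+ 2 * V w) = E (fun w => quad (Z^~ w) * V w).
Proof.
move=> hZ hV; have hTZ a := offT (hZ a); have hTV := offT hV.
under eq_fun do rewrite /dot expr2 sumM2 mulr_suml.
under eq_fun do under eq_bigr do rewrite mulr_suml.
rewrite Esum2; last by move=> a b; do ?apply: momM.
have -> : E (fun w => quad (Z^~ w) * V w) =
    \sum_a \sum_b E (fun w => Z a w * Z b w * Gam a b * V w).
  rewrite -Esum2; last by move=> a b; do ?apply: momM => //; exact: mom_cst.
  apply: eqE => w; rewrite /quad mulr_suml; apply: eq_bigr => a _.
  by rewrite mulr_suml.
apply: eq_bigr => a _; apply: eq_bigr => b _.
transitivity (E (fun w => Y l a w * Y l b w * (Z a w * Z b w * V w))).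
  by apply: eqE => w; ring.
rewrite hI2; last by do ?apply: momM.
rewrite -EZ; last by do ?apply: momM.
by apply: eqE => w; ring.
Qed.

(** Given the other observations, [quart_le] at c = c' = Z bounds the fourth moment of <Y_l, Z> by K
    times its squared variance. *)
Lemma E_dot4_off l (Z : I -> T -> R) : (forall a, mom P (off l) (Z a)) ->
  E (fun w => dot (Y l ^~ w) (Z^~ w) ^+ 4) <= K * E (fun w => quad (Z^~ w) ^+ 2).
Proof.
move=> hZ; have hTZ a := offT (hZ a).
rewrite -EZ; last by apply: momX => //; exact: mom_quad.
rewrite [leLHS](_ : _ = E (fun w => \sum_a \sum_b \sum_e \sum_f
    Z a w * Z b w * (Z e w * Z f w) * quart l a b e f)); last first.
  under eq_fun do rewrite (_ : 4 = 2 + 2)%N// exprD /dot expr2 sumM4.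
  rewrite Esum4; last by move=> a b e f; do ?apply: momM.
  rewrite Esum4; last by move=> a b e f; do ?apply: momM => //; exact: mom_cst.
  apply: eq_bigr => a _; apply: eq_bigr => b _.
  apply: eq_bigr => e _; apply: eq_bigr => f _.
  transitivity (E (fun w => Y l a w * Y l b w * (Y l e w * Y l f w)
     * (Z a w * Z b w * (Z e w * Z f w)))).
    by apply: eqE => w; ring.
  rewrite hI4; last by do ?apply: momM.
  rewrite mulrC -[in RHS](E_cst P (quart l a b e f)).
  rewrite mulrC E_cst -EZ; last by do ?apply: momM.
  by apply: eqE => w; ring.
apply: leE.
- do 4 (apply: mom_sum => // ? _); do ?apply: momM => //; exact: mom_cst.
- by apply: momZ => //; apply: momX => //; exact: mom_quad.
move=> w; have := quart_le (hY l) (hGam l) K0 (hyper l) (Z^~ w) (Z^~ w).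
by rewrite /quad -mulrA expr2.
Qed.

Lemma tr2_ge0 : 0 <= tr2.
Proof. by apply: sumr_ge0 => a _; apply: sumr_ge0 => b _; exact: sqr_ge0. Qed.

Lemma tr4_ge0 : 0 <= tr4.
Proof. by apply: sumr_ge0 => a _; apply: sumr_ge0 => b _; exact: sqr_ge0. Qed.

Lemma tr4_le l : tr4 <= tr2 ^+ 2.
Proof.
rewrite /tr4 expr2 /tr2 sumM2; apply: ler_sum => a _; apply: ler_sum => b _.
rewrite /sq; apply: le_trans (sum_CS _ _) _.
by rewrite [X in _ * X](eq_bigr (fun e => Gam b e ^+ 2))// => e _; rewrite (GamC l).
Qed.

(** [Gam] is the Gram matrix of [Y l] itself, so [gram_le] applies with the same vector in both
    roles. *)
Lemma E_sqr_quad l : E (fun w => quad (Y l ^~ w) ^+ 2) <= K * tr2 ^+ 2.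
Proof.
have -> : tr2 = \sum_a \sum_b Gam a b * Gam a b.
  by apply: eq_bigr => a _; apply: eq_bigr => b _; rewrite expr2.
apply: le_trans (gram_le (hY l) (hGam l) (quart_le (hY l) (hGam l) K0 (hyper l))).
rewrite [leLHS](_ : _ = E (fun w => \sum_a \sum_b \sum_e \sum_f
  Gam a b * Gam e f * (Y l a w * Y l b w * (Y l e w * Y l f w)))); last first.
  apply: eqE => w; rewrite expr2 /quad mulr_suml; apply: eq_bigr => a _.
  rewrite mulr_suml; apply: eq_bigr => b _; rewrite mulr_sumr; apply: eq_bigr => e _.
  by rewrite mulr_sumr; apply: eq_bigr => f _; ring.
rewrite Esum4; last by move=> a b e f; do ?apply: momM => //; exact: mom_cst.
apply: ler_sum => a _; apply: ler_sum => b _; apply: ler_sum => e _.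
by apply: ler_sum => f _; rewrite EZ//; do ?apply: momM.
Qed.

(** The form <S, Gam S> splits into its diagonal [D], whose terms are uncorrelated with mean [tr2],
    and the cross terms [Rem], whose second moment is of order |J|^2 tr4. *)
Definition S J a w : R := \sum_(k in J) Y k a w.
Definition D J w : R := \sum_(k in J) quad (Y k ^~ w).
Definition Rem J w : R := quad (S J ^~ w) - D J w.

Let mS J a : momT (S J a).
Proof. by apply: mom_sum. Qed.

Let mD J : momT (D J).
Proof. by apply: mom_sum => // k _; apply: mom_quad. Qed.

Let mRem J : momT (Rem J).
Proof. by apply: momB => //; exact: mom_quad. Qed.

Let neq_in J l k : l \notin J -> k \in J -> k != l.
Proof. by move=> lJ kJ; apply: contraNneq lJ => <-. Qed.

Let mSo J l a : l \notin J -> mom P (off l) (S J a).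
Proof. by move=> lJ; apply: mom_sum => // k kJ; apply/hYoff/neq_in/kJ. Qed.

Let mDo J l : l \notin J -> mom P (off l) (D J).
Proof.
move=> lJ; apply: mom_sum => // k kJ; apply: mom_quad => // a.
exact/hYoff/neq_in/kJ.
Qed.

Let mRemo J l : l \notin J -> mom P (off l) (Rem J).
Proof. by move=> lJ; apply: momB => //; [apply: mom_quad => // a|]; auto. Qed.

Lemma S_setU1 J l a w : l \notin J -> S (l |: J) a w = Y l a w + S J a w.
Proof. by move=> lJ; rewrite /S big_setU1. Qed.

Definition GS J a w : R := \sum_b Gam a b * S J b w.

Let mGSo J l a : l \notin J -> mom P (off l) (GS J a).
Proof. by move=> lJ; apply: mom_sum => // b _; apply: momZ => //; exact: mSo. Qed.

Lemma quadD x y : forall l : 'I_n, quad (fun a => x a + y a) =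
  quad x + 2 * dot x (fun a => \sum_b Gam a b * y b) + quad y.
Proof.
move=> l; rewrite /quad /dot.
transitivity (\sum_a \sum_b (x a * x b * Gam a b + x a * (Gam a b * y b) +
   y a * (Gam a b * x b) + y a * y b * Gam a b)).
  by apply: eq_bigr => a _; apply: eq_bigr => b _; ring.
under eq_bigr do rewrite !big_split/=.
rewrite !big_split/=; congr (_ + _); rewrite -addrA; congr (_ + _).
rewrite mulr2n mulrDl mul1r; congr (_ + _).
  by apply: eq_bigr => a _; rewrite mulr_sumr.
rewrite exchange_big/=; apply: eq_bigr => a _; rewrite mulr_sumr.
by apply: eq_bigr => b _; rewrite (GamC l); ring.
Qed.

Lemma Rem_setU1 J l w : l \notin J ->
  Rem (l |: J) w = Rem J w + 2 * dot (Y l ^~ w) (GS J ^~ w).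
Proof.
move=> lJ; rewrite /Rem /D big_setU1//=.
have -> : quad (S (l |: J)^~ w) = quad (fun a => Y l a w + S J a w).
  by congr quad; apply/funext => a; rewrite S_setU1.
by rewrite (quadD _ _ l); rewrite /GS; ring.
Qed.

Lemma E_SS J a b : E (fun w => S J a w * S J b w) = #|J|%:R * Gam a b.
Proof.
elim/setU1_ind: J => [|J l lJ IH].
  by rewrite cards0 mul0r -[RHS](E_cst P); apply: eqE => w; rewrite /S !big_set0 mul0r.
transitivity (E (fun w => Y l a w * Y l b w + Y l a w * S J b w +
    (Y l b w * S J a w + S J a w * S J b w))).
  by apply: eqE => w; rewrite !S_setU1//; ring.
rewrite !ED; do ?[exact: momM|apply: momD => //; exact: momM].
rewrite (hI1 _ (@mSo J l b lJ)) (hI1 _ (@mSo J l a lJ)).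
by rewrite IH hGam !add0r addr0 cardsU1 lJ add1n -natr1 mulrDl mul1r addrC.
Qed.

(** The form is <S, Gam^3 S>, and S has covariance |J| Gam, so the mean is |J| times the trace of
    Gam^4. *)
Lemma E_quad_GS J : E (fun w => quad (GS J ^~ w)) = #|J|%:R * tr4.
Proof.
rewrite [LHS](_ : _ = E (fun w => \sum_e \sum_f S J e w * S J f w *
   (\sum_a \sum_b Gam a e * Gam b f * Gam a b))); last first.
  apply: eqE => w; rewrite /quad /GS.
  under eq_bigr do under eq_bigr do rewrite sumM2 mulr_suml.
  under eq_bigr do under eq_bigr do under eq_bigr do rewrite mulr_suml.
  under [RHS]eq_bigr do under eq_bigr do rewrite mulr_sumr.
  under [RHS]eq_bigr do under eq_bigr do under eq_bigr do rewrite mulr_sumr.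
  rewrite pair_big/= [RHS]pair_big/=.
  under eq_bigr do rewrite pair_big/=.
  under [RHS]eq_bigr do rewrite pair_big/=.
  rewrite exchange_big; apply: eq_bigr => -[e f] _.
  by apply: eq_bigr => -[a b] _ /=; ring.
rewrite Esum2; last by move=> a b; do ?apply: momM => //; exact: mom_cst.
transitivity (\sum_e \sum_f \sum_a \sum_b #|J|%:R * Gam e f * (Gam a e * Gam b f * Gam a b)).
  apply: eq_bigr => e _; apply: eq_bigr => f _; under eq_fun do rewrite mulrC.
  rewrite EZ; last exact: momM.
  rewrite E_SS mulrC mulr_sumr; apply: eq_bigr => a _.
  by rewrite mulr_sumr.
rewrite exchange_big/=; under eq_bigr do rewrite exchange_big/=; rewrite exchange_big/=.
rewrite /tr4 mulr_sumr; apply: eq_bigr => a _; rewrite mulr_sumr; apply: eq_bigr => f _.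
rewrite /sq expr2 sumM2 mulr_sumr; apply: eq_bigr => e _; rewrite mulr_sumr.
apply: eq_bigr => b _; ring.
Qed.

(** The increment 2 <Y_l, Gam S> is orthogonal to [Rem J] and has second moment 4 |J| tr4; adding
    these up stays below 2 |J|^2 tr4. *)
Lemma E_sqr_Rem J : E (fun w => Rem J w ^+ 2) <= 2 * #|J|%:R ^+ 2 * tr4.
Proof.
elim/setU1_ind: J => [|J l lJ IH].
  rewrite cards0 expr0n mulr0 mul0r -[leRHS](E_cst P) le_eqVlt; apply/orP; left.
  apply/eqP; apply: eqE => w; rewrite /Rem /D big_set0 subr0 /quad big1 ?expr0n// => a _.
  by rewrite big1// => b _; rewrite /S big_set0 !mul0r.
have mdot := mom_dot (@subset_refl _ _) (hY l) (fun a => offT (@mGSo J l a lJ)).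
rewrite [leLHS](_ : _ = E (fun w => Rem J w ^+ 2 +
    (4 * (dot (Y l ^~ w) (GS J ^~ w) * Rem J w) + 4 * (dot (Y l ^~ w) (GS J ^~ w) ^+ 2 * 1)))); last first.
  by apply: eqE => w; rewrite Rem_setU1//; ring.
have m1 : momT (fun w => dot (Y l ^~ w) (GS J ^~ w) * Rem J w) by exact: momM.
have m2 : momT (fun w => dot (Y l ^~ w) (GS J ^~ w) ^+ 2 * 1).
  by apply: momM => //; [exact: momX|exact: mom_cst].
rewrite ED; [|exact: momX|by apply: momD => //; exact: momZ].
rewrite ED; [|exact: momZ..].
rewrite EZ// EZ// E_dot_off; [|move=> a; exact: mGSo|exact: mRemo].
rewrite E_sqr_dot_off; [|move=> a; exact: mGSo|exact: mom_cst].
under [X in _ + (_ + _ * E X)]eq_fun do rewrite mulr1.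
rewrite E_quad_GS cardsU1 lJ add1n -natr1 mulr0 add0r.
apply: le_trans (lerD IH (lexx _)) _.
have := tr4_ge0; set N := #|J|%:R; nra.
Qed.

Lemma E_quad l : E (fun w => quad (Y l ^~ w)) = tr2.
Proof.
have := E_quad_off (mom_cst P (@hoff l) 1); rewrite E_cst mulr1 => <-.
by apply: eqE => w; rewrite mulr1.
Qed.

(** Adding [l] contributes the variance of <Y_l, Gam Y_l>, bounded by [E_sqr_quad]; the cross term
    vanishes. *)
Lemma E_sqr_D J : E (fun w => (D J w - #|J|%:R * tr2) ^+ 2) <= #|J|%:R * (K * tr2 ^+ 2).
Proof.
elim/setU1_ind: J => [|J l lJ IH].
  rewrite cards0 !mul0r -[leRHS](E_cst P) le_eqVlt; apply/orP; left.
  by apply/eqP; apply: eqE => w; rewrite /D big_set0 subr0 expr0n.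
set V := (fun w => D J w - #|J|%:R * tr2).
have hV : mom P (off l) V by apply: momB => //; [exact: mDo|exact: mom_cst].
have mQ : momT (fun w => quad (Y l ^~ w)) by exact: mom_quad.
rewrite [leLHS](_ : _ = E (fun w => V w ^+ 2 + (2 * (quad (Y l ^~ w) * V w)
   + (- (2 * tr2) * V w + (quad (Y l ^~ w) ^+ 2 + (- (2 * tr2) * quad (Y l ^~ w) + tr2 ^+ 2)))))); last first.
  by apply: eqE => w; rewrite /V /D big_setU1//= cardsU1 lJ add1n -natr1; ring.
have hVT := offT hV.
have hc c := mom_cst P hT c.
rewrite !ED; do ?[exact: momX|exact: hc|apply: momD => //|apply: momZ => //|exact: momM].
rewrite !EZ//; last exact: momM.
rewrite E_quad_off// E_quad E_cst.
have := E_sqr_quad l; have := sqr_ge0 tr2; rewrite cardsU1 lJ add1n -natr1 mulrDl mul1r.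
move: IH; rewrite -/V => IH h0 h; nra.
Qed.

Let K' := 4 * K + 8.

(** The square of D + Rem is at most 4 (D - m tr2)^2 + 4 (m tr2)^2 + 2 Rem^2. With tr4 <= tr2^2 the
    three means contribute 4 K, 4 and 4, which is where K' comes from. *)
Lemma E_sqr_quad_S J (l : 'I_n) :
  E (fun w => quad (S J ^~ w) ^+ 2) <= K' * (n%:R * tr2) ^+ 2.
Proof.
pose m : R := #|J|%:R.
have mn : m <= n%:R by rewrite ler_nat -[leqRHS]card_ord max_card.
have n1 : 1 <= n%:R :> R by rewrite ler1n (leq_ltn_trans _ (ltn_ord l)).
have m0 : 0 <= m by rewrite ler0n.
have mDm : momT (fun w => D J w - m * tr2) by apply: momB => //; exact: mom_cst.
apply: (@le_trans _ _ (E (fun w => 4 * (D J w - m * tr2) ^+ 2 +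
    (4 * (m * tr2) ^+ 2 + 2 * Rem J w ^+ 2)))).
  apply: leE.
  - by apply: momX => //; exact: mom_quad.
  - do ?apply: momD => //; do ?apply: momZ => //; do ?apply: momX => //.
    exact: mom_cst.
  move=> w; have -> : quad (S J ^~ w) = D J w + Rem J w by rewrite /Rem addrC subrK.
  have := sqr_ge0 (D J w - 2 * m * tr2); have := sqr_ge0 (D J w - Rem J w); nra.
have hc c := mom_cst P hT c.
have e1 : momT (fun w => 4 * (D J w - m * tr2) ^+ 2) by apply: momZ => //; exact: momX.
have e2 : momT (fun w => 2 * Rem J w ^+ 2) by apply: momZ => //; exact: momX.
rewrite ED//; last exact: momD.
rewrite ED// E_cst !EZ//; do ?exact: momX.
have h1 := E_sqr_D J; have h2 := E_sqr_Rem J; have h3 := tr4_le l.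
rewrite -/m in h1 h2.
have t0 := sqr_ge0 tr2.
have m2 : m ^+ 2 <= n%:R ^+ 2 by rewrite lerXn2r// nnegrE.
have mm : m <= n%:R ^+ 2 by rewrite (le_trans mn)// expr2 ler_peMl.
have k1 : m * (K * tr2 ^+ 2) <= n%:R ^+ 2 * (K * tr2 ^+ 2) by rewrite ler_wpM2r// mulr_ge0.
have k2 : m ^+ 2 * tr2 ^+ 2 <= n%:R ^+ 2 * tr2 ^+ 2 by rewrite ler_wpM2r.
have k3 : m ^+ 2 * tr4 <= n%:R ^+ 2 * tr2 ^+ 2.
  by apply: ler_pM => //; [exact: sqr_ge0|exact: tr4_ge0].
rewrite /K' !exprMn; nra.
Qed.

(** * Stein's method with one observation left out *)

Section stein_bound.
Variable c : R.

Definition oth l : {set 'I_n} := finset.setC (finset.set1 l).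
Definition allI : {set 'I_n} := finset.setTfor 'I_n.

Definition sqn (y : I -> R) : R := \sum_a y a ^+ 2.
(** Norm of the sum minus the diagonal: c times the sum of <Y_k, Y_l> over ordered pairs of distinct
    k, l in [J]. *)
Definition U J w : R := c * (sqn (S J ^~ w) - \sum_(k in J) sqn (Y k ^~ w)).
Definition H l w : R := 2 * c * dot (Y l ^~ w) (S (oth l) ^~ w).
Local Notation F := (U allI).
Local Notation G l := (U (oth l)).
Local Notation q l := (fun w => quad (S (oth l) ^~ w)).

Lemma U_setU1 J l w : l \notin J ->
  U (l |: J)%SET w = U J w + 2 * c * dot (Y l ^~ w) (S J ^~ w).
Proof.
move=> lJ; rewrite /U big_setU1//=.
have -> : sqn (S (l |: J)^~ w) =
    sqn (Y l ^~ w) + 2 * dot (Y l ^~ w) (S J ^~ w) + sqn (S J ^~ w).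
  rewrite /sqn /dot mulr_sumr -!big_split/=; apply: eq_bigr => a _.
  by rewrite S_setU1//; ring.
by ring.
Qed.

Let lC l : l \notin (oth l).
Proof. by rewrite /oth !inE eqxx. Qed.

Let setTE l : allI = (l |: oth l)%SET.
Proof. by apply/setP => k; rewrite /allI /oth !inE orbN. Qed.

Lemma U_setT l w : F w = G l w + H l w.
Proof. by rewrite (setTE l) U_setU1. Qed.

Let ST l a w : S allI a w = Y l a w + S (oth l) a w.
Proof. by rewrite (setTE l) S_setU1. Qed.

Let big_allI (V : nmodType) (h : 'I_n -> V) : \sum_(l in allI) h l = \sum_l h l.
Proof. by apply: eq_bigl => l; rewrite /allI !inE. Qed.

Let sumS a w : \sum_l Y l a w = S allI a w.
Proof. by rewrite /S big_allI. Qed.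

(** Every pair of observations is counted by both of its members. Hence E F f(F) is half of sum_l E
    H_l f(F), where [H l] is centred given the rest. *)
Lemma sum_H w : \sum_l H l w = 2 * F w.
Proof.
rewrite /U big_allI /H -mulr_sumr -mulrA; congr (_ * (_ * _)).
have -> : sqn (S allI ^~ w) = \sum_l dot (Y l ^~ w) (S allI ^~ w).
  rewrite /dot exchange_big/=; apply: eq_bigr => a _.
  by rewrite -mulr_suml sumS expr2.
rewrite -sumrB; apply: eq_bigr => l _; rewrite /dot /sqn -sumrB.
by apply: eq_bigr => a _; rewrite (ST l); ring.
Qed.

(** By bilinearity the sum is (n - 2) <S, Gam S> + D with S the full sum. This expresses the total
    conditional variance through two quantities with known second moments. *)
Lemma sum_quad w : \sum_l q l w =
  (n%:R - 1) * D allI w + (n%:R - 2) * Rem allI w.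
Proof.
have h l : q l w = quad (S allI ^~ w)
    - 2 * dot (Y l ^~ w) (GS allI ^~ w) + quad (Y l ^~ w).
  have -> : quad (S allI ^~ w) = quad (fun a => Y l a w + S (oth l) a w).
    by congr quad; apply/funext => a; rewrite (ST l).
  rewrite (quadD _ _ l).
  have -> : dot (Y l ^~ w) (GS allI ^~ w) = quad (Y l ^~ w) +
      dot (Y l ^~ w) (fun a => \sum_b Gam a b * S (oth l) b w).
    rewrite /dot /quad -big_split/=; apply: eq_bigr => a _.
    have -> : GS allI a w = \sum_b Gam a b * Y l b w + \sum_b Gam a b * S (oth l) b w.
      by rewrite -big_split; apply: eq_bigr => b _; rewrite (ST l) mulrDr.
    by rewrite mulrDr; congr (_ + _); rewrite mulr_sumr; apply: eq_bigr => b _; ring.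
  by ring.
under eq_bigr do rewrite h.
rewrite !big_split/= sumrN -mulr_sumr sumr_const card_ord.
have -> : \sum_l dot (Y l ^~ w) (GS allI ^~ w) = quad (S allI ^~ w).
  rewrite /dot exchange_big/= /quad; apply: eq_bigr => a _.
  rewrite -mulr_suml sumS /GS mulr_sumr; apply: eq_bigr => b _; ring.
have -> : quad (S allI ^~ w) = Rem allI w + D allI w.
  by rewrite /Rem subrK.
have -> : \sum_l quad (Y l ^~ w) = D allI w by rewrite /D big_allI.
by rewrite -mulr_natr; ring.
Qed.

Let mSl l a : mom P (off l) (S (oth l) a).
Proof. exact: mSo. Qed.

Let mq l : momT (q l).
Proof. exact: mom_quad. Qed.

Let mU J : momT (U J).
Proof.
apply: momZ => //; apply: momB => //.
  by apply: mom_sum => // a _; exact: momX.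
by apply: mom_sum => // k _; apply: mom_sum => // a _; exact: momX.
Qed.

Let mGl l : mom P (off l) (G l).
Proof.
apply: momZ => //; apply: momB => //.
  by apply: mom_sum => // a _; apply: momX => //; exact: mSl.
apply: mom_sum => // k; rewrite /oth !inE => kl; apply: mom_sum => // a _.
by apply: momX => //; exact: hYoff.
Qed.

Let mH l : momT (H l).
Proof. by apply: momZ => //; exact: mom_dot. Qed.

(** Half the variance of [U] over the whole sample, up to the factor n / (n - 1). *)
Let u : R := c ^+ 2 * n%:R ^+ 2 * tr2.

Let n0 (l : 'I_n) : 0 < n%:R :> R.
Proof. by rewrite ltr0n (leq_ltn_trans _ (ltn_ord l)). Qed.

Lemma E_sqr_H l : E (fun w => H l w ^+ 2) <= 4 * u / n%:R.
Proof.
rewrite [leLHS](_ : _ = E (fun w => 4 * c ^+ 2 *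
   (dot (Y l ^~ w) (S (oth l) ^~ w) ^+ 2 * 1))); last first.
  by apply: eqE => w; rewrite /H; ring.
rewrite EZ; last by apply: momM => //; [apply: momX => //; exact: mom_dot|exact: mom_cst].
rewrite (E_sqr_dot_off (mSl l)); last exact: mom_cst.
have -> : E (fun w => q l w * 1) = #|oth l|%:R * tr2.
  rewrite /quad; under eq_fun do rewrite mulr1.
  rewrite Esum2; last by move=> a b; do ?apply: momM => //; exact: mom_cst.
  rewrite /tr2 mulr_sumr; apply: eq_bigr => a _; rewrite mulr_sumr; apply: eq_bigr => b _.
  under eq_fun do rewrite mulrC; rewrite EZ; last exact: momM.
  by rewrite E_SS; ring.
rewrite /u ler_pdivlMr ?(n0 l)//.
have h : #|oth l|%:R <= n%:R :> R by rewrite ler_nat -[leqRHS]card_ord max_card.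
have := tr2_ge0; have := sqr_ge0 c; have := n0 l; set N := n%:R in h *.
move=> N0 c0 t0.
have h' : #|oth l|%:R * N <= N ^+ 2 by rewrite expr2 ler_wpM2r// ltW.
have := ler_wpM2l (mulr_ge0 c0 t0) h'; nra.
Qed.

(** The conditional fourth moment is at most K times the squared conditional variance, whose mean
    [E_sqr_quad_S] bounds. *)
Lemma E_H4 l : E (fun w => H l w ^+ 4) <= 16 * K * K' * u ^+ 2 / n%:R ^+ 2.
Proof.
rewrite [leLHS](_ : _ = E (fun w => 16 * c ^+ 4 *
   dot (Y l ^~ w) (S (oth l) ^~ w) ^+ 4)); last first.
  by apply: eqE => w; rewrite /H; ring.
rewrite EZ; last by apply: momX => //; exact: mom_dot.
have h1 := E_dot4_off (mSl l).
have h2 := le_trans h1 (ler_wpM2l K0 (E_sqr_quad_S (oth l) l)).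
have c4 : 0 <= 16 * c ^+ 4 by rewrite mulr_ge0// exprn_even_ge0.
apply: le_trans (ler_wpM2l c4 h2) _; rewrite le_eqVlt; apply/orP; left; apply/eqP.
rewrite /u; field; by rewrite gt_eqF// (n0 l).
Qed.

Variables (f f' : R -> R) (M0 M1 M2 : R).
Hypothesis cf : continuous f.
Hypothesis cf' : continuous f'.
Hypothesis f_le : forall x, `|f x| <= M0.
Hypothesis f'_le : forall x, `|f' x| <= M1.
Hypothesis f'_lip : forall x y, `|f' x - f' y| <= M2 * `|x - y|.
Hypothesis f_taylor : forall x h, `|f (x + h) - f x - h * f' x| <= M2 * h ^+ 2.

Let mf Z C : C `<=` measurable -> mom P C Z -> mom P C (f \o Z).
Proof. by move=> hC hZ; exact: mom_comp hZ. Qed.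
Let mf' Z C : C `<=` measurable -> mom P C Z -> mom P C (f' \o Z).
Proof. by move=> hC hZ; exact: mom_comp hZ. Qed.

Lemma M2_ge0 : 0 <= M2.
Proof. by have := f'_lip 1 0; rewrite subr0 normr1 mulr1; apply: le_trans. Qed.

(** Expand f(F) around G_l = F - H_l. The term H_l f(G_l) has mean zero, and H_l^2 f'(G_l) has the
    mean of 4 c^2 q_l f'(G_l); what remains is cubic in H_l or of order q_l |H_l|. The free
    parameter [delta] trades these terms for moments of even order. *)
Lemma E_stein_term (delta : R) l : 0 < delta ->
  `|E (fun w => H l w * f (F w)) - E (fun w => 4 * c ^+ 2 * q l w * f' (F w))| <=
  M2 * (4 * u * delta / n%:R + 8 * K' * (K + 1) * u ^+ 2 / (n%:R ^+ 2 * delta)).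
Proof.
move=> d0.
(* [A] is the Taylor remainder, [B] the cost of returning from G_l to F inside f'. *)
pose A w := H l w * (f (F w) - f (G l w)) - H l w ^+ 2 * f' (G l w).
pose B w := 4 * c ^+ 2 * q l w * (f' (G l w) - f' (F w)).
have mfF := mf hT (mU allI); have mf'F := mf' hT (mU allI).
have mfG := mf hT (mU (oth l)); have mf'G := mf' hT (mU (oth l)).
have mqc : momT (fun w => 4 * c ^+ 2 * q l w) by exact: momZ.
have mA : momT A.
  by apply: momB => //; apply: momM => //; [exact: momB|exact: momX].
have mB : momT B by apply: momM => //; exact: momB.
have eA : E (fun w => H l w * f (G l w)) = 0.
  rewrite [LHS](_ : _ = E (fun w => 2 * c * (dot (Y l ^~ w) (S (oth l) ^~ w) * f (G l w)))); last first.
    by apply: eqE => w; rewrite /H mulrA.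
  rewrite EZ; last by apply: momM => //; exact: mom_dot.
  by rewrite (E_dot_off (mSl l) (mf (@hoff l) (mGl l))) mulr0.
have eB : E (fun w => H l w ^+ 2 * f' (G l w)) = E (fun w => 4 * c ^+ 2 * q l w * f' (G l w)).
  rewrite [LHS](_ : _ = E (fun w => 4 * c ^+ 2 *
      (dot (Y l ^~ w) (S (oth l) ^~ w) ^+ 2 * f' (G l w)))); last first.
    by apply: eqE => w; rewrite /H; ring.
  rewrite EZ; last by apply: momM => //; apply: momX => //; exact: mom_dot.
  rewrite (E_sqr_dot_off (mSl l) (mf' (@hoff l) (mGl l))) -EZ; last exact: momM.
  by apply: eqE => w; rewrite mulrA.
have -> : E (fun w => H l w * f (F w)) - E (fun w => 4 * c ^+ 2 * q l w * f' (F w)) =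
    E (fun w => A w + B w).
  have -> : E (fun w => H l w * f (F w)) =
     E (fun w => A w + H l w * f (G l w) + H l w ^+ 2 * f' (G l w)).
    by apply: eqE => w; rewrite /A; ring.
  have m1 : momT (fun w => H l w * f (G l w)) by exact: momM.
  have m2 : momT (fun w => H l w ^+ 2 * f' (G l w)) by apply: momM => //; exact: momX.
  rewrite ED//; last exact: momD.
  rewrite (ED mA m1) eA eB addr0 (ED mA mB) -addrA; congr (_ + _).
  by rewrite -EB; [apply: eqE => w; rewrite /B; ring|exact: momM..].
apply: le_trans (normE (momD hT mA mB)) _.
have mg : momT (fun w => delta * H l w ^+ 2 + (2^-1 / delta * H l w ^+ 4 +
    8 / delta * c ^+ 4 * q l w ^+ 2)).
  apply: momD => //; first by apply: momZ => //; exact: momX.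
  by apply: momD => //; apply: momZ => //; exact: momX.
apply: (@le_trans _ _ (E (fun w => M2 * (delta * H l w ^+ 2 + (2^-1 / delta * H l w ^+ 4 +
    8 / delta * c ^+ 4 * q l w ^+ 2))))).
  apply: leE; [by apply: mom_norm; exact: momD|exact: momZ|move=> w].
  apply: le_trans (ler_normD _ _) _.
  have M20 := M2_ge0.
  have hA : `|A w| <= M2 * `|H l w| ^+ 3.
    have -> : A w = H l w * (f (G l w + H l w) - f (G l w) - H l w * f' (G l w)).
      by rewrite /A (U_setT l); ring.
    rewrite normrM exprS mulrCA ler_wpM2l// (le_trans (f_taylor _ _))//.
    by rewrite real_normK ?num_real.
  have hB : `|B w| <= 4 * c ^+ 2 * `|q l w| * (M2 * `|H l w|).
    rewrite /B normrM normrM [`|4 * _|]ger0_norm; last by rewrite mulr_ge0// sqr_ge0.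
    rewrite ler_wpM2l//; first by rewrite mulr_ge0// mulr_ge0// sqr_ge0.
    by rewrite (le_trans (f'_lip _ _))// (U_setT l) opprD addNKr normrN.
  apply: le_trans (lerD hA hB) _.
  have -> : M2 * `|H l w| ^+ 3 + 4 * c ^+ 2 * `|q l w| * (M2 * `|H l w|) =
    M2 * (`|H l w| ^+ 3 + 4 * c ^+ 2 * `|q l w| * `|H l w|) by ring.
  rewrite ler_wpM2l//.
  have hx2 : H l w ^+ 2 = `|H l w| ^+ 2 by rewrite real_normK ?num_real.
  have hq2 : q l w ^+ 2 = `|q l w| ^+ 2 by rewrite real_normK ?num_real.
  have -> : H l w ^+ 4 = `|H l w| ^+ 4 by rewrite -[4%N]/(2 * 2)%N !exprM hx2.
  rewrite hx2 hq2; move: (normr_ge0 (H l w)) (normr_ge0 (q l w)).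
  move: `|H l w| `|q l w| => x y x0 y0; rewrite -subr_ge0.
  (* Both terms to be absorbed are cross terms of a square: the difference is a sum of two squares
     divided by 2 delta. *)
  have -> : delta * x ^+ 2 + (2^-1 / delta * x ^+ 4 + 8 / delta * c ^+ 4 * y ^+ 2) -
     (x ^+ 3 + 4 * c ^+ 2 * y * x) =
     2^-1 / delta * (delta * x - x ^+ 2) ^+ 2 + 2^-1 / delta * (delta * x - 4 * c ^+ 2 * y) ^+ 2.
    by field; rewrite gt_eqF.
  by rewrite addr_ge0// mulr_ge0 ?sqr_ge0// divr_ge0// ltW.
rewrite EZ// ler_wpM2l ?M2_ge0//.
have mH2 : momT (fun w => delta * H l w ^+ 2) by apply: momZ => //; exact: momX.
have mH4 : momT (fun w => 2^-1 / delta * H l w ^+ 4) by apply: momZ => //; exact: momX.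
have mq2 : momT (fun w => 8 / delta * c ^+ 4 * q l w ^+ 2) by apply: momZ => //; exact: momX.
rewrite ED//; last exact: momD.
rewrite ED// !EZ//; do ?exact: momX.
have n0l := n0 l.
have k1 := ler_wpM2l (ltW d0) (E_sqr_H l).
have k2 : 2^-1 / delta * E (fun w => H l w ^+ 4) <= 2^-1 / delta * (16 * K * K' * u ^+ 2 / n%:R ^+ 2).
  by rewrite ler_wpM2l ?divr_ge0 ?(ltW d0)//; exact: E_H4.
have k3 : 8 / delta * c ^+ 4 * E (fun w => q l w ^+ 2) <= 8 / delta * c ^+ 4 * (K' * (n%:R * tr2) ^+ 2).
  rewrite ler_wpM2l//; last exact: E_sqr_quad_S.
  by rewrite mulr_ge0 ?divr_ge0 ?(ltW d0)// exprn_even_ge0.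
apply: le_trans (lerD k1 (lerD k2 k3)) _; rewrite le_eqVlt; apply/orP; left; apply/eqP.
rewrite /u; field; by rewrite !gt_eqF.
Qed.

(** By [sum_H] the left-hand expectation is E (1 - V) f'(F) minus half the sum of the errors of
    [E_stein_term]. The first part is small because V concentrates at its mean 2 c^2 n (n - 1)
    tr2. *)
Lemma stein_bound (delta : R) : 0 < delta -> (0 < n)%N ->
  `|E (fun w => f' (F w) - F w * f (F w))| <=
  M1 * (`|1 - 2 * c ^+ 2 * n%:R * (n%:R - 1) * tr2| +
    2 * c ^+ 2 * n%:R * (Num.sqrt (n%:R * (K * tr2 ^+ 2)) + Num.sqrt (2 * n%:R ^+ 2 * tr4)))
  + M2 * (2 * u * delta + 4 * K' * (K + 1) * u ^+ 2 / (n%:R * delta)).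
Proof.
move=> d0 ngt0; have nR0 : 0 < n%:R :> R by rewrite ltr0n.
have mF := mU allI; have mfF := mf hT mF; have mf'F := mf' hT mF.
(* Half the sum of the conditional variances 4 c^2 q_l of the H_l. *)
pose V w := 2 * c ^+ 2 * \sum_l q l w.
have mV : momT V by apply: momZ => //; exact: mom_sum.
pose er l := E (fun w => H l w * f (F w)) - E (fun w => 4 * c ^+ 2 * q l w * f' (F w)).
have mqf l : momT (fun w => 4 * c ^+ 2 * q l w * f' (F w)).
  by apply: momM => //; exact: momZ.
have mHf l : momT (fun w => H l w * f (F w)) by exact: momM.
have -> : E (fun w => f' (F w) - F w * f (F w)) =
    E (fun w => (1 - V w) * f' (F w)) - 2^-1 * \sum_l er l.
  rewrite /er big_split/= sumrN -!Esum//.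
  rewrite -EB; [|exact: mom_sum..].
  rewrite -EZ; last by apply: momB => //; exact: mom_sum.
  rewrite -EB; last 2 first.
  - by apply: momM => //; apply: momB => //; exact: mom_cst.
  - by apply: momZ => //; apply: momB => //; exact: mom_sum.
  apply: eqE => w; rewrite -mulr_suml sum_H -mulr_suml -mulr_sumr /V.
  by field.
apply: le_trans (ler_normB _ _) _; apply: lerD.
  have mV1 : momT (fun w => 1 - V w) by apply: momB => //; exact: mom_cst.
  have M10 : 0 <= M1 by rewrite (le_trans _ (f'_le 0)).
  apply: le_trans (normE (momM hT mV1 mf'F)) _.
  apply: (@le_trans _ _ (E (fun w => M1 * `|1 - V w|))).
    apply: leE; [by apply: mom_norm; exact: momM|by apply: momZ => //; exact: mom_norm|].
    by move=> w; rewrite normrM mulrC; apply: ler_wpM2r => //; exact: f'_le.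
  rewrite EZ; last exact: mom_norm.
  rewrite ler_wpM2l//.
  pose Dc w := D allI w - n%:R * tr2.
  have mDc : momT Dc by apply: momB => //; exact: mom_cst.
  apply: (@le_trans _ _ (E (fun w => `|1 - 2 * c ^+ 2 * n%:R * (n%:R - 1) * tr2| +
     (2 * c ^+ 2 * n%:R * `|Dc w| + 2 * c ^+ 2 * n%:R * `|Rem allI w|)))).
    apply: leE; [exact: mom_norm| |].
      apply: momD => //; first exact: mom_cst.
      by apply: momD => //; apply: momZ => //; exact: mom_norm.
    move=> w; rewrite /V sum_quad.
    (* Centring [D] at n tr2 isolates the mean of V; the coefficients n - 1 and n - 2 are then
       bounded by n. *)
    have -> : 1 - 2 * c ^+ 2 * ((n%:R - 1) * D allI w + (n%:R - 2) * Rem allI w) =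
      (1 - 2 * c ^+ 2 * n%:R * (n%:R - 1) * tr2) -
      (2 * c ^+ 2 * (n%:R - 1) * Dc w + 2 * c ^+ 2 * (n%:R - 2) * Rem allI w).
      by rewrite /Dc; ring.
    apply: le_trans (ler_normB _ _) _; rewrite lerD2l.
    have c2 : 0 <= 2 * c ^+ 2 by rewrite mulr_ge0// sqr_ge0.
    have n1 : 1 <= n%:R :> R by rewrite ler1n.
    have hz (x y : R) : `|x| <= n%:R -> `|2 * c ^+ 2 * x * y| <= 2 * c ^+ 2 * n%:R * `|y|.
      by move=> hx; rewrite normrM ler_wpM2r// normrM (ger0_norm c2) ler_wpM2l.
    by apply: le_trans (ler_normD _ _) _; apply: lerD; apply: hz; rewrite ler_norml; lra.
  rewrite ED; [|exact: mom_cst|by apply: momD => //; apply: momZ => //; exact: mom_norm].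
  rewrite E_cst lerD2l ED; [|by apply: momZ => //; exact: mom_norm..].
  rewrite !EZ; [|exact: mom_norm..].
  rewrite mulrDr; have c2 : 0 <= 2 * c ^+ 2 * n%:R by rewrite mulr_ge0// mulr_ge0// sqr_ge0.
  have nI : #|allI|%:R = n%:R :> R by rewrite cardsT card_ord.
  apply: lerD; rewrite ler_wpM2l//; apply: le_trans (E_norm_sqrt _) _ => //; rewrite ler_wsqrtr//.
    by have := E_sqr_D allI; rewrite nI.
  by have := E_sqr_Rem allI; rewrite nI.
rewrite normrM ger0_norm//.
apply: (@le_trans _ _ (2^-1 * \sum_(l < n)
  M2 * (4 * u * delta / n%:R + 8 * K' * (K + 1) * u ^+ 2 / (n%:R ^+ 2 * delta)))).
  rewrite ler_wpM2l// (le_trans (ler_norm_sum _ _ _))//; apply: ler_sum => l _.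
  exact: E_stein_term.
rewrite sumr_const card_ord -mulr_natr le_eqVlt; apply/orP; left; apply/eqP.
by field; rewrite !gt_eqF.
Qed.

End stein_bound.
End degenerate_form.

(** * Stein's equation *)

Section calculus.
Context {R : realType}.
Implicit Types (f g : R -> R) (x y : R).

Lemma derivM f g x df dg : is_derive x 1 f df -> is_derive x 1 g dg ->
  is_derive x 1 (fun t => f t * g t) (df * g x + f x * dg).
Proof.
move=> hf hg; rewrite (_ : (fun _ => _) = f * g)//.
by apply: (is_derive_eq (is_deriveM hf hg)); rewrite /GRing.scale/=; ring.
Qed.

Lemma derivD f g x df dg : is_derive x 1 f df -> is_derive x 1 g dg ->
  is_derive x 1 (fun t => f t + g t) (df + dg).
Proof. by move=> hf hg; exact: is_deriveD. Qed.

Lemma derivB f g x df dg : is_derive x 1 f df -> is_derive x 1 g dg ->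
  is_derive x 1 (fun t => f t - g t) (df - dg).
Proof. by move=> hf hg; exact: is_deriveB. Qed.

Lemma derivZ f x df k : is_derive x 1 f df -> is_derive x 1 (fun t => k * f t) (k * df).
Proof. by move=> hf; exact: (@is_deriveZ _ _ _ f k x 1 df hf). Qed.

Lemma derivV f x df : f x != 0 -> is_derive x 1 f df ->
  is_derive x 1 (fun t => (f t)^-1) (- df / f x ^+ 2).
Proof.
move=> f0 hf; apply: (is_derive_eq (is_deriveV f0 hf)).
by rewrite /GRing.scale/=; field.
Qed.

Lemma derivX x k : is_derive x 1 (fun t : R => t ^+ k) (k%:R * x ^+ k.-1).
Proof.
elim: k => [|k IH]; first by rewrite mul0r; exact: is_derive_cst.
rewrite (_ : (fun _ => _) = (fun t => id t * t ^+ k)); last first.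
  by apply/funext => t; rewrite exprS.
apply: (is_derive_eq (derivM (is_derive_id x 1) IH)).
by case: k {IH} => [|k] /=; rewrite ?expr0 -?natr1 ?exprS; ring.
Qed.

Lemma deriv_comp f g x df dg : is_derive x 1 g dg -> is_derive (g x) 1 f df ->
  is_derive x 1 (fun t => f (g t)) (df * dg).
Proof. by move=> hg hf; exact: is_derive1_comp hf hg. Qed.

Lemma deriv_cont f df : (forall x : R, is_derive x 1 f (df x)) -> continuous f.
Proof.
by move=> h x; apply/differentiable_continuous/derivable1_diffP; case: (h x).
Qed.

Lemma deriv_MVT f df x y : x <= y ->
  (forall t : R, x <= t <= y -> is_derive t 1 f (df t)) ->
  exists2 z, x <= z <= y & f y - f x = df z * (y - x).
Proof.
move=> xy h.
have [||z] := @MVT_segment R f df x y xy.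
- by move=> t; rewrite in_itv/= => /andP[t1 t2]; apply: h; rewrite !ltW.
- apply: derivable_within_continuous => t; rewrite in_itv/= => txy.
  by case: (h t txy).
- by rewrite in_itv/= => zxy e; exists z.
Qed.

Lemma deriv_nondecr f df x y : x <= y ->
  (forall t : R, x <= t <= y -> is_derive t 1 f (df t)) ->
  (forall t, x <= t <= y -> 0 <= df t) -> f x <= f y.
Proof.
move=> xy h h0; have [z zxy e] := deriv_MVT xy h.
by rewrite -subr_ge0 e mulr_ge0// ?h0// subr_ge0.
Qed.

Lemma deriv_lip f df B x y : (forall t : R, is_derive t 1 f (df t)) ->
  (forall t, `|df t| <= B) -> `|f x - f y| <= B * `|x - y|.
Proof.
move=> h hB; wlog xy : x y / x <= y.
  by case: (leP x y) => [xy|/ltW xy]; last rewrite distrC (distrC x); exact.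
have [z _ e] := deriv_MVT xy (fun t _ => h t).
by rewrite distrC e normrM (distrC x) ler_wpM2r.
Qed.

(** The increment is s f'(z) for a z between x and x + s. Only the Lipschitz constant of f' enters,
    since the Stein solution has no second derivative at the kinks of the ramp. *)
Lemma deriv_taylor f df B x s : (forall t : R, is_derive t 1 f (df t)) ->
  (forall t u, `|df t - df u| <= B * `|t - u|) ->
  `|f (x + s) - f x - s * df x| <= B * s ^+ 2.
Proof.
move=> h hB.
have B0 : 0 <= B by have := hB 1 0; rewrite subr0 normr1 mulr1; apply: le_trans.
have [z zs e] : exists2 z, `|z - x| <= `|s| & f (x + s) - f x = df z * s.
  have [s0|/ltW s0] := leP 0 s.
    have xs : x <= x + s by rewrite lerDl.
    have [z /andP[z1 z2] e] := deriv_MVT xs (fun t _ => h t).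
    exists z; last by rewrite e; congr (_ * _); ring.
    by rewrite !ger0_norm ?subr_ge0//; lra.
  have xs : x + s <= x by rewrite gerDl.
  have [z /andP[z1 z2] e] := deriv_MVT xs (fun t _ => h t).
  exists z; last by rewrite -opprB e; ring.
  by rewrite !ler0_norm ?subr_le0//; lra.
rewrite e mulrC -mulrBr normrM.
apply: le_trans (ler_wpM2l (normr_ge0 _) (hB _ _)) _.
rewrite mulrCA ler_wpM2l// -(real_normK (num_real s)) expr2 ler_wpM2l//.
Qed.

(** Reduces the bounds on the Stein solution to its tails, at the price of a constant that is not
    explicit. *)
Lemma bounded_off_compact f (m B : R) : 0 <= m -> continuous f ->
  (forall x, m <= `|x| -> `|f x| <= B) -> exists B', forall x, `|f x| <= B'.
Proof.
move=> m0 cf hB.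
have [||c _ hc] := @EVT_max R (fun x => `|f x|) (- m) m.
- lra.
- apply: continuous_subspaceT => x; apply: (@continuous_comp _ _ _ f Num.norm).
    exact: cf.
  exact: norm_continuous.
exists (Num.max B `|f c|) => x; rewrite le_max.
have [/hB ->//|xm] := leP m `|x|; rewrite hc ?orbT// in_itv/=.
by rewrite -ler_norml ltW.
Qed.

End calculus.

(** * Normal densities and the distribution function of N(0, 1) *)

Section normal_density.
Context {R : realType}.
Implicit Types (x s : R).

Lemma normal_pdf_gt0 s x : s != 0 -> 0 < normal_pdf 0 s x.
Proof. by move=> s0; rewrite normal_pdfE// mulr_gt0// ?normal_peak_gt0// expR_gt0. Qed.

Lemma deriv_normal_pdf s x : s != 0 ->
  is_derive x 1 (normal_pdf 0 s) (- (x / s ^+ 2) * normal_pdf 0 s x).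
Proof.
move=> s0; rewrite normal_pdfE//.
have h1 : is_derive x 1 (fun t : R => (- (t - 0) ^+ 2) / (s ^+ 2 *+ 2)) (- (x / s ^+ 2)).
  rewrite (_ : (fun _ => _) = (fun t => - (s ^+ 2 *+ 2)^-1 * (id t * id t))); last first.
    by apply/funext => t; rewrite subr0 expr2 mulNr mulrC mulNr.
  apply: (is_derive_eq (derivZ _ (derivM (is_derive_id _ _) (is_derive_id _ _)))).
  by rewrite -mulr_natr; field.
have h2 := derivZ (normal_peak s) (deriv_comp h1 (is_derive_expR _)).
by apply: (is_derive_eq h2); rewrite /normal_fun; ring.
Qed.

Definition Phi x : R := fine (normal_prob 0 1 `]-oo, x]).

Lemma PhiE x : Phi x = \int[lebesgue_measure]_(t in `]-oo, x]) normal_pdf 0 1 t.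
Proof. by []. Qed.

Lemma Phi_fin x : (Phi x)%:E = normal_prob 0 1 `]-oo, x].
Proof. by rewrite /Phi fineK// fin_num_measure. Qed.

Lemma Phi_ge0 x : 0 <= Phi x.
Proof. exact: fine_ge0. Qed.

(* [normal_prob] itself, as the law of the identity, to use the library on
   cumulative distribution functions *)
Let idfN : measurableTypeR R -> R := idfun.

#[local] HB.instance Definition _ :=
  @isMeasurableFun.Build _ _ _ _ idfN (@measurable_id _ _ setT).

Let idN : {RV (normal_prob (0 : R) 1) >-> R} := idfN.

Let cdfE x : cdf idN x = (Phi x)%:E.
Proof. by rewrite Phi_fin. Qed.

Lemma cvg_Phiy : Phi x @[x --> +oo] --> (1 : R).
Proof.
have := cvg_cdfy1 idN; rewrite (_ : cdf idN = EFin \o Phi); last first.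
  by apply/funext => x; rewrite cdfE.
by move/fine_cvgP => [].
Qed.

Lemma cvg_PhiNy : Phi x @[x --> -oo] --> (0 : R).
Proof.
have := cvg_cdfNy0 idN; rewrite (_ : cdf idN = EFin \o Phi); last first.
  by apply/funext => x; rewrite cdfE.
by move/fine_cvgP => [].
Qed.

Lemma Phi_le1 x : Phi x <= 1.
Proof. by rewrite -lee_fin Phi_fin; exact: probability_le1. Qed.

Lemma integrable_pdfM (h : R -> R) (A : set R) : measurable A -> continuous h ->
  (forall x, 0 <= h x <= 1) ->
  lebesgue_measure.-integrable A (EFin \o (fun t => h t * normal_pdf 0 1 t)).
Proof.
move=> mA ch h01.
apply: (@integrableS _ _ _ _ setT) => //.
apply: le_integrable (integrable_normal_pdf 0 1) => //.
  apply/measurable_EFinP; apply: measurable_funM; last exact: measurable_normal_pdf.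
  exact: continuous_measurable_fun.
move=> x _ /=; rewrite lee_fin normrM ler_piMl//.
by have /andP[? ?] := h01 x; rewrite ger0_norm.
Qed.

(** With [h] the ramp this differentiates the numerator of the Stein solution; with h = 1 it gives
    the derivative of [Phi]. *)
Lemma deriv_int_pdf (h : R -> R) x : continuous h ->
  (forall x, 0 <= h x <= 1) ->
  is_derive x 1 (fun y => \int[lebesgue_measure]_(t in `]-oo, y]) (h t * normal_pdf 0 1 t))
    (h x * normal_pdf 0 1 x).
Proof.
move=> ch h01.
have := @continuous_FTC1 R (fun t => h t * normal_pdf 0 1 t) -oo%O x (x + 1).
rewrite ltrDl ltr01 ltNyr => /(_ isT (integrable_pdfM _ ch h01) isT) [].
- exact: measurable_itv.
- by apply: continuousM; [exact: ch|apply: continuous_normal_pdf; rewrite oner_eq0].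
- by move=> d e; apply: DeriveDef => //; rewrite -derive1E.
Qed.

Lemma deriv_Phi x : is_derive x 1 Phi (normal_pdf 0 1 x).
Proof.
have := @deriv_int_pdf (fun=> 1) x (@cst_continuous _ R 1) _.
rewrite mul1r (_ : (fun _ => _) = Phi); last first.
  apply/funext => y; rewrite PhiE; by under eq_Rintegral do rewrite mul1r.
by apply => y; rewrite ler01 lexx.
Qed.

End normal_density.

(** * Mills ratio bounds for a Gaussian tail *)

Section mills.
Context {R : realType}.
Local Notation pdf := (@normal_pdf R 0 1).
(** A Gaussian upper tail known through its derivative and its limit, so that the bounds serve both
    1 - Phi x and Phi (- x). *)
Variable Psi : R -> R.
Hypothesis dPsi : forall x : R, is_derive x 1 Psi (- pdf x).
Hypothesis Psi_ge0 : forall x, 0 <= Psi x.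
Hypothesis Psi_cvg : Psi x @[x --> +oo] --> (0 : R).

Let n10 : (1 : R) != 0. Proof. exact: oner_neq0. Qed.
Let pdf0 x : 0 < pdf x. Proof. exact: normal_pdf_gt0. Qed.

Let dpdf (x : R) : is_derive x 1 pdf (- x * pdf x).
Proof. by apply: (is_derive_eq (deriv_normal_pdf x n10)); field. Qed.

Let dquot (x : R) (k : nat) : 0 < x ->
  is_derive x 1 (fun t => pdf t * t ^- k) (- x * pdf x * x ^- k - k%:R * pdf x * x ^- k.+1).
Proof.
move=> x0; have xn0 : x ^+ k != 0 by rewrite expf_neq0// gt_eqF.
have dX : is_derive x 1 (fun t : R => t ^+ k) (k%:R * x ^+ k.-1).
  exact: derivX.
have h := derivM (dpdf x) (@derivV _ (fun t => t ^+ k) _ _ xn0 dX).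
apply: (is_derive_eq h).
case: k xn0 {dX h} => [|k] xn0; first by rewrite expr0 !mul0r !oppr0 mul0r mulr0.
rewrite /= !exprS; field; by rewrite expf_neq0 gt_eqF.
Qed.

(** [Psi x - pdf x / x] has derivative [pdf x / x ^+ 2] >= 0 and is at most [Psi y] for every y >=
    x, which tends to 0. *)
Lemma mills_le x : 0 < x -> Psi x <= pdf x * x ^- 1.
Proof.
move=> x0; rewrite -subr_le0; apply: (cvgr_to_ge Psi_cvg).
near=> y; have xy : x <= y by near: y; apply: nbhs_pinfty_ge; exact: num_real.
apply: (@le_trans _ _ (Psi y - pdf y * y ^- 1)); last first.
  by rewrite gerBl mulr_ge0 ?ltW// invr_gt0 expr1 (lt_le_trans x0).
apply: (@deriv_nondecr _ (fun t => Psi t - pdf t * t ^- 1) _ _ _ xy).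
  by move=> t /andP[xt _]; apply: derivB (dPsi t) (dquot 1 (lt_le_trans x0 xt)).
move=> t /andP[xt _]; have t0 := lt_le_trans x0 xt.
rewrite (_ : _ - _ = pdf t * t ^- 2); first by rewrite mulr_ge0 ?ltW// invr_gt0 exprn_gt0.
by field; rewrite gt_eqF.
Unshelve. all: by end_near. Qed.

(** The difference of the two sides has derivative [3 * pdf x / x ^+ 4], so it is at most its value
    far out, which is below any e > 0. *)
Lemma mills_ge x : 1 <= x -> pdf x * x ^- 1 - pdf x * x ^- 3 <= Psi x.
Proof.
move=> x1; have x0 : 0 < x by rewrite (lt_le_trans ltr01).
pose G t := pdf t * t ^- 1 - pdf t * t ^- 3 - Psi t.
rewrite -subr_le0 -/(G x); apply/ler_addgt0Pr => e e0; rewrite add0r.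
have p0 : 0 < normal_peak (1 : R) by exact: normal_peak_gt0.
(* Far enough for normal_peak / y, hence for pdf y / y, to be at most e. *)
pose y := Num.max x (normal_peak 1 / e).
have xy : x <= y by rewrite le_max lexx.
have y0 := lt_le_trans x0 xy.
apply: (@le_trans _ _ (G y)).
  apply: (@deriv_nondecr _ G (fun t => 3 * (pdf t * t ^- 4)) _ _ xy) => t /andP[xt _];
    have t0 := lt_le_trans x0 xt; last first.
    by rewrite !mulr_ge0 ?ltW// invr_gt0 exprn_gt0.
  apply: (is_derive_eq (derivB (derivB (dquot 1 t0) (dquot 3 t0)) (dPsi t))).
  by field; rewrite gt_eqF.
apply: (@le_trans _ _ (pdf y * y ^- 1)).
  rewrite /G -addrA gerDl -opprD oppr_le0 addr_ge0//.
  by rewrite mulr_ge0 ?ltW// invr_gt0 exprn_gt0.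
rewrite expr1 ler_pdivrMr// (le_trans (normal_pdf_ub _ _ n10))//.
by rewrite mulrC -ler_pdivrMr// le_max lexx orbT.
Qed.

(** With r = Psi / pdf, the three quantities are on the tails, up to sign and a factor in [0, 1],
    the Stein solution f, x f and the derivative of x f. The last one needs both Mills bounds, since
    x^2 r and x cancel up to a bounded term. *)
Lemma mills_ratio x : 1 <= x -> `|Psi x / pdf x| <= 1 /\ `|x * (Psi x / pdf x)| <= 1 /\
  `|Psi x / pdf x + x ^+ 2 * (Psi x / pdf x) - x| <= 2.
Proof.
move=> x1; have x0 : 0 < x by rewrite (lt_le_trans ltr01).
have := mills_le x0; have := mills_ge x1; have := Psi_ge0 x; have := pdf0 x.
set r := Psi x / pdf x; move=> p0 P0 h1 h2.
have PE : Psi x = r * pdf x by rewrite /r divfK// gt_eqF.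
have r0 : 0 <= r by rewrite divr_ge0// ltW.
have r1 : r * x <= 1.
  by rewrite -ler_pdivlMr// mul1r -(ler_pM2r p0) -PE mulrC -(expr1 x).
have r2 : x ^+ 2 - 1 <= r * x ^+ 3.
  have h1' : (pdf x * x ^- 1 - pdf x * x ^- 3) * x ^+ 3 <= Psi x * x ^+ 3.
    by rewrite ler_pM2r ?exprn_gt0.
  have e : (pdf x * x ^- 1 - pdf x * x ^- 3) * x ^+ 3 = (x ^+ 2 - 1) * pdf x.
    by field; rewrite gt_eqF.
  by rewrite -(ler_pM2r p0) -e mulrAC -PE.
have r3 : r <= 1 by rewrite (le_trans _ r1)// ler_peMr.
have r4 : x - 1 <= r * x ^+ 2.
  rewrite -(ler_pM2r x0) -mulrA -exprSr (le_trans _ r2)// mulrBl mul1r -expr2 lerB//.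
split; first by rewrite ger0_norm.
split; first by rewrite mulrC ger0_norm// mulr_ge0// ltW.
rewrite ler_norml; apply/andP; split; first by lra.
have : r * x ^+ 2 <= x by rewrite expr2 mulrA ler_piMl// ltW.
lra.
Qed.

End mills.

(** * Stein's equation for a ramp *)

Section stein_solution.
Context {R : realType}.
Variables (a b : R).
Hypothesis ab : a < b.
Local Notation pdf := (@normal_pdf R 0 1).
Local Notation leb := (@lebesgue_measure R).

(** It lies between the indicators of ]-oo, a] and ]-oo, b]; being Lipschitz, it has a Stein
    solution with Lipschitz derivative, unlike an indicator. *)
Definition ramp (x : R) : R := Num.min 1 (Num.max 0 ((b - x) / (b - a))).

Let ba0 : 0 < b - a. Proof. by rewrite subr_gt0. Qed.

Lemma ramp01 x : 0 <= ramp x <= 1.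
Proof. by rewrite /ramp le_min ler01/= le_max lexx/= ge_min lexx. Qed.

Lemma ramp_lip x y : `|ramp x - ramp y| <= (b - a)^-1 * `|x - y|.
Proof.
have h (u v : R) : `|Num.min 1 (Num.max 0 u) - Num.min 1 (Num.max 0 v)| <= `|u - v|.
  rewrite /Order.min /Order.max.
  case: (ltP 0 u) => ?; case: (ltP 0 v) => ?; rewrite ?ltr10;
  case: (ltP 1 u) => ?; case: (ltP 1 v) => ?;
  rewrite ler_norml; apply/andP; split;
  have := ler_norm (u - v); have := ler_norm (v - u); rewrite (distrC v); lra.
apply: le_trans (h _ _) _.
rewrite -mulrBl normrM [X in _ * X]ger0_norm ?invr_ge0 ?(ltW ba0)//.
by rewrite mulrC (_ : b - x - (b - y) = y - x) 1?distrC//; ring.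
Qed.

Lemma lip_continuous (g : R -> R) B : (forall x y, `|g x - g y| <= B * `|x - y|) ->
  continuous g.
Proof.
move=> h x; apply/cvgrPdist_lt => e e0; near=> y.
apply: le_lt_trans (h _ _) _.
have B1 : 0 < `|B| + 1 by rewrite ltr_pwDr.
apply: (@le_lt_trans _ _ ((`|B| + 1) * `|x - y|)).
  by rewrite ler_wpM2r// (le_trans (ler_norm B))// lerDl.
rewrite mulrC -ltr_pdivlMr//.
by near: y; apply: cvgr_dist_lt => //; rewrite divr_gt0.
Unshelve. all: by end_near. Qed.

Lemma continuous_ramp : continuous ramp.
Proof. exact: lip_continuous ramp_lip. Qed.

Lemma ramp_left x : x <= a -> ramp x = 1.
Proof.
move=> xa; rewrite /ramp; apply/min_idPl; rewrite le_max; apply/orP; right.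
by rewrite ler_pdivlMr// mul1r lerD2l lerN2.
Qed.

Lemma ramp_right x : b <= x -> ramp x = 0.
Proof.
move=> bx; rewrite /ramp (max_idPl _); first by apply/min_idPr.
by rewrite pmulr_lle0 ?invr_gt0// subr_le0.
Qed.

(** [stein_mean] is the mean of the ramp under N(0, 1): the integral may stop at b, where the ramp
    vanishes. [stein_f] solves f'(x) - x f(x) = ramp x - stein_mean, and [stein_df] is its
    derivative read off from this equation. *)
Definition stein_num x : R := \int[leb]_(t in `]-oo, x]) (ramp t * pdf t).
Definition stein_mean : R := stein_num b.
Definition stein_f x : R := (stein_num x - stein_mean * Phi x) / pdf x.
Definition stein_df x : R := x * stein_f x + ramp x - stein_mean.

Let n10 : (1 : R) != 0. Proof. exact: oner_neq0. Qed.
Let pdf0 x : 0 < pdf x. Proof. exact: normal_pdf_gt0. Qed.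

Let rpdf_ge0 x : 0 <= ramp x * pdf x.
Proof. by apply: mulr_ge0; [case/andP: (ramp01 x)|exact: ltW]. Qed.

Let irp (A : set R) : measurable A -> leb.-integrable A (EFin \o (fun t => ramp t * pdf t)).
Proof. by move=> mA; apply: integrable_pdfM => //; [exact: continuous_ramp|exact: ramp01]. Qed.

Let ip (A : set R) : measurable A -> leb.-integrable A (EFin \o pdf).
Proof. by move=> mA; apply: integrableS (integrable_normal_pdf 0 1). Qed.

Lemma stein_num_left x : x <= a -> stein_num x = Phi x.
Proof.
move=> xa; apply: eq_Rintegral => t; rewrite inE/= in_itv/= => tx.
by rewrite ramp_left ?mul1r// (le_trans tx).
Qed.

Lemma stein_num_right x : b <= x -> stein_num x = stein_mean.
Proof.
move=> bx; apply/eqP; rewrite -subr_eq0 /stein_mean /stein_num.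
rewrite Rintegral_itvB//; last exact: irp.
rewrite [X in X == _](_ : _ = \int[leb]_(t in `]b, x]) 0); first by rewrite Rintegral_cst ?mul0r.
apply: eq_Rintegral => t; rewrite inE/= in_itv/= => /andP[bt _].
by rewrite ramp_right ?mul0r// ltW.
Qed.

Lemma stein_mean_ge : Phi a <= stein_mean.
Proof.
rewrite -stein_num_left// -subr_ge0 /stein_mean /stein_num.
rewrite Rintegral_itvB//; [|exact: irp|by rewrite bnd_simp ltW].
by apply: Rintegral_ge0 => t _; exact: rpdf_ge0.
Qed.

Lemma stein_mean_le : stein_mean <= Phi b.
Proof.
apply: le_Rintegral => //; [exact: irp|exact: ip|move=> t _].
by apply: ler_piMl; [exact: ltW|case/andP: (ramp01 t)].
Qed.

Lemma deriv_stein_f (x : R) : is_derive x 1 stein_f (stein_df x).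
Proof.
have h1 := derivB (deriv_int_pdf x continuous_ramp ramp01) (derivZ stein_mean (deriv_Phi x)).
have p0 : pdf x != 0 by rewrite gt_eqF.
apply: (is_derive_eq (derivM h1 (derivV p0 (deriv_normal_pdf x n10)))).
rewrite /stein_df /stein_f /stein_num; field.
by rewrite p0.
Qed.

Lemma continuous_stein_f : continuous stein_f.
Proof. exact: deriv_cont deriv_stein_f. Qed.

(** [stein_df] is [xf] plus the ramp minus a constant: it is bounded once [xf] is, and Lipschitz
    once the derivative [dxf] of [xf] is bounded. *)
Let xf x := x * stein_f x.
Let dxf x := stein_f x + x ^+ 2 * stein_f x + x * (ramp x - stein_mean).

Let deriv_xf (x : R) : is_derive x 1 xf (dxf x).
Proof.
apply: (is_derive_eq (derivM (is_derive_id x 1) (deriv_stein_f x))).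
by rewrite /dxf /stein_df; ring.
Qed.

Let continuous_xf : continuous xf.
Proof. exact: deriv_cont deriv_xf. Qed.

Let continuous_dxf : continuous dxf.
Proof.
move=> x; have cf := continuous_stein_f (x := x).
apply: cvgD; [apply: cvgD => //; apply: cvgM => //; exact: exprn_continuous|].
apply: cvgM => //; apply: cvgB; [exact: continuous_ramp|exact: cvg_cst].
Qed.

Let m := Num.max 1 (Num.max `|a| `|b|).

(** Beyond [m] the ramp is constant, so the numerator of f is a multiple of a Gaussian tail:
    stein_mean (1 - Phi) on the right, (1 - stein_mean) Phi on the left. *)
Let tails x : m <= `|x| -> `|stein_f x| <= 1 /\ `|xf x| <= 1 /\ `|dxf x| <= 2.
Proof.
rewrite /m !ge_max => /and3P[x1 xa xb].
have c01 : 0 <= stein_mean <= 1.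
  rewrite (le_trans (Phi_ge0 a) stein_mean_ge).
  exact: le_trans stein_mean_le (Phi_le1 b).
have nl (c z B : R) : 0 <= c <= 1 -> `|z| <= B -> `|c * z| <= B.
  move=> /andP[c0 c1] zB; rewrite normrM ger0_norm// (le_trans _ zB)//.
  by rewrite ler_piMl.
have [x0|x0] := leP 0 x.
  rewrite ger0_norm// in x1 xa xb.
  have bx : b <= x by rewrite (le_trans (ler_norm b)).
  have [] := @mills_ratio _ (fun x => 1 - Phi x) _ _ _ x x1.
  - move=> t; have h := @derivB R (fun=> 1) Phi t 0 _ (is_derive_cst _ _ _) (deriv_Phi t).
    apply: (is_derive_eq h).
    by rewrite sub0r.
  - by move=> t; rewrite subr_ge0 Phi_le1.
  - rewrite -[X in _ --> X](subrr (1 : R)); apply: cvgB; [exact: cvg_cst|exact: cvg_Phiy].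
  rewrite /dxf /xf /stein_f stein_num_right// ramp_right//.
  have -> : (stein_mean - stein_mean * Phi x) / pdf x = stein_mean * ((1 - Phi x) / pdf x) by ring.
  set r := (1 - Phi x) / pdf x => r1 [r2 r3].
  split; first exact: nl.
  split; first by rewrite mulrCA; exact: nl.
  have -> : stein_mean * r + x ^+ 2 * (stein_mean * r) + x * (0 - stein_mean) =
    stein_mean * (r + x ^+ 2 * r - x) by ring.
  exact: nl.
rewrite ltr0_norm// in x1 xa xb.
have xa' : x <= a by have := ler_norm (- a); rewrite normrN; lra.
have [] := @mills_ratio _ (fun x => Phi (- x)) _ _ _ (- x) x1.
- move=> t; have h := deriv_comp (is_deriveNid t 1) (deriv_Phi (- t)).
  apply: (is_derive_eq h); rewrite mulrN1; congr (- _).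
  by rewrite !normal_pdfE// /normal_fun !subr0 sqrrN.
- by move=> t; exact: Phi_ge0.
- by have := @cvg_PhiNy R; rewrite cvgNy_compNP.
have e1 : pdf (- x) = pdf x by rewrite !normal_pdfE// /normal_fun !subr0 sqrrN.
rewrite opprK e1 /dxf /xf /stein_f stein_num_left// ramp_left//.
have -> : (Phi x - stein_mean * Phi x) / pdf x = (1 - stein_mean) * (Phi x / pdf x) by ring.
set r := Phi x / pdf x => r1 [r2 r3].
have c01' : 0 <= 1 - stein_mean <= 1 by lra.
split; first exact: nl.
split.
  have -> : x * ((1 - stein_mean) * r) = - ((1 - stein_mean) * (- x * r)) by ring.
  by rewrite normrN; exact: nl.
have -> : (1 - stein_mean) * r + x ^+ 2 * ((1 - stein_mean) * r) + x * (1 - stein_mean) =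
   (1 - stein_mean) * (r + (- x) ^+ 2 * r + x) by ring.
exact: nl.
Qed.

Let m0 : 0 <= m.
Proof. by rewrite /m le_max ler01. Qed.

Lemma stein_f_bounded : exists M, forall x, `|stein_f x| <= M.
Proof.
apply: (bounded_off_compact m0 continuous_stein_f) => x /tails[+ _]; exact.
Qed.

Lemma stein_df_lip : exists M, forall x y, `|stein_df x - stein_df y| <= M * `|x - y|.
Proof.
have [B hB] := bounded_off_compact m0 continuous_dxf (fun x h => proj2 (proj2 (tails h))).
exists (B + (b - a)^-1) => x y.
have -> : stein_df x - stein_df y = (xf x - xf y) + (ramp x - ramp y).
  by rewrite /stein_df /xf; ring.
rewrite (le_trans (ler_normD _ _))// mulrDl lerD//; last exact: ramp_lip.
exact: deriv_lip deriv_xf hB.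
Qed.

Lemma stein_df_bounded : exists M, forall x, `|stein_df x| <= M.
Proof.
have [B hB] := bounded_off_compact m0 continuous_xf (fun x h => proj1 (proj2 (tails h))).
exists (B + 1 + `|stein_mean|) => x; rewrite /stein_df.
rewrite (le_trans (ler_normB _ _))// lerD2r (le_trans (ler_normD _ _))// lerD//.
  exact: hB.
by case/andP: (ramp01 x) => ? ?; rewrite ger0_norm.
Qed.

End stein_solution.

(** * Gaussian moments *)

Section normal_moments.
Context {R : realType}.
Variable s : R.
Hypothesis s0 : s != 0.
Local Notation mu := (@lebesgue_measure R).
Local Notation nu := (@normal_prob R 0 s).
Local Notation pdf := (@normal_pdf R 0 s).

Let pdf_ge0 x : 0 <= pdf x. Proof. exact: normal_pdf_ge0. Qed.

Let mpdf : measurable_fun setT pdf.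
Proof. exact: measurable_normal_pdf. Qed.

(** The change of variables speaks of a Radon-Nikodym derivative; it integrates to the same measure
    as [pdf], so the two agree almost everywhere. *)
Let dens_ae : ae_eq mu setT (Radon_Nikodym_SigmaFinite.f nu mu) (EFin \o pdf).
Proof.
have dom := normal_prob_dominates 0 s.
apply: integral_ae_eq => //.
- exact: Radon_Nikodym_SigmaFinite.f_integrable.
- exact/measurable_EFinP.
- by move=> A _ mA; rewrite -Radon_Nikodym_SigmaFinite.f_integral.
Qed.

Lemma integral_normal_ge0 (f : R -> \bar R) : measurable_fun setT f ->
  (forall x, 0 <= f x)%E ->
  (\int[nu]_x f x = \int[mu]_x (f x * (pdf x)%:E))%E.
Proof.
move=> mf f0; have dom := normal_prob_dominates 0 s.
rewrite -(Radon_Nikodym_SigmaFinite.change_of_variables dom)//.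
apply: ae_eq_integral => //.
- apply: emeasurable_funM => //; apply: (measurable_int mu).
  exact: Radon_Nikodym_SigmaFinite.f_integrable.
- by apply: emeasurable_funM => //; exact/measurable_EFinP.
- exact: ae_eqe_mul2l.
Qed.

Lemma integral_normal (f : R -> R) : measurable_fun setT f ->
  (\int[nu]_x `|f x|%:E < +oo)%E ->
  (\int[nu]_x (f x)%:E = \int[mu]_x (f x * pdf x)%:E)%E.
Proof.
move=> mf finf; have dom := normal_prob_dominates 0 s.
have mE : measurable_fun setT (EFin \o f) by exact/measurable_EFinP.
have mfp : measurable_fun setT (fun x => (f x * pdf x)%:E).
  by apply/measurable_EFinP; exact: measurable_funM.
rewrite -(Radon_Nikodym_change_of_variables dom)//=; last first.
  by apply/integrableP; split.
have iRN := Radon_Nikodym_integrable (nu := charge_of_finite_measure nu) dom.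
apply: ae_eq_integral => //.
- by apply: emeasurable_funM => //; exact: (measurable_int mu iRN).
rewrite (_ : (fun x => (f x * pdf x)%:E) = (fun x => (f x)%:E * (pdf x)%:E)%E); last first.
  by apply/funext => x; rewrite EFinM.
apply: ae_eqe_mul2l => /=.
rewrite Radon_NikodymE//=; case: cid => /= h [h1 h2 h3].
apply: integral_ae_eq => //=; first exact/measurable_EFinP.
by move=> A AT mA; rewrite -h3.
Qed.

(** Doubling the standard deviation absorbs a power: the exponentials differ by the factor exp(- r
    x^2) with r = 1/(2 s^2) - 1/(8 s^2), and (r x^2)^k <= k! exp(r x^2). *)
Lemma normal_pdf_expX (k : nat) : exists C : R, forall x,
  x ^+ (2 * k) * pdf x <= C * normal_pdf 0 (2 * s) x.
Proof.
have s20 : 2 * s != 0 by rewrite mulf_neq0.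
pose r := 3 / 8 / s ^+ 2.
have ss0 : 0 < s ^+ 2 by rewrite exprn_even_gt0.
have r0 : 0 < r by rewrite /r divr_gt0// divr_gt0.
exists (k`!%:R / r ^+ k * normal_peak s / normal_peak (2 * s)) => x.
have e1 : pdf x = normal_peak s * (expR (- (r * x ^+ 2)) * normal_fun 0 (2 * s) x).
  rewrite normal_pdfE//; congr (_ * _); rewrite /normal_fun -expRD; congr expR.
  by rewrite /r subr0 -[s ^+ 2 *+ 2]mulr_natr -[(2 * s) ^+ 2 *+ 2]mulr_natr; field.
rewrite e1 (_ : normal_pdf 0 (2 * s) x = normal_peak (2 * s) * normal_fun 0 (2 * s) x); last first.
  by rewrite normal_pdfE.
have p0 := normal_peak_gt0 s0; have p20 := normal_peak_gt0 s20.
have f0 := normal_fun_ge0 0 (2 * s) x.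
have rk0 : r ^+ k != 0 by rewrite expf_neq0// gt_eqF.
have pk20 : normal_peak (2 * s) != 0 by rewrite gt_eqF.
have -> : k`!%:R / r ^+ k * normal_peak s / normal_peak (2 * s) *
    (normal_peak (2 * s) * normal_fun 0 (2 * s) x) =
    k`!%:R / r ^+ k * (normal_peak s * normal_fun 0 (2 * s) x).
  by field; rewrite ?rk0 ?pk20.
have -> : x ^+ (2 * k) * (normal_peak s * (expR (- (r * x ^+ 2)) * normal_fun 0 (2 * s) x)) =
  x ^+ (2 * k) * expR (- (r * x ^+ 2)) * (normal_peak s * normal_fun 0 (2 * s) x) by ring.
apply: ler_wpM2r; first by rewrite mulr_ge0// ltW.
rewrite expRN ler_pdivrMr ?expR_gt0// mulrC mulrA ler_pdivlMr ?exprn_gt0//.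
rewrite exprM -exprMn mulrC (mulrC (x ^+ 2)).
have y0 : 0 <= r * x ^+ 2 by rewrite mulr_ge0 ?sqr_ge0// ltW.
rewrite -ler_pdivrMl ?ltr0n ?fact_gt0// [_^-1 * _]mulrC.
case: k rk0 => [|k] _; last first.
  by have := expR_ge1Dxn k y0; lra.
by rewrite expr0 fact0 divr1; have := expR_ge1Dx (r * x ^+ 2); lra.
Qed.

Let mnormX k : measurable_fun setT (fun x : R => `|x| ^+ k).
Proof.
apply: measurable_funX; apply: continuous_measurable_fun; exact: norm_continuous.
Qed.

Lemma integrable_normal_mom (k : nat) :
  mu.-integrable setT (fun x => (`|x| ^+ k * pdf x)%:E).
Proof.
have [C hC] := normal_pdf_expX k.
have i1 := integrable_normal_pdf (0 : R) s.
have i2 := integrable_normal_pdf (0 : R) (2 * s).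
apply: le_integrable (integrableD measurableT i1 (integrableZl measurableT C i2)) => //.
  by apply/measurable_EFinP; apply: measurable_funM => //; exact: mnormX.
move=> x _; rewrite -EFinM -EFinD [leLHS]/= [leRHS]/= lee_fin.
apply: le_trans (ler_norm _); rewrite ger0_norm; last by rewrite mulr_ge0.
apply: (@le_trans _ _ ((1 + x ^+ (2 * k)) * pdf x)).
  rewrite ler_wpM2r// exprM -(real_normK (num_real x)) -exprM mulnC exprM.
  have := exprn_ge0 k (normr_ge0 x); nra.
by rewrite mulrDl mul1r lerD2l.
Qed.

Lemma normal_mom_fin (k : nat) : (\int[nu]_x (`|x| ^+ k)%:E < +oo)%E.
Proof.
rewrite integral_normal_ge0//; last by apply/measurable_EFinP; exact: mnormX.
have /integrableP[_] := integrable_normal_mom k.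
under eq_integral do rewrite gee0_abs ?lee_fin ?mulr_ge0//.
by under [in X in _ -> X]eq_integral do rewrite -EFinM.
Qed.

Let dG (m : nat) (x : R) : is_derive x 1 (fun t => t ^+ m * pdf t)
  (m%:R * x ^+ m.-1 * pdf x - x ^+ m.+1 / s ^+ 2 * pdf x).
Proof.
apply: (is_derive_eq (derivM (derivX x m) (deriv_normal_pdf x s0))).
by rewrite [x ^+ m.+1]exprSr; field.
Qed.

Let cpow (m : nat) : continuous (fun x : R => x ^+ m).
Proof. exact: deriv_cont (fun x => derivX x m). Qed.

Let cpdf : continuous pdf.
Proof. exact: continuous_normal_pdf. Qed.

Let mpow m : measurable_fun setT (fun x : R => x ^+ m * pdf x).
Proof. by apply: measurable_funM => //; exact: measurable_funX. Qed.

Let imom m : mu.-integrable setT (fun x => (x ^+ m * pdf x)%:E).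
Proof.
apply: le_integrable (integrable_normal_mom m) => //.
  by apply/measurable_EFinP; exact: mpow.
by move=> x _ /=; rewrite lee_fin !normrM !normrX normr_id.
Qed.

(** The boundary terms of the integration by parts on [-n, n], with [u] equal to n or -n. *)
Let pow_pdf_cvg m (u : R^nat) : (forall n, `|u n| = n%:R) ->
  (u n) ^+ m * pdf (u n) @[n --> \oo] --> (0 : R).
Proof.
move=> hu; have [C hC] := normal_pdf_expX m.+1.
have s20 : 2 * s != 0 by rewrite mulf_neq0.
pose B := `|C| * normal_peak (2 * s).
have h n : (0 < n)%N -> `|u n ^+ m * pdf (u n)| <= B / n%:R.
  move=> n0; have nR : 0 < n%:R :> R by rewrite ltr0n.
  rewrite ler_pdivlMr// normrM normrX hu [`|pdf _|]ger0_norm//.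
  apply: (@le_trans _ _ (n%:R ^+ (2 * m.+1) * pdf (u n))).
    rewrite mulrAC ler_wpM2r// -exprSr ler_weXn2l ?ler1n//.
    by rewrite mulnC muln2 -addnn leq_addr.
  have -> : (n%:R : R) ^+ (2 * m.+1) = u n ^+ (2 * m.+1).
    by rewrite !exprM -hu real_normK ?num_real.
  apply: le_trans (hC _) _; rewrite /B.
  apply: (@le_trans _ _ (`|C| * normal_pdf 0 (2 * s) (u n))).
    by rewrite ler_wpM2r ?normal_pdf_ge0// ler_norm.
  by rewrite ler_wpM2l// normal_pdf_ub.
apply/cvgr0Pnorm_lt => e e0; near=> n.
have n0 : (0 < n)%N by near: n; exists 1%N.
apply: le_lt_trans (h _ n0) _.
rewrite ltr_pdivrMr ?ltr0n// mulrC -ltr_pdivrMr//.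
by near: n; exact: nbhs_infty_gtr.
Unshelve. all: by end_near. Qed.

(** Integration by parts: [D] is the derivative of [x ^+ m * pdf x], and its integrals over [-n, n]
    are differences of boundary terms that tend to 0. For m = 0 the truncated predecessor is
    harmless, its coefficient being 0. *)
Lemma normal_mom_rec m : \int[mu]_x (x ^+ m.+1 * pdf x) =
  m%:R * s ^+ 2 * \int[mu]_x (x ^+ m.-1 * pdf x).
Proof.
pose D x := m%:R * (x ^+ m.-1 * pdf x) - (s ^+ 2)^-1 * (x ^+ m.+1 * pdf x).
have ss0 : s ^+ 2 != 0 by rewrite expf_neq0.
have iD : mu.-integrable setT (EFin \o D).
  have := integrableB measurableT (integrableZl measurableT m%:R (imom m.-1))
    (integrableZl measurableT (s ^+ 2)^-1 (imom m.+1)).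
  by apply: eq_integrable => // x _ /=; rewrite /D EFinB !EFinM.
suff : \int[mu]_x D x = 0.
  rewrite /D RintegralB//; last 2 first.
  - by have := integrableZl measurableT m%:R (imom m.-1); exact: eq_integrable.
  - by have := integrableZl measurableT (s ^+ 2)^-1 (imom m.+1); exact: eq_integrable.
  rewrite !RintegralZl//; [|exact: imom..].
  move/eqP; rewrite subr_eq0 => /eqP h.
  by rewrite -mulrA mulrCA h mulVKf.
pose fn (n : nat) (x : R) : \bar R := ((EFin \o D) x * (\1_`[- n%:R, n%:R] x)%:E)%E.
have mD : measurable_fun setT D by case/integrableP : iD => /measurable_EFinP.
have mfn n : measurable_fun setT (fn n).
  apply: emeasurable_funM; first exact/measurable_EFinP.
  by apply/measurable_EFinP; exact: measurable_indic.
have cvfn : (\int[mu]_x fn n x @[n --> \oo] --> \int[mu]_x (D x)%:E)%E.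
  have [] := @dominated_convergence _ _ _ mu setT measurableT fn (EFin \o D) (fun x => `|D x|%:E) mfn _ _ _ _ => //.
  - exact/measurable_EFinP.
  - apply: aeW => x _; apply: cvg_near_cst; near=> n.
    rewrite /fn indicE mem_set ?mule1//= in_itv/= -ler_norml.
    by near: n; exact: nbhs_infty_ger.
  - by apply: eq_integrable (integrable_abse iD).
  - apply: aeW => x n _; rewrite /fn abseM/= -EFinM lee_fin ler_piMr//.
    by rewrite indicE; case: (_ \in _); rewrite ?normr1 ?normr0.
have fnE n : (0 < n)%N -> (\int[mu]_x fn n x = (n%:R ^+ m * pdf n%:R - (- n%:R) ^+ m * pdf (- n%:R))%:E)%E.
  move=> n0; rewrite /fn.
  have -> : (\int[mu]_x ((EFin \o D) x * (\1_`[- n%:R, n%:R] x)%:E) =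
      \int[mu]_(x in `[(- n%:R)%R, n%:R%R]) (D x)%:E)%E.
    rewrite [RHS]integral_mkcond; apply: eq_integral => x _.
    by rewrite patchE indicE; case: (_ \in _); rewrite ?mule1 ?mule0.
  rewrite -[in RHS]/((fun t => t ^+ m * pdf t) n%:R) -[X in _ - X]/((fun t => t ^+ m * pdf t) (- n%:R)) EFinB.
  apply: (@continuous_FTC2 R D (fun t => t ^+ m * pdf t)).
  - by rewrite gtrN// ltr0n.
  - apply: continuous_subspaceT => x.
    by apply: cvgB; apply: cvgM; [exact: cvg_cst|apply: cvgM; [exact: cpow|exact: cpdf]|
       exact: cvg_cst|apply: cvgM; [exact: cpow|exact: cpdf]].
  - have cG : continuous (fun t : R => t ^+ m * pdf t) by exact: deriv_cont (dG m).
    split.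
    + by move=> x _; case: (dG m x).
    + exact/cvg_at_right_filter/cG.
    + exact/cvg_at_left_filter/cG.
  - move=> x _; rewrite derive1E; have [_ ->] := dG m x; rewrite /D; ring.
have lim0 : (\int[mu]_x fn n x @[n --> \oo] --> 0%:E)%E.
  apply: (@cvg_trans _ ((n%:R ^+ m * pdf n%:R - (- n%:R) ^+ m * pdf (- n%:R))%:E @[n --> \oo])%E).
    apply: near_eq_cvg; near=> n; rewrite fnE//; near: n; by exists 1%N.
  apply: cvg_EFin; first by near=> n.
  rewrite -[X in _ --> X](subrr (0 : R)).
  apply: cvgB; apply: pow_pdf_cvg => n; rewrite ?normrN ger0_norm//.
by rewrite /Rintegral (cvg_unique _ cvfn lim0).
Unshelve. all: by end_near. Qed.

End normal_moments.

(** * Powers of linear forms span the polynomials *)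

Section polarization.
Context {R : realType} {p : nat}.
Local Notation mp := (mpoly p R).

Definition lin (v : 'I_p -> R) : mp := \sum_i v i *: mpolyX R (mnm1 i).

Lemma linD v w (t : R) : lin (fun i => v i + t * w i) = lin v + t *: lin w.
Proof.
rewrite /lin scaler_sumr -big_split/=; apply: eq_bigr => i _.
by rewrite scalerDl scalerA.
Qed.

Lemma linX i : lin (fun j => (j == i)%:R) = mpolyX R (mnm1 i).
Proof.
rewrite /lin (bigD1 i)//= eqxx scale1r big1 ?addr0// => j /negPf ->.
by rewrite scale0r.
Qed.

Lemma mderiv_lin j v : mderiv j (lin v) = (v j)%:A.
Proof.
rewrite /lin linear_sum/= (bigD1 j)//= big1 ?addr0 => [|i ij].
  rewrite linearZ/= mderivX mnm1E eqxx scale1r.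
  have -> : mnm_sub (mnm1 j) (mnm1 j) = mnm0 :> multinom p.
    by apply/mnmP => k; rewrite mnmBE mnm0E subnn.
  by rewrite mpolyX0.
by rewrite linearZ/= mderivX mnm1E (negPf ij) scale0r scaler0.
Qed.

Lemma mderivXn j (f : mp) m : mderiv j (f ^+ m) = m%:R *: (mderiv j f * f ^+ m.-1).
Proof.
elim: m => [|m IH]; first by rewrite expr0 mulr0n scale0r -[1]/(mpolyC p 1) mderivC.
rewrite exprS mderivM IH -scalerAr mulrCA; case: m {IH} => [|m].
  by rewrite expr0 scale0r addr0 scale1r.
by rewrite /= -exprS -[in RHS]natr1 scalerDl scale1r addrC.
Qed.

(** A nonzero polynomial cannot have all of 0, 1, ..., up to its degree as roots. *)
Lemma poly_fun_eq0 (n : nat) (c : nat -> R) :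
  (forall t : R, \sum_(i < n) c i * t ^+ i = 0) -> forall i, (i < n)%N -> c i = 0.
Proof.
move=> h i ilt; pose q := \poly_(i < n) c i.
suff q0 : q = 0 by have := coef_poly n c i; rewrite -/q q0 coef0 ilt.
apply/eqP; rewrite -size_poly_eq0; apply: contraT => sz.
pose rs := [seq (k%:R : R) | k <- iota 0 (size q)].
have /(_ rs) := @max_poly_roots R q; rewrite -size_poly_eq0 => /(_ sz) hh.
suff : (size rs < size q)%N by rewrite size_map size_iota ltnn.
apply: hh.
  apply/allP => _ /mapP[k _ ->]; apply/eqP; rewrite horner_poly; exact: h.
rewrite map_inj_uniq ?iota_uniq// => a b /eqP; rewrite eqr_nat => /eqP; exact.
Qed.

Variable La : mp -> R.
Hypothesis LaZD : forall a f g, La (a *: f + g) = a * La f + La g.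

Let La0 : La 0 = 0.
Proof. by have := LaZD (-1) 0 0; rewrite scaler0 addr0 mulN1r addNr. Qed.

Let LaD f g : La (f + g) = La f + La g.
Proof. by have := LaZD 1 f g; rewrite scale1r mul1r. Qed.

Let LaZ a f : La (a *: f) = a * La f.
Proof. by have := LaZD a f 0; rewrite !addr0 La0 addr0. Qed.

Let La_sum (I : Type) (r : seq I) (F : I -> mp) :
  La (\sum_(i <- r) F i) = \sum_(i <- r) La (F i).
Proof. exact: (big_morph La LaD La0). Qed.

Hypothesis La_pow : forall v m, La (lin v ^+ m) = 0.

(* comparing the coefficients of [t] in the expansion of [(v + t w)^m] *)
Let La_prod (s : seq ('I_p -> R)) : forall v m, La ((\prod_(w <- s) lin w) * lin v ^+ m) = 0.
Proof.
elim: s => [|w s IH] v m; first by rewrite big_nil mul1r.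
set A := \prod_(w <- s) lin w in IH.
pose c i := La (A * (lin v ^+ (m.+1 - i) * lin w ^+ i)) *+ 'C(m.+1, i).
have h t : \sum_(i < m.+2) c i * t ^+ i = 0.
  rewrite -[RHS](IH (fun i => v i + t * w i) m.+1) linD exprDn mulr_sumr La_sum.
  apply: eq_bigr => i _; rewrite mulrnAr exprZn -!scalerAr.
  by rewrite -scaler_nat !LaZ /c -mulr_natl; ring.
have := poly_fun_eq0 h (isT : 1 < m.+2)%N.
rewrite /c subn1 /= bin1 expr1 => /eqP; rewrite mulrn_eq0 /= => /eqP <-.
by rewrite big_cons -/A; congr La; rewrite [lin w * A]mulrC mulrA mulrAC.
Qed.

(** Monomials are products of linear forms, and [La_prod] reduces these to powers. Powers are what
    is accessible, since a Gaussian vector is given by the laws of its linear combinations. *)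
Lemma polarization g : La g = 0.
Proof.
have hX m : exists s, mpolyX R m = \prod_(w <- s) lin w.
  rewrite mpolyXE_id.
  apply: (big_ind (fun f => exists s, f = \prod_(w <- s) lin w)).
  - by exists [::]; rewrite big_nil.
  - by move=> f h [s ->] [t ->]; exists (s ++ t); rewrite big_cat.
  - move=> i _; exists (nseq (m i) (fun j => (j == i)%:R)).
    by rewrite big_nseq linX -Monoid.iteropE.
elim/mpolyind: g => [|c m g _ _ IH]; first exact: La0.
have [s e] := hX m; rewrite LaZD IH addr0.
by have := La_prod s (fun=> 0) 0; rewrite expr0 mulr1 -e => ->; rewrite mulr0.
Qed.

End polarization.

(** * Stationarity of the Ornstein-Uhlenbeck generator *)

Section stationarity.
Context {R : realType} {p : nat}.
Local Notation mp := (mpoly p R).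
Variables (L : mp -> R) (Sg : 'I_p -> 'I_p -> R).
Hypothesis LZD : forall a f g, L (a *: f + g) = a * L f + L g.
Hypothesis L_pow : forall v m, L (lin v ^+ m.+1) =
  m%:R * (\sum_i \sum_j v i * v j * Sg i j) * L (lin v ^+ m.-1).

(* the generator of the Ornstein-Uhlenbeck semigroup with covariance [Sg] *)
Definition OU (g : mp) : mp :=
  \sum_i \sum_j Sg i j *: mderiv i (mderiv j g) - \sum_i mpolyX R (mnm1 i) * mderiv i g.

Lemma OU_ZD a f g : OU (a *: f + g) = a *: OU f + OU g.
Proof.
rewrite /OU scalerBr !scaler_sumr addrACA -opprD; congr (_ - _).
  rewrite -big_split; apply: eq_bigr => i _; rewrite scaler_sumr -big_split.
  apply: eq_bigr => j _ /=; rewrite !(mderivD, mderivZ) scalerDr; congr (_ + _).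
  by rewrite !scalerA mulrC.
rewrite -big_split; apply: eq_bigr => i _ /=.
by rewrite mderivD mderivZ mulrDr scalerAr.
Qed.

Lemma OU_pow v m : OU (lin v ^+ m) =
  (m%:R * m.-1%:R * (\sum_i \sum_j v i * v j * Sg i j)) *: lin v ^+ m.-2 - m%:R *: lin v ^+ m.
Proof.
rewrite /OU; congr (_ - _).
  rewrite mulr_sumr scaler_suml; apply: eq_bigr => i _.
  rewrite mulr_sumr scaler_suml; apply: eq_bigr => j _.
  rewrite mderivXn mderivZ mderiv_lin -scalerAl mul1r mderivZ mderivXn mderiv_lin.
  rewrite -scalerAl mul1r !scalerA; congr (_ *: _); ring.
under eq_bigr do rewrite mderivXn mderiv_lin -scalerAl mul1r -!scalerAr.
under eq_bigr do rewrite scalerAl.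
rewrite -scaler_sumr -mulr_suml; case: m => [|m]; first by rewrite !scale0r.
by rewrite /= exprS.
Qed.

(** By linearity powers of linear forms suffice; there the second-order part and the drift cancel by
    the moment recursion [L_pow]. This is Gaussian integration by parts on polynomials, singular
    covariances included. *)
Lemma OU_stationary g : L (OU g) = 0.
Proof.
move: g; apply: polarization => [a f g|v m]; first by rewrite OU_ZD LZD.
rewrite OU_pow -scaleNr addrC LZD.
have L0 : L 0 = 0 by have := LZD (-1) 0 0; rewrite scaler0 addr0 mulN1r addNr.
rewrite -[X in _ + L X]addr0 LZD L0 addr0.
by case: m => [|m]; rewrite ?mul0r ?oppr0 ?mul0r ?addr0// L_pow /=; ring.
Qed.

End stationarity.

(** * Moments of Gaussian vectors and of their quadratic forms *)

Section gaussian_law.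
Context d (T : measurableType d) (R : realType) (P : probability T R).
Local Notation E := (E P).
Local Notation momT := (mom P measurable).

Section normal_rv.
Variables (Z : T -> R) (v : R).
Hypothesis mZ : measurable_fun setT Z.
Hypothesis v0 : 0 <= v.
Hypothesis lawZ : forall A : set R, measurable A ->
  P [set w | A (Z w)] = centered_normal v A.

(** The same function, typed so that its law lives on the measurable space of [normal_prob]. *)
Let Zm : T -> measurableTypeR R := Z.

#[local] HB.instance Definition _ := @isMeasurableFun.Build _ _ _ _ Zm mZ.

Let Z' : {mfun T >-> measurableTypeR R} := Zm.

Let intZ (f : R -> R) : measurable_fun setT f ->
  (\int[P]_w `|f (Z w)|%:E)%E = if v == 0 then `|f 0|%:E else
     (\int[normal_prob 0 (Num.sqrt v)]_x `|f x|%:E)%E.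
Proof.
move=> mf; have mnf : measurable_fun setT (fun x => `|f x|%:E).
  by apply/measurable_EFinP; exact: measurableT_comp.
rewrite -(ge0_integral_distribution Z' mnf)//.
have [v00|vn0] := eqVneq v 0.
  rewrite (@eq_measure_integral _ _ _ _ (dirac (0 : measurableTypeR R))); last first.
    by move=> A mA _; rewrite -[LHS]/(P [set w | A (Z w)]) lawZ// /centered_normal v00 eqxx.
  by rewrite integral_dirac// diracT mul1e.
apply: eq_measure_integral => A mA _.
by rewrite -[LHS]/(P [set w | A (Z w)]) lawZ// /centered_normal (negPf vn0).
Qed.

Let sqv0 : v != 0 -> Num.sqrt v != 0.
Proof. by move=> vn0; rewrite sqrtr_eq0 -ltNge lt_neqAle eq_sym vn0. Qed.

Lemma mom_normal : momT Z.
Proof.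
split.
  move=> _ B mB; rewrite setTI; apply: sub_sigma_algebra.
  by rewrite -[X in measurable X]setTI; exact: mZ.
move=> m; apply/integrableP; split.
  by apply/measurable_EFinP; apply: measurable_funX; exact: measurableT_comp.
have -> : (\int[P]_w `|(EFin \o (fun w => (`|Z w| ^+ m)%R)) w| = \int[P]_w `|(Z w) ^+ m|%:E)%E.
  by apply: eq_integral => w _ /=; rewrite !normrX normr_id.
rewrite (intZ (f := fun x => x ^+ m)); last exact: measurable_funX.
case: eqVneq => [_|vn0]; first exact: ltry.
under eq_integral do rewrite normrX.
exact: normal_mom_fin (sqv0 vn0) m.
Qed.

Lemma E_normal m : E (fun w => Z w ^+ m) = if v == 0 then 0 ^+ m else
  \int[lebesgue_measure]_x (x ^+ m * normal_pdf 0 (Num.sqrt v) x).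
Proof.
have mX : measurable_fun setT (fun x : R => x ^+ m) by exact: measurable_funX.
have iZ : P.-integrable setT (EFin \o (fun w => Z w ^+ m)).
  exact: (mom_integrable (@subset_refl _ measurable) (momX (@subset_refl _ measurable) m mom_normal)).
have -> : E (fun w => Z w ^+ m) = \int[distribution P Z']_x (x ^+ m).
  rewrite /E /Rintegral (@integral_distribution _ _ _ _ _ P Z' (fun x => (x ^+ m)%:E))//.
  by apply/measurable_EFinP.
rewrite /Rintegral.
case: eqVneq => [v00|vn0].
  rewrite (@eq_measure_integral _ _ _ _ (dirac (0 : measurableTypeR R))); last first.
    by move=> A mA _; rewrite -[LHS]/(P [set w | A (Z w)]) lawZ// /centered_normal v00 eqxx.
  by rewrite integral_dirac ?diracT ?mul1e//; exact/measurable_EFinP.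
rewrite (@eq_measure_integral _ _ _ _ (normal_prob 0 (Num.sqrt v))); last first.
  by move=> A mA _; rewrite -[LHS]/(P [set w | A (Z w)]) lawZ// /centered_normal (negPf vn0).
rewrite integral_normal ?sqv0//.
under eq_integral do rewrite normrX.
exact: normal_mom_fin (sqv0 vn0) m.
Qed.

Lemma E_normal_rec m :
  E (fun w => Z w ^+ m.+1) = m%:R * v * E (fun w => Z w ^+ m.-1).
Proof.
rewrite !E_normal; case: eqVneq => [v00|vn0].
  by rewrite v00 mulr0 mul0r exprS mul0r.
by rewrite normal_mom_rec ?sqv0// sqr_sqrtr.
Qed.
End normal_rv.

Section normal_vector.
Variables (p : nat) (Sg : 'M[R]_p) (X : {RV P >-> p.-tuple R}).
Hypothesis SgT : Sg^T = Sg.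
Hypothesis Sg_ge0 : forall u : 'rV[R]_p, 0 <= (u *m Sg *m u^T) 0 0.
Hypothesis gX : gaussian_vector P Sg X.
Local Notation mp := (mpoly p R).
Local Notation hT := (@subset_refl _ (@measurable _ T)).

Definition crd (i : 'I_p) (w : T) : R := tnth (X w) i.

Let SgC i j : Sg i j = Sg j i.
Proof. by rewrite -{1}SgT mxE. Qed.

Let quadE (v : 'I_p -> R) :
  ((\row_i v i) *m Sg *m (\row_i v i)^T) 0 0 = \sum_i \sum_j v i * v j * Sg i j.
Proof.
rewrite mxE exchange_big/=; apply: eq_bigr => j _; rewrite !mxE mulr_suml.
by apply: eq_bigr => i _; rewrite !mxE; ring.
Qed.

Let mcrd i : measurable_fun setT (crd i).
Proof. exact: (measurableT_comp (measurable_tnth i) (measurable_funPT X)). Qed.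

Let mlf (v : 'I_p -> R) : measurable_fun setT (fun w => \sum_i v i * crd i w).
Proof. by apply: measurable_sum => i; apply: measurable_funM. Qed.

Let lawlf (v : 'I_p -> R) (A : set R) : measurable A ->
  P [set w | A (\sum_i v i * crd i w)] = centered_normal (\sum_i \sum_j v i * v j * Sg i j) A.
Proof.
move=> mA; rewrite -quadE -gX//; congr (P _); apply/funext => w /=.
by congr A; apply: eq_bigr => i _; rewrite mxE.
Qed.

Let q0 (v : 'I_p -> R) : 0 <= \sum_i \sum_j v i * v j * Sg i j.
Proof. by rewrite -quadE. Qed.

Lemma mom_crd i : momT (crd i).
Proof.
have := mom_normal (mlf (fun j => (j == i)%:R)) (q0 _) (@lawlf _).
rewrite (_ : (fun _ => _) = crd i)//; apply/funext => w.
by rewrite (bigD1 i)//= eqxx mul1r big1 ?addr0// => j /negPf ->; rewrite mul0r.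
Qed.

Definition ev (g : mp) (w : T) : R := meval (crd ^~ w) g.

Lemma mom_ev g : momT (ev g).
Proof.
have -> : ev g = fun w => \sum_(m <- msupp g) mcoeff m g * \prod_i crd i w ^+ m i.
  by apply/funext => w; rewrite /ev mevalE.
apply: mom_sum => // m _; apply: momZ => //; apply: mom_prod => // i _.
by apply: momX => //; exact: mom_crd.
Qed.

Let L g := E (ev g).

Let LZD a f g : L (a *: f + g) = a * L f + L g.
Proof.
rewrite /L -EZ; last exact: mom_ev.
rewrite -ED; [|by apply: momZ => //; exact: mom_ev|exact: mom_ev].
by apply: eqE => w; rewrite /ev mevalD mevalZ.
Qed.

Lemma ev_lin v w : ev (lin v) w = \sum_i v i * crd i w.
Proof.
rewrite /ev /lin raddf_sum/=; apply: eq_bigr => i _.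
by rewrite mevalZ mevalXU.
Qed.

Let L_pow v m : L (lin v ^+ m.+1) =
  m%:R * (\sum_i \sum_j v i * v j * Sg i j) * L (lin v ^+ m.-1).
Proof.
have h k : L (lin v ^+ k) = E (fun w => (\sum_i v i * crd i w) ^+ k).
  by apply: eqE => w; rewrite /ev rmorphXn/= -[meval _ _]/(ev (lin v) w) ev_lin.
by rewrite !h (E_normal_rec (mlf v) (q0 v) (@lawlf v)).
Qed.

Let OUx := OU (fun i j => Sg i j).

Lemma E_OU g : E (ev (OUx g)) = 0.
Proof. exact: (OU_stationary LZD L_pow). Qed.

(** The carre du champ of the generator: by [OU_M] it measures the failure of the Leibniz rule for
    [OU]. *)
Definition Gm (f g : mp) : mp := \sum_i \sum_j Sg i j *: (mderiv i f * mderiv j g).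

Lemma OU_M f g : OUx (f * g) = f * OUx g + g * OUx f + 2 *: Gm f g.
Proof.
rewrite /OUx /OU.
have e1 : \sum_i mpolyX R (mnm1 i) * mderiv i (f * g) =
   f * (\sum_i mpolyX R (mnm1 i) * mderiv i g) + g * (\sum_i mpolyX R (mnm1 i) * mderiv i f).
  rewrite !mulr_sumr -big_split; apply: eq_bigr => i _ /=; rewrite mderivM; ring.
have e2 : \sum_i \sum_j Sg i j *: mderiv i (mderiv j (f * g)) =
   f * (\sum_i \sum_j Sg i j *: mderiv i (mderiv j g)) +
   g * (\sum_i \sum_j Sg i j *: mderiv i (mderiv j f)) + 2 *: Gm f g.
  have -> : 2 *: Gm f g = Gm f g + \sum_i \sum_j Sg i j *: (mderiv j f * mderiv i g).
    rewrite scaler_nat mulr2n; congr (_ + _); rewrite /Gm exchange_big/=.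
    by apply: eq_bigr => i _; apply: eq_bigr => j _; rewrite SgC.
  rewrite /Gm !mulr_sumr -!big_split; apply: eq_bigr => i _ /=.
  rewrite !mulr_sumr -!big_split; apply: eq_bigr => j _ /=.
  rewrite mderivM mderivD !mderivM -!scalerAr -!scalerDr; congr (_ *: _); ring.
rewrite e1 e2; ring.
Qed.

Lemma Gm_Ml f g h : Gm (f * g) h = f * Gm g h + g * Gm f h.
Proof.
rewrite /Gm !mulr_sumr -big_split; apply: eq_bigr => i _ /=.
rewrite !mulr_sumr -big_split; apply: eq_bigr => j _ /=.
rewrite mderivM -!scalerAr -scalerDr; congr (_ *: _); ring.
Qed.

Lemma Gm_C f g : Gm f g = Gm g f.
Proof.
rewrite /Gm exchange_big; apply: eq_bigr => i _; apply: eq_bigr => j _ /=.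
by rewrite SgC mulrC.
Qed.

Definition cov2 (u v : 'I_p -> R) := \sum_i \sum_j Sg i j * (u i * v j).

Lemma Gm_lin u v : Gm (lin u) (lin v) = (cov2 u v)%:A.
Proof.
rewrite /Gm /cov2 scaler_suml; apply: eq_bigr => i _; rewrite scaler_suml.
apply: eq_bigr => j _.
by rewrite !mderiv_lin -scalerAl mul1r !scalerA mulrA.
Qed.

Lemma OU_lin u : OUx (lin u) = - lin u.
Proof. by have := OU_pow (fun i j => Sg i j) u 1; rewrite mulr0 mul0r scale0r sub0r scale1r expr1. Qed.

Lemma OU_lin2 u v : OUx (lin u * lin v) = - 2 *: (lin u * lin v) + (2 * cov2 u v)%:A.
Proof. by rewrite OU_M !OU_lin Gm_lin scalerA scaleNr scaler_nat; ring. Qed.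

Lemma E_lin2 u v : E (ev (lin u * lin v)) = cov2 u v.
Proof.
have := E_OU (lin u * lin v); rewrite OU_lin2 -/(L _) LZD.
have -> : L ((2 * cov2 u v)%:A) = 2 * cov2 u v.
  rewrite /L -[RHS](E_cst P); apply: eqE => w.
  by rewrite /ev mevalZ meval1 mulr1.
rewrite /L; move/eqP; rewrite addrC mulNr subr_eq0 => /eqP; lra.
Qed.

Lemma E_crd2 i j : E (fun w => crd i w * crd j w) = Sg i j.
Proof.
have -> : Sg i j = cov2 (fun k => (k == i)%:R) (fun k => (k == j)%:R).
  rewrite /cov2 (bigD1 i)//= [X in _ + X]big1 ?addr0 => [|k /negPf ->]; last first.
    by apply: big1 => l _; rewrite mul0r mulr0.
  rewrite (bigD1 j)//= !eqxx !mulr1 big1 ?addr0// => k /negPf ->.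
  by rewrite !mulr0.
by rewrite -E_lin2 !linX; apply: eqE => w; rewrite /ev mevalM !mevalXU.
Qed.

(** The Isserlis formula. The product rule writes [OU] of the product as -4 times the product plus
    products of two forms weighted by covariances, and its mean is zero. *)
Lemma E_lin4 a b c e : E (ev (lin a * lin b * (lin c * lin e))) =
  cov2 a b * cov2 c e + cov2 a c * cov2 b e + cov2 a e * cov2 b c.
Proof.
have := E_OU (lin a * lin b * (lin c * lin e)).
rewrite OU_M !OU_lin2 Gm_Ml Gm_C [Gm (lin a) _]Gm_C !Gm_Ml !Gm_lin.
set A := lin a; set B := lin b; set C := lin c; set D := lin e.
rewrite [E _](_ : _ = E (fun w => - 4 * ev (A * B * (C * D)) w +
   (2 * cov2 c e * ev (A * B) w + (2 * cov2 a b * ev (C * D) w +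
   2 * (cov2 e b * ev (A * C) w + (cov2 c b * ev (A * D) w +
    (cov2 e a * ev (B * C) w + cov2 c a * ev (B * D) w))))))); last first.
  apply: eqE => w; rewrite /ev !(mevalD, mevalM, mevalZ, meval1); ring.
have mm k f : momT (fun w => k * ev f w) by apply: momZ => //; exact: mom_ev.
have mm' k (f : T -> R) : momT f -> momT (fun w => k * f w) by exact: momZ.
rewrite !(ED, EZ); do ?[exact: mom_ev|exact: mm|apply: momD => //|apply: mm'].
rewrite !E_lin2; have -> : cov2 e b = cov2 b e.
  by rewrite /cov2 exchange_big; apply: eq_bigr => i _; apply: eq_bigr => j _; rewrite SgC; ring.
have -> : cov2 c b = cov2 b c.
  by rewrite /cov2 exchange_big; apply: eq_bigr => i _; apply: eq_bigr => j _; rewrite SgC; ring.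
have -> : cov2 e a = cov2 a e.
  by rewrite /cov2 exchange_big; apply: eq_bigr => i _; apply: eq_bigr => j _; rewrite SgC; ring.
have -> : cov2 c a = cov2 a c.
  by rewrite /cov2 exchange_big; apply: eq_bigr => i _; apply: eq_bigr => j _; rewrite SgC; ring.
lra.
Qed.

Lemma E_crd4 i j k l : E (fun w => crd i w * crd j w * (crd k w * crd l w)) =
  Sg i j * Sg k l + Sg i k * Sg j l + Sg i l * Sg j k.
Proof.
have h a b : cov2 (fun m => (m == a)%:R) (fun m => (m == b)%:R) = Sg a b.
  rewrite -E_crd2 -E_lin2 !linX; apply: eqE => w; by rewrite /ev mevalM !mevalXU.
rewrite -!h -E_lin4 !linX; apply: eqE => w; by rewrite /ev !mevalM !mevalXU.
Qed.

Lemma E_lin_pow4 (v : 'I_p -> R) : E (fun w => (\sum_i v i * crd i w) ^+ 4) =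
  3 * (\sum_i \sum_j v i * v j * Sg i j) ^+ 2.
Proof.
rewrite (E_normal_rec (mlf v) (q0 v) (@lawlf v)) (E_normal_rec (mlf v) (q0 v) (@lawlf v)) /=.
rewrite [E _](_ : _ = 1); first by ring.
by rewrite -[RHS](E_cst P); apply: eqE => w; rewrite ?expr0.
Qed.

Section quadratic.
Variable A : 'I_p -> 'I_p -> R.

Definition Qm : mp := \sum_i \sum_j A i j *:
  (mpolyX R (mnm1 i) * mpolyX R (mnm1 j) - (Sg i j)%:A).

Definition Qx w := \sum_i \sum_j A i j * (crd i w * crd j w - Sg i j).

Let QE w : ev Qm w = Qx w.
Proof.
rewrite /ev /Qm raddf_sum/=; apply: eq_bigr => i _; rewrite raddf_sum/=.
apply: eq_bigr => j _.
by rewrite mevalZ mevalB mevalM !mevalXU mevalZ meval1 mulr1.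
Qed.

Let mderivA j (k : R) : mderiv j k%:A = 0 :> mp.
Proof. by rewrite mderivZ -[1]/(mpolyC p 1) mderivC scaler0. Qed.

Let OU_A k : OUx k%:A = 0.
Proof.
rewrite /OUx /OU big1 => [|i _]; last first.
  by apply: big1 => j _; rewrite mderivA mderiv0 scaler0.
by rewrite big1 ?subr0// => i _; rewrite mderivA mulr0.
Qed.

Let OU0 : OUx 0 = 0.
Proof. by have := OU_A 0; rewrite scale0r. Qed.

Let OU_sum (I : Type) (r : seq I) (F : I -> mp) :
  OUx (\sum_(i <- r) F i) = \sum_(i <- r) OUx (F i).
Proof.
have OUD f g : OUx (f + g) = OUx f + OUx g.
  by have := OU_ZD (fun i j => Sg i j) 1 f g; rewrite !scale1r.
exact: (big_morph OUx OUD OU0).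
Qed.

Let OU_Z k f : OUx (k *: f) = k *: OUx f.
Proof.
by have := OU_ZD (fun i j => Sg i j) k f 0; rewrite addr0 -/OUx OU0 addr0.
Qed.

(** A centred quadratic form lies in the second Wiener chaos, the eigenspace of [OU] for -2. *)
Lemma OU_Q : OUx Qm = - 2 *: Qm.
Proof.
rewrite /Qm OU_sum scaler_sumr; apply: eq_bigr => i _.
rewrite OU_sum scaler_sumr; apply: eq_bigr => j _.
rewrite OU_Z scalerA [-2 * _]mulrC -scalerA; congr (_ *: _).
have -> : mpolyX R (mnm1 i) * mpolyX R (mnm1 j) - (Sg i j)%:A =
  (- Sg i j) *: 1 + lin (fun k => (k == i)%:R) * lin (fun k => (k == j)%:R).
  by rewrite !linX scaleNr addrC.
have OU1 : OUx 1 = 0 by have := OU_A 1; rewrite scale1r.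
have := OU_ZD (fun i j => Sg i j) (- Sg i j) 1 (lin (fun k => (k == i)%:R) * lin (fun k => (k == j)%:R)).
rewrite -/OUx => ->; rewrite OU1 scaler0 add0r OU_lin2.
rewrite scalerDr scalerA addrC; congr (_ + _); congr (_ *: _).
rewrite -E_lin2 mulrNN; congr (_ * _).
rewrite -E_crd2 !linX; apply: eqE => w; by rewrite /ev mevalM !mevalXU.
Qed.

Let At i j := A i j + A j i.

Let dQ k : mderiv k Qm = lin (At k).
Proof.
rewrite /Qm linear_sum/=.
have h i j : mderiv k (A i j *: (mpolyX R (mnm1 i) * mpolyX R (mnm1 j) - (Sg i j)%:A)) =
  A i j *: ((k == i)%:R *: mpolyX R (mnm1 j) + (k == j)%:R *: mpolyX R (mnm1 i)).
  rewrite mderivZ mderivB mderivM -!linX !mderiv_lin mderivA subr0.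
  by rewrite -scalerAl mul1r -scalerAr mulr1.
under eq_bigr do rewrite linear_sum/=.
under eq_bigr do under eq_bigr do rewrite h scalerDr !scalerA.
under eq_bigr do rewrite big_split/=.
rewrite big_split/= exchange_big/= -big_split/= /lin.
apply: eq_bigr => j _; rewrite scalerDl; congr (_ + _).
  rewrite (bigD1 k)//= eqxx mulr1 big1 ?addr0// => i; rewrite eq_sym => /negPf ->.
  by rewrite mulr0 scale0r.
rewrite (bigD1 k)//= eqxx mulr1 big1 ?addr0// => i; rewrite eq_sym => /negPf ->.
by rewrite mulr0 scale0r.
Qed.

(** The gradient of the form, by [dQ]; it is linear in the vector and has covariance [G]. *)
Let Z (a : 'I_p) (w : T) := \sum_i At a i * crd i w.
Let G a b := E (fun w => Z a w * Z b w).

Let mZ a : momT (Z a).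
Proof. by apply: mom_sum => // i _; apply: momZ => //; exact: mom_crd. Qed.

Let GmQ w : ev (Gm Qm Qm) w = \sum_a \sum_b Z a w * Z b w * Sg a b.
Proof.
rewrite /ev /Gm raddf_sum/=; apply: eq_bigr => i _; rewrite raddf_sum/=.
apply: eq_bigr => j _; rewrite mevalZ mevalM !dQ -!/(ev _ w) !ev_lin.
by rewrite mulrC.
Qed.

Let GE a b : G a b = \sum_i \sum_j At a i * At b j * Sg i j.
Proof.
rewrite /G /Z; under eq_fun do rewrite sumM2.
rewrite Esum2; last first.
  by move=> i j; apply: momM => //; apply: momZ => //; exact: mom_crd.
apply: eq_bigr => i _; apply: eq_bigr => j _; rewrite -E_crd2 -EZ; last first.
  by apply: momM => //; exact: mom_crd.
by apply: eqE => w; ring.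
Qed.

Let AtC a b : At a b = At b a.
Proof. by rewrite /At addrC. Qed.

(** As [At] is symmetric, the matrix At Sg At of the carre du champ is also the covariance [G] of
    the gradient, which is the shape that [gram_le] needs. *)
Let GmQ' w : ev (Gm Qm Qm) w = \sum_a \sum_b G a b * (crd a w * crd b w).
Proof.
rewrite GmQ.
transitivity (\sum_i \sum_j \sum_a \sum_b At i a * At j b * Sg i j * (crd a w * crd b w)).
  apply: eq_bigr => i _; apply: eq_bigr => j _; rewrite /Z sumM2 mulr_suml.
  apply: eq_bigr => a _; rewrite mulr_suml; apply: eq_bigr => b _; ring.
transitivity (\sum_a \sum_b \sum_i \sum_j At i a * At j b * Sg i j * (crd a w * crd b w)).
  rewrite pair_big/= [RHS]pair_big/=.
  under eq_bigr do rewrite pair_big/=.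
  under [RHS]eq_bigr do rewrite pair_big/=.
  by rewrite exchange_big.
apply: eq_bigr => a _; apply: eq_bigr => b _; rewrite GE mulr_suml.
apply: eq_bigr => i _; rewrite mulr_suml; apply: eq_bigr => j _.
by rewrite (AtC a) (AtC b).
Qed.

(** E OU(Q^2) = 0 reads -4 E Q^2 + 2 E Gm(Q, Q) = 0. *)
Let EGm : E (ev (Gm Qm Qm)) = 2 * E (fun w => Qx w ^+ 2).
Proof.
have := E_OU (Qm * Qm); rewrite OU_M OU_Q.
rewrite [E _](_ : _ = E (fun w => - 4 * Qx w ^+ 2 + 2 * ev (Gm Qm Qm) w)); last first.
  by apply: eqE => w; rewrite -QE /ev !(mevalD, mevalM, mevalZ); ring.
have mQ : momT Qx by rewrite -(funext QE); exact: mom_ev.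
rewrite ED; [|by apply: momZ => //; exact: momX|by apply: momZ => //; exact: mom_ev].
rewrite (EZ _ (momX hT 2 mQ)) (EZ _ (mom_ev _)); lra.
Qed.

(** [gram_le] for the gradient of Q and the vector itself, with the constant 3 of the fourth moment
    of a Gaussian variable. *)
Let EGm2 : E (fun w => ev (Gm Qm Qm) w ^+ 2) <= 3 * E (ev (Gm Qm Qm)) ^+ 2.
Proof.
have mc2 a b k : momT (fun w => k * (crd a w * crd b w)).
  by apply: momZ => //; apply: momM => //; exact: mom_crd.
have hy c : E (fun w => (\sum_a c a * crd a w) ^+ 4) <=
    3 * (\sum_a \sum_b c a * c b * Sg a b) ^+ 2 by rewrite E_lin_pow4.
have := gram_le mZ (fun _ _ => erefl) (quart_le mom_crd E_crd2 (ler0n _ 3) hy).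
rewrite -/(G _ _).
have -> : E (ev (Gm Qm Qm)) = \sum_a \sum_b G a b * Sg a b.
  rewrite (eqE P GmQ') Esum2//; apply: eq_bigr => a _; apply: eq_bigr => b _.
  by rewrite EZ ?E_crd2//; apply: momM => //; exact: mom_crd.
apply: le_trans; rewrite le_eqVlt; apply/orP; left; apply/eqP.
rewrite [LHS](_ : _ = E (fun w => \sum_a \sum_b \sum_e \sum_f
    G a b * G e f * (crd a w * crd b w * (crd e w * crd f w)))); last first.
  apply: eqE => w; rewrite GmQ' expr2 mulr_suml; apply: eq_bigr => a _.
  rewrite mulr_suml; apply: eq_bigr => b _; rewrite mulr_sumr.
  apply: eq_bigr => e _; rewrite mulr_sumr; apply: eq_bigr => f _; ring.
have mcrd' := mom_crd.
rewrite Esum4; last by move=> a b e f; apply: momZ => //; do ?apply: momM.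
apply: eq_bigr => a _; apply: eq_bigr => b _; apply: eq_bigr => e _.
by apply: eq_bigr => f _; rewrite EZ//; do ?apply: momM.
Qed.

(** E OU(Q^4) = 0 gives 2 E Q^4 = 3 E Q^2 Gm. Cauchy-Schwarz and E Gm^2 <= 3 (2 E Q^2)^2 then give 4
    (E Q^4)^2 <= 108 (E Q^2)^2 E Q^4, whence 27. *)
Lemma E_Q4 : E (fun w => Qx w ^+ 4) <= 27 * E (fun w => Qx w ^+ 2) ^+ 2.
Proof.
have mQ : momT Qx by rewrite -(funext QE); exact: mom_ev.
have h : 2 * E (fun w => Qx w ^+ 4) = 3 * E (fun w => Qx w ^+ 2 * ev (Gm Qm Qm) w).
  have := E_OU ((Qm * Qm) * (Qm * Qm)); rewrite !OU_M !OU_Q Gm_Ml Gm_C Gm_Ml.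
  rewrite [E _](_ : _ = E (fun w => - 8 * Qx w ^+ 4 + 12 * (Qx w ^+ 2 * ev (Gm Qm Qm) w))); last first.
    by apply: eqE => w; rewrite -QE /ev !(mevalD, mevalM, mevalZ); ring.
  rewrite ED; [|by apply: momZ => //; exact: momX|apply: momZ => //; apply: momM => //; [exact: momX|exact: mom_ev]].
  rewrite (EZ _ (momX hT 4 mQ)) (EZ _ (momM hT (momX hT 2 mQ) (mom_ev _))); lra.
have cs := E_CS (momX hT 2 mQ) (mom_ev (Gm Qm Qm)).
have := EGm2; rewrite EGm.
rewrite [E (fun w => (Qx w ^+ 2) ^+ 2)](_ : _ = E (fun w => Qx w ^+ 4)) in cs; last first.
  by apply: eqE => w; rewrite -exprM.
have p0 : 0 <= E (fun w => Qx w ^+ 4) by apply: E_ge0 => w; exact: exprn_even_ge0.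
have q20 : 0 <= E (fun w => Qx w ^+ 2) by apply: E_ge0 => w; exact: sqr_ge0.
move: h cs p0 q20; set x := E (fun w => Qx w ^+ 4); set y := E (fun w => Qx w ^+ 2).
set z := E (fun w => _ * _); set g := E (fun w => _ ^+ 2) => h cs x0 y0 hg.
have h2 : 4 * x ^+ 2 <= 108 * y ^+ 2 * x.
  have e9 : 9 * z ^+ 2 = (3 * z) ^+ 2 by ring.
  have -> : 4 * x ^+ 2 = 9 * z ^+ 2 by rewrite e9 -h; ring.
  have : x * g <= x * (12 * y ^+ 2) by rewrite ler_wpM2l//; nra.
  nra.
have [->|xn0] := eqVneq x 0; first by rewrite mulr_ge0// sqr_ge0.
have xp : 0 < x by rewrite lt_neqAle eq_sym xn0.
by rewrite -(ler_pM2r xp); nra.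
Qed.

End quadratic.

End normal_vector.
End gaussian_law.

(** * The test statistic as a quadratic form plus a linear remainder *)

Section link.
Context d (T : measurableType d) (R : realType) (P : probability T R).
Context (n p : nat) (Sg : 'M[R]_p) (X : 'I_n -> {RV P >-> p.-tuple R}).
Hypothesis SgT : Sg^T = Sg.
Hypothesis Sg_ge0 : forall u : 'rV[R]_p, 0 <= (u *m Sg *m u^T) 0 0.
Hypothesis hX : iid_gaussian P Sg X.
Variable wt : 'I_p * 'I_p -> R.
Hypothesis wt0 : forall a, 0 <= wt a.
Local Notation E := (E P).
Local Notation momT := (mom P measurable).
Local Notation hT := (@subset_refl _ (@measurable _ T)).
Local Notation I := ('I_p * 'I_p)%type.

Let iX : mutually_independent P X := proj1 hX.
Let gX k : gaussian_vector P Sg (X k) := proj2 hX k.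

Definition cprod (a : I) (y : p.-tuple R) : R := tnth y a.1 * tnth y a.2 - Sg a.1 a.2.
(** The square root makes the plain scalar product of [Yv k] and [Yv l] the weighted one of the
    statistic. A pair of coordinates is left out by giving it weight zero. *)
Definition Yv (k : 'I_n) (a : I) (w : T) : R := Num.sqrt (wt a) * cprod a (X k w).
(** Covariance of two products of coordinates, by the Isserlis formula. *)
Definition Gam0 (a b : I) : R := Sg a.1 b.1 * Sg a.2 b.2 + Sg a.1 b.2 * Sg a.2 b.1.
Definition Gamw (a b : I) : R := Num.sqrt (wt a) * Num.sqrt (wt b) * Gam0 a b.
Definition offX (l : 'I_n) : set (set T) := cyl X (finset.setC (finset.set1 l)).

Let mprod a : measurable_fun setT (cprod a).
Proof.
apply: measurable_funB => //; apply: measurable_funM; exact: measurable_tnth.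
Qed.

Let mY0 k a : momT (cprod a \o X k).
Proof.
apply: momB => //; last exact: mom_cst.
by apply: momM => //; exact: (mom_crd Sg_ge0 (@gX k)).
Qed.

Lemma mom_Yv k a : momT (Yv k a).
Proof. by apply: momZ => //; exact: mY0. Qed.

Lemma mom_Yv_off k l a : k != l -> mom P (offX l) (Yv k a).
Proof.
move=> kl; apply: momZ; first exact: cyl_measurable.
by apply: mom_block => //; rewrite !inE.
Qed.

Let lnot (l : 'I_n) : l \notin finset.setC (finset.set1 l).
Proof. by rewrite !inE eqxx. Qed.

Let Eoff l (g : p.-tuple R -> R) V : measurable_fun setT g -> momT (g \o X l) ->
  mom P (offX l) V -> E (fun w => g (X l w) * V w) = E (g \o X l) * E V.
Proof. by move=> mg hg hV; apply: (E_block iX (lnot l)). Qed.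

Let mYg a : measurable_fun setT (fun y => Num.sqrt (wt a) * cprod a y).
Proof. exact: measurable_funM. Qed.

Let E_cprod k a : E (cprod a \o X k) = 0.
Proof.
have mc := mom_crd Sg_ge0 (@gX k).
rewrite [LHS](_ : _ = E (fun w => crd (X k) a.1 w * crd (X k) a.2 w - Sg a.1 a.2))//.
rewrite EB ?E_cst; [|exact: momM|exact: mom_cst].
by rewrite (E_crd2 SgT Sg_ge0 (@gX k)) subrr.
Qed.

Let E_cprod2 k a b : E (fun w => cprod a (X k w) * cprod b (X k w)) = Gam0 a b.
Proof.
have mc := mom_crd Sg_ge0 (@gX k).
have e2 := E_crd2 SgT Sg_ge0 (@gX k).
rewrite [LHS](_ : _ = E (fun w =>
   crd (X k) a.1 w * crd (X k) a.2 w * (crd (X k) b.1 w * crd (X k) b.2 w)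
   - (Sg b.1 b.2 * (crd (X k) a.1 w * crd (X k) a.2 w) +
     (Sg a.1 a.2 * (crd (X k) b.1 w * crd (X k) b.2 w) - Sg a.1 a.2 * Sg b.1 b.2)))); last first.
  by apply: eqE => w; rewrite /cprod /crd; ring.
have m2 i j : momT (fun w => crd (X k) i w * crd (X k) j w) by exact: momM.
have mz c i j : momT (fun w => c * (crd (X k) i w * crd (X k) j w)) by exact: momZ.
rewrite EB; [|exact: momM|apply: momD => //; apply: momB => //; exact: mom_cst].
rewrite ED//; last by apply: momB => //; exact: mom_cst.
rewrite EB//; last exact: mom_cst.
rewrite E_cst !EZ// !e2 (E_crd4 SgT Sg_ge0 (@gX k)) /Gam0; ring.
Qed.

Lemma E_Yv1 l a V : mom P (offX l) V -> E (fun w => Yv l a w * V w) = 0.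
Proof.
move=> hV; rewrite (@Eoff l (fun y => Num.sqrt (wt a) * cprod a y))//.
  by rewrite [E _]EZ ?E_cprod ?mulr0 ?mul0r//; exact: mY0.
exact: mom_Yv.
Qed.

Lemma E_Yv2 l a b V : mom P (offX l) V ->
  E (fun w => Yv l a w * Yv l b w * V w) = Gamw a b * E V.
Proof.
move=> hV.
rewrite (@Eoff l (fun y => (Num.sqrt (wt a) * cprod a y) * (Num.sqrt (wt b) * cprod b y)))//.
- congr (_ * _); rewrite /Gamw -(E_cprod2 l) -EZ; last by apply: momM => //; exact: mY0.
  by apply: eqE => w /=; ring.
- exact: measurable_funM.
- by apply: momM => //; exact: mom_Yv.
Qed.

Lemma E_Yv4 l a b e f V : mom P (offX l) V ->
  E (fun w => Yv l a w * Yv l b w * (Yv l e w * Yv l f w) * V w) =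
  quart P (Yv l) a b e f * E V.
Proof.
move=> hV.
rewrite (@Eoff l (fun y => (Num.sqrt (wt a) * cprod a y) * (Num.sqrt (wt b) * cprod b y) *
  ((Num.sqrt (wt e) * cprod e y) * (Num.sqrt (wt f) * cprod f y))))//.
- by do !apply: measurable_funM.
- have mYl := mom_Yv l.
  have h := momM hT (momM hT (mYl a) (mYl b)) (momM hT (mYl e) (mYl f)); exact: h.
Qed.

(** A linear form in [Yv l] is a centred quadratic form in [X l], with coefficients c_ij
    sqrt(w_ij). *)
Lemma Yv_hyper l (c : I -> R) : E (fun w => (\sum_a c a * Yv l a w) ^+ 4) <=
  27 * (\sum_a \sum_b c a * c b * Gamw a b) ^+ 2.
Proof.
have e2 : \sum_a \sum_b c a * c b * Gamw a b = E (fun w => (\sum_a c a * Yv l a w) ^+ 2).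
  rewrite (@E_sqr_lin _ _ _ P _ (Yv l) Gamw)// => [a|a b]; first exact: mom_Yv.
  have := @E_Yv2 l a b _ (mom_cst P (@cyl_measurable _ _ _ _ _ _ _ X _) 1).
  by rewrite E_cst mulr1 => <-; apply: eqE => w; rewrite mulr1.
rewrite e2.
have h w : \sum_a c a * Yv l a w = Qx Sg (X l) (fun i j => c (i, j) * Num.sqrt (wt (i, j))) w.
  rewrite /Qx pair_big/=; apply: eq_bigr => -[i j] _.
  by rewrite /Yv /cprod /crd/= mulrA.
rewrite (eqE P (fun w => congr1 (fun z => z ^+ 4) (h w))).
rewrite (eqE P (fun w => congr1 (fun z => z ^+ 2) (h w))).
exact: (E_Q4 SgT Sg_ge0 (@gX l)).
Qed.

Section bound.
Variables (f f' : R -> R) (M0 M1 M2 : R).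
Hypothesis cf : continuous f.
Hypothesis cf' : continuous f'.
Hypothesis f_le : forall x, `|f x| <= M0.
Hypothesis f'_le : forall x, `|f' x| <= M1.
Hypothesis f'_lip : forall x y, `|f' x - f' y| <= M2 * `|x - y|.
Hypothesis f_taylor : forall x h, `|f (x + h) - f x - h * f' x| <= M2 * h ^+ 2.

Definition Ux (c : R) : T -> R := U Yv c (allI n).

Lemma Ux_bound (c delta : R) : 0 < delta -> (0 < n)%N ->
  `|E (fun w => f' (Ux c w) - Ux c w * f (Ux c w))| <=
  M1 * (`|1 - 2 * c ^+ 2 * n%:R * (n%:R - 1) * tr2 Gamw| +
    2 * c ^+ 2 * n%:R * (Num.sqrt (n%:R * (27 * tr2 Gamw ^+ 2)) + Num.sqrt (2 * n%:R ^+ 2 * tr4 Gamw)))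
  + M2 * (2 * (c ^+ 2 * n%:R ^+ 2 * tr2 Gamw) * delta +
     4 * (4 * 27 + 8) * (27 + 1) * (c ^+ 2 * n%:R ^+ 2 * tr2 Gamw) ^+ 2 / (n%:R * delta)).
Proof.
apply: (@stein_bound _ _ _ P _ n Yv offX Gamw 27 (fun l => @cyl_measurable _ _ _ _ _ _ _ X _)
  mom_Yv mom_Yv_off E_Yv1 E_Yv2 E_Yv4 (ler0n _ 27) Yv_hyper c f f' M0 M1 M2) => //.
Qed.
End bound.

Lemma mom_Ux c : momT (Ux c).
Proof.
apply: momZ => //; apply: momB => //.
  by apply: mom_sum => // a _; apply: momX => //; apply: mom_sum => // k _; exact: mom_Yv.
by apply: mom_sum => // k _; apply: mom_sum => // a _; apply: momX => //; exact: mom_Yv.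
Qed.

(** [Lin] is the first-order Hoeffding projection of the normalised statistic, a sum over
    independent observations. *)
Definition Zl (k : 'I_n) (w : T) : R := \sum_a wt a * Sg a.1 a.2 * cprod a (X k w).
Definition Lin (w : T) : R := 2 / Num.sqrt p%:R * \sum_k Zl k w.

Lemma mom_Zl k : momT (Zl k).
Proof. by apply: mom_sum => // a _; apply: momZ => //; exact: mY0. Qed.

Lemma mom_Lin : momT Lin.
Proof. by apply: momZ => //; apply: mom_sum => // k _; exact: mom_Zl. Qed.

Lemma E_sqr_Lin : E (fun w => Lin w ^+ 2) = 4 / p%:R * (n%:R *
  \sum_a \sum_b wt a * Sg a.1 a.2 * (wt b * Sg b.1 b.2) * Gam0 a b).
Proof.
have E2 k : E (fun w => Zl k w ^+ 2) =
    \sum_a \sum_b wt a * Sg a.1 a.2 * (wt b * Sg b.1 b.2) * Gam0 a b.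
  by rewrite (@E_sqr_lin _ _ _ P _ (fun a => cprod a \o X k) Gam0)// => a b; exact: E_cprod2.
have E0 k l : k != l -> E (fun w => Zl k w * Zl l w) = 0.
  move=> kl; rewrite (@Eoff k (fun y => \sum_a wt a * Sg a.1 a.2 * cprod a y)).
  - rewrite [X in X * _](_ : _ = 0) ?mul0r//.
    rewrite [LHS]Esum => [|a _]; last by apply: momZ => //; exact: mY0.
    by apply: big1 => a _; rewrite EZ ?E_cprod ?mulr0//; exact: mY0.
  - by apply: measurable_sum => a; exact: measurable_funM.
  - exact: mom_Zl.
  - apply: mom_sum => [|a _]; first exact: cyl_measurable.
    apply: momZ; first exact: cyl_measurable.
    by apply: mom_block => //; rewrite !inE eq_sym.
have -> : E (fun w => Lin w ^+ 2) = 4 / p%:R * E (fun w => \sum_k \sum_l Zl k w * Zl l w).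
  rewrite -EZ; last by apply: mom_sum2 => // k l; apply: momM => //; exact: mom_Zl.
  apply: eqE => w; rewrite /Lin exprMn expr_div_n sqr_sqrtr// -sumM2 -expr2.
  by congr (_ / _ * _); rewrite -natrX.
congr (_ * _); rewrite Esum2; last by move=> k l; apply: momM => //; exact: mom_Zl.
rewrite [LHS](_ : _ = \sum_(k < n) \sum_a \sum_b wt a * Sg a.1 a.2 * (wt b * Sg b.1 b.2) * Gam0 a b).
  by rewrite sumr_const card_ord mulr_natl.
apply: eq_bigr => k _; rewrite (bigD1 k)//= big1 ?addr0 => [|l lk].
  by rewrite -(E2 k); apply: eqE => w; rewrite expr2.
by rewrite E0// eq_sym.
Qed.

Definition Dsum (w : T) : R := \sum_(k < n) \sum_(l < n | k != l) \sum_a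
  wt a * (tnth (X k w) a.1 * tnth (X k w) a.2) * (tnth (X l w) a.1 * tnth (X l w) a.2).

Let mean : R := \sum_a wt a * Sg a.1 a.2 ^+ 2.

Let sum_neq (z : 'I_n -> R) : \sum_(k < n) \sum_(l < n | k != l) z k * z l =
  (\sum_k z k) ^+ 2 - \sum_k z k ^+ 2.
Proof.
rewrite expr2 sumM2 -sumrB; apply: eq_bigr => k _.
rewrite [in RHS](bigD1 k)//= -expr2 addrAC subrr add0r.
by apply: eq_bigl => l; rewrite eq_sym.
Qed.

(** Write X_ki X_kj = y_k + s with s the covariance: the sum of (y_k + s)(y_l + s) over k <> l is
    that of y_k y_l, plus 2 (n - 1) s sum_k y_k, plus n (n - 1) s^2. *)
Lemma Dsum_decomp (c : R) w : (1 < n)%N -> (0 < p)%N ->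
  c = ((n%:R - 1) * Num.sqrt p%:R)^-1 ->
  c * (Dsum w - n%:R * (n%:R - 1) * mean) = Ux c w + Lin w.
Proof.
move=> n1 p0 cE.
have sp : Num.sqrt p%:R != 0 :> R by rewrite sqrtr_eq0 -ltNge ltr0n.
have nn : n%:R - 1 != 0 :> R by rewrite subr_eq0 pnatr_eq1 gtn_eqF.
have DE : Dsum w = \sum_a wt a * ((\sum_k (cprod a (X k w) + Sg a.1 a.2)) ^+ 2
    - \sum_k (cprod a (X k w) + Sg a.1 a.2) ^+ 2).
  rewrite /Dsum.
  under eq_bigr do rewrite exchange_big/=.
  rewrite exchange_big/=; apply: eq_bigr => a _; rewrite -sum_neq mulr_sumr.
  apply: eq_bigr => k _; rewrite mulr_sumr; apply: eq_bigr => l _.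
  by rewrite /cprod !subrK -mulrA.
have UE : Ux c w = c * \sum_a wt a * ((\sum_k cprod a (X k w)) ^+ 2 - \sum_k cprod a (X k w) ^+ 2).
  rewrite /Ux /U; congr (_ * _); rewrite /sqn /allI.
  have e (h : 'I_n -> R) : \sum_(k in finset.setTfor 'I_n) h k = \sum_k h k.
    by apply: eq_bigl => k; rewrite inE.
  rewrite e exchange_big/= -sumrB; apply: eq_bigr => a _.
  rewrite /S e mulrBr /Yv -mulr_sumr exprMn sqr_sqrtr//; congr (_ - _).
  by rewrite mulr_sumr; apply: eq_bigr => k _; rewrite exprMn sqr_sqrtr.
have LE : Lin w = c * \sum_a wt a * (2 * (n%:R - 1) * Sg a.1 a.2 * \sum_k cprod a (X k w)).
  rewrite /Lin /Zl exchange_big/= !mulr_sumr; apply: eq_bigr => a _.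
  rewrite -mulr_sumr cE; field; by rewrite sp nn.
rewrite UE LE DE -mulrDr; congr (_ * _); rewrite /mean mulr_sumr -sumrB -big_split/=.
apply: eq_bigr => a _; set s := Sg a.1 a.2.
have -> : \sum_k (cprod a (X k w) + s) = \sum_k cprod a (X k w) + n%:R * s.
  by rewrite big_split/= sumr_const card_ord mulr_natl.
have -> : \sum_k (cprod a (X k w) + s) ^+ 2 =
    \sum_k cprod a (X k w) ^+ 2 + 2 * s * \sum_k cprod a (X k w) + n%:R * s ^+ 2.
  have -> : n%:R * s ^+ 2 = \sum_(k < n) s ^+ 2 by rewrite sumr_const card_ord mulr_natl.
  rewrite mulr_sumr -!big_split/=.
  by apply: eq_bigr => k _; ring.
by ring.
Qed.

Lemma E_Dsum : (0 < n)%N -> E Dsum = n%:R * (n%:R - 1) * mean.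
Proof.
move=> n0.
have mx k a : momT (fun w => tnth (X k w) a.1 * tnth (X k w) a.2).
  by apply: momM => //; exact: (mom_crd Sg_ge0 (@gX k)).
have e k l a : k != l -> E (fun w => wt a * (tnth (X k w) a.1 * tnth (X k w) a.2) *
    (tnth (X l w) a.1 * tnth (X l w) a.2)) = wt a * Sg a.1 a.2 ^+ 2.
  move=> kl; under eq_fun do rewrite -mulrA.
  rewrite EZ; last exact: momM.
  rewrite (@Eoff k (fun y => tnth y a.1 * tnth y a.2))//.
  - by rewrite expr2; congr (_ * (_ * _)); exact: (E_crd2 SgT Sg_ge0 (@gX _)).
  - by apply: measurable_funM; exact: measurable_tnth.
  - exact: mx.
  - have mt : measurable_fun setT (fun y : p.-tuple R => tnth y a.1 * tnth y a.2).
      by apply: measurable_funM; exact: measurable_tnth.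
    have hb : mom P (offX k) ((fun y : p.-tuple R => tnth y a.1 * tnth y a.2) \o X l).
      by apply: mom_block => //; [rewrite !inE eq_sym|exact: mx].
    exact: hb.
have mm k l a : momT (fun w => wt a * (tnth (X k w) a.1 * tnth (X k w) a.2) *
    (tnth (X l w) a.1 * tnth (X l w) a.2)) by apply: momM => //; exact: momZ.
rewrite Esum; last by move=> k _; do 2 (apply: mom_sum => // ? _).
transitivity (\sum_(k < n) ((n%:R - 1) * mean)).
  apply: eq_bigr => k _; rewrite Esum; last by move=> l _; apply: mom_sum => // ? _.
  transitivity (\sum_(l < n | k != l) mean).
    apply: eq_bigr => l kl; rewrite Esum//; apply: eq_bigr => a _; exact: e.
  rewrite sumr_const -[mean *+ _]mulr_natl; congr (_ * mean).
  have := cardC1 k; rewrite card_ord => h.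
  rewrite (eq_card (B := predC1 k)) => [|l]; last by rewrite !inE eq_sym.
  by rewrite h -subn1 natrB.
by rewrite sumr_const card_ord -[RHS]mulrA mulr_natl.
Qed.

Lemma mom_Dsum : momT Dsum.
Proof.
have mx k a : momT (fun w => tnth (X k w) a.1 * tnth (X k w) a.2).
  by apply: momM => //; exact: (mom_crd Sg_ge0 (@gX k)).
by do 3 (apply: mom_sum => // ? _); apply: momM => //; exact: momZ.
Qed.

End link.

(** * Traces of the weighted covariance operator *)

Section frobenius.
Context {R : realType} {p : nat}.
Variables (Sg : 'M[R]_p) (wt : 'I_p * 'I_p -> R) (W B : R).
Local Notation I := ('I_p * 'I_p)%type.
Hypothesis SgT : Sg^T = Sg.
Hypothesis Sg1 : forall i, Sg i i = 1.
Hypothesis wt0 : forall a, 0 <= wt a.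
Hypothesis wtW : forall a, wt a <= W.
Hypothesis wt_lt : forall a, wt a != 0 -> (a.1 < a.2)%N.
Hypothesis wt_row : forall i, \sum_j wt (i, j) <= B.
Hypothesis wt_col : forall j, \sum_i wt (i, j) <= B.

Let SgC i j : Sg i j = Sg j i.
Proof. by rewrite -{1}SgT mxE. Qed.

Definition off2 (i j : 'I_p) : R := if i == j then 0 else Sg i j ^+ 2.
Definition offsum : R := \sum_i \sum_j off2 i j.
Definition wsq : R := \sum_a wt a ^+ 2.

(** Deviation from the diagonal matrix of the weights, which is the covariance operator when Sigma
    is the identity. *)
Definition Gamrem (a b : I) : R := Gamw Sg wt a b - (a == b)%:R * wt a.
Definition remsq : R := \sum_a \sum_b Gamrem a b ^+ 2.

Let r i : R := \sum_j off2 i j.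

Let off2_ge0 i j : 0 <= off2 i j.
Proof. by rewrite /off2; case: eqP => // _; exact: sqr_ge0. Qed.

Let r_ge0 i : 0 <= r i.
Proof. by apply: sumr_ge0. Qed.

Let W0 : I -> 0 <= W.
Proof. by move=> a; exact: le_trans (wt0 a) (wtW a). Qed.

Let sumP (F : I -> R) : \sum_a F a = \sum_i \sum_j F (i, j).
Proof. by rewrite pair_bigA; apply: eq_bigr => -[]. Qed.

Let wr1 : \sum_a wt a * r a.1 <= B * offsum.
Proof.
rewrite sumP /offsum mulr_sumr; apply: ler_sum => i _ /=.
by rewrite -mulr_suml ler_wpM2r.
Qed.

Let wr2 : \sum_a wt a * r a.2 <= B * offsum.
Proof.
rewrite sumP exchange_big /offsum mulr_sumr; apply: ler_sum => i _ /=.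
by rewrite -mulr_suml ler_wpM2r.
Qed.

Let wr12 : \sum_a wt a * (r a.1 * r a.2) <= W * offsum ^+ 2.
Proof.
apply: (@le_trans _ _ (\sum_a W * (r a.1 * r a.2))).
  by apply: ler_sum => a _; rewrite ler_wpM2r// mulr_ge0.
by rewrite -mulr_sumr sumP /= -sumM2 expr2.
Qed.

(** Bound [wt b] by [W] and sum over b. An index is required to know that W >= 0. *)
Let bnd (G : I -> I -> R) (g : I -> R) C : (forall a b, 0 <= G a b) ->
  (forall a, \sum_b G a b = g a) -> \sum_a wt a * g a <= C ->
  (0 < #|{: I}|)%N ->
  \sum_a \sum_b wt a * wt b * G a b <= W * C.
Proof.
move=> G0 Gg hC /card_gt0P[a0 _].
apply: (@le_trans _ _ (\sum_a W * (wt a * g a))); last first.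
  by rewrite -mulr_sumr ler_wpM2l// (W0 a0).
apply: ler_sum => a _; rewrite -Gg mulrCA !mulr_sumr; apply: ler_sum => b _.
have -> : wt a * wt b * G a b = wt b * (wt a * G a b) by ring.
have -> : wt a * (W * G a b) = W * (wt a * G a b) by ring.
by rewrite ler_wpM2r// mulr_ge0.
Qed.

Let dlt (i k : 'I_p) : R := (i == k)%:R.

Let sum_dlt i (F : 'I_p -> R) : \sum_k dlt i k * F k = F i.
Proof.
rewrite (bigD1 i)//= /dlt eqxx mul1r big1 ?addr0// => k; rewrite eq_sym => /negPf ->.
by rewrite mul0r.
Qed.

Let Sg2E i k : Sg i k ^+ 2 = dlt i k + off2 i k.
Proof.
rewrite /dlt /off2; case: eqVneq => [->|_]; rewrite ?Sg1 ?expr1n ?addr0//.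
by rewrite add0r.
Qed.

Let x2E (i j k l : 'I_p) : (Sg i k * Sg j l - dlt i k * dlt j l) ^+ 2 =
  dlt i k * off2 j l + off2 i k * dlt j l + off2 i k * off2 j l.
Proof.
rewrite /dlt /off2; case: eqVneq => [->|_]; case: eqVneq => [->|_];
  rewrite ?Sg1 ?mulr1n ?mulr0n; ring.
Qed.

(** The ordering of the pairs matters: i = l and j = k cannot both hold when i < j and k < l, so the
    swapped product has no diagonal part. *)
Let y2E (i j k l : 'I_p) : (i < j)%N -> (k < l)%N -> (Sg i l * Sg j k) ^+ 2 =
  dlt i l * off2 j k + off2 i l * dlt j k + off2 i l * off2 j k.
Proof.
move=> ij kl; rewrite exprMn !Sg2E.
have -> : (dlt i l + off2 i l) * (dlt j k + off2 j k) =
   dlt i l * dlt j k + (dlt i l * off2 j k + off2 i l * dlt j k + off2 i l * off2 j k).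
  by ring.
rewrite -[RHS]add0r; congr (_ + _); rewrite /dlt.
case: eqVneq => [il|_]; rewrite ?mul0r//; case: eqVneq => [jk|_]; rewrite ?mulr0//.
by move: ij kl; rewrite il jk => /ltn_trans h /h; rewrite ltnn.
Qed.

Let rem_le a b : Gamrem a b ^+ 2 <= 2 * (
   wt a * wt b * (dlt a.1 b.1 * off2 a.2 b.2) + wt a * wt b * (off2 a.1 b.1 * dlt a.2 b.2)
   + wt a * wt b * (off2 a.1 b.1 * off2 a.2 b.2)
   + wt a * wt b * (dlt a.1 b.2 * off2 a.2 b.1) + wt a * wt b * (off2 a.1 b.2 * dlt a.2 b.1)
   + wt a * wt b * (off2 a.1 b.2 * off2 a.2 b.1)).
Proof.
rewrite /Gamrem /Gamw.
have [a0|an0] := eqVneq (wt a) 0.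
  by rewrite a0 sqrtr0 !mul0r mulr0 subr0 !addr0 expr0n mulr0.
have [b0|bn0] := eqVneq (wt b) 0.
  have -> : a == b = false by apply: contra_neqF an0 => /eqP ->.
  by rewrite b0 sqrtr0 !mulr0 !mul0r subr0 !addr0 expr0n mulr0.
have -> : (a == b)%:R * wt a = Num.sqrt (wt a) * Num.sqrt (wt b) * (dlt a.1 b.1 * dlt a.2 b.2).
  rewrite /dlt -natrM mulnb -[_ && _]/(a == b).
  case: eqVneq => [<-|_]; rewrite ?mul0r ?mulr0// mul1r mulr1.
  by rewrite -expr2 sqr_sqrtr.
rewrite -mulrBr exprMn exprMn !sqr_sqrtr//.
have -> : Gam0 Sg a b - dlt a.1 b.1 * dlt a.2 b.2 =
  (Sg a.1 b.1 * Sg a.2 b.2 - dlt a.1 b.1 * dlt a.2 b.2) + Sg a.1 b.2 * Sg a.2 b.1.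
  by rewrite /Gam0; ring.
rewrite -!mulrDr [leRHS]mulrCA ler_wpM2l ?mulr_ge0//.
have := x2E a.1 a.2 b.1 b.2; have := y2E (wt_lt an0) (wt_lt bn0).
set x := Sg _ _ * _ - _; set y := Sg a.1 b.2 * _ => hy hx.
have : (x + y) ^+ 2 <= 2 * (x ^+ 2 + y ^+ 2) by have := sqr_ge0 (x - y); nra.
rewrite hx hy => /le_trans; apply; rewrite le_eqVlt; apply/orP; left; apply/eqP; ring.
Qed.

(** [rem_le] gives six sums with a factor 2. Four contain a Kronecker delta, which leaves one
    off-diagonal sum and a row or column of weights: at most W B offsum each. The other two are at
    most W^2 offsum^2. *)
Lemma remsq_le : (0 < p)%N -> remsq <= 8 * W * B * offsum + 4 * W ^+ 2 * offsum ^+ 2.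
Proof.
move=> p0; have cI : (0 < #|{: I}|)%N by rewrite card_prod card_ord muln_gt0 p0.
have d0 i k : 0 <= dlt i k by rewrite ler0n.
have g0 i k j l : 0 <= dlt i k * off2 j l by rewrite mulr_ge0.
have g0' i k j l : 0 <= off2 i k * dlt j l by rewrite mulr_ge0.
have g1 i k j l : 0 <= off2 i k * off2 j l by rewrite mulr_ge0.
have h1 := @bnd (fun a b => dlt a.1 b.1 * off2 a.2 b.2) (fun a => r a.2) _ (fun a b => g0 _ _ _ _) _ wr2 cI.
have h2 := @bnd (fun a b => off2 a.1 b.1 * dlt a.2 b.2) (fun a => r a.1) _ (fun a b => g0' _ _ _ _) _ wr1 cI.
have h3 := @bnd (fun a b => off2 a.1 b.1 * off2 a.2 b.2) (fun a => r a.1 * r a.2) _ (fun a b => g1 _ _ _ _) _ wr12 cI.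
have h4 := @bnd (fun a b => dlt a.1 b.2 * off2 a.2 b.1) (fun a => r a.2) _ (fun a b => g0 _ _ _ _) _ wr2 cI.
have h5 := @bnd (fun a b => off2 a.1 b.2 * dlt a.2 b.1) (fun a => r a.1) _ (fun a b => g0' _ _ _ _) _ wr1 cI.
have h6 := @bnd (fun a b => off2 a.1 b.2 * off2 a.2 b.1) (fun a => r a.1 * r a.2) _ (fun a b => g1 _ _ _ _) _ wr12 cI.
apply: (@le_trans _ _ (2 * (W * (B * offsum) + W * (B * offsum) + W * (W * offsum ^+ 2) +
   W * (B * offsum) + W * (B * offsum) + W * (W * offsum ^+ 2)))); last first.
  by rewrite le_eqVlt; apply/orP; left; apply/eqP; ring.
apply: (@le_trans _ _ (2 * (
  (\sum_a \sum_b wt a * wt b * (dlt a.1 b.1 * off2 a.2 b.2)) +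
  (\sum_a \sum_b wt a * wt b * (off2 a.1 b.1 * dlt a.2 b.2)) +
  (\sum_a \sum_b wt a * wt b * (off2 a.1 b.1 * off2 a.2 b.2)) +
  (\sum_a \sum_b wt a * wt b * (dlt a.1 b.2 * off2 a.2 b.1)) +
  (\sum_a \sum_b wt a * wt b * (off2 a.1 b.2 * dlt a.2 b.1)) +
  (\sum_a \sum_b wt a * wt b * (off2 a.1 b.2 * off2 a.2 b.1))))).
  rewrite -!big_split/= mulr_sumr; apply: ler_sum => a _.
  rewrite -!big_split/= mulr_sumr; apply: ler_sum => b _; exact: rem_le.
rewrite ler_wpM2l//; do !apply: lerD.
- apply: h1 => a; rewrite sumP/= -[RHS](sum_dlt a.1 (fun _ => r a.2)); apply: eq_bigr => i _.
  by rewrite -mulr_sumr.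
- apply: h2 => a; rewrite sumP exchange_big/= -[RHS](sum_dlt a.2 (fun _ => r a.1)); apply: eq_bigr => i _.
  by rewrite -mulr_suml mulrC.
- by apply: h3 => a; rewrite sumP/= sumM2.
- apply: h4 => a; rewrite sumP exchange_big/= -[RHS](sum_dlt a.1 (fun _ => r a.2)); apply: eq_bigr => i _.
  by rewrite -mulr_sumr.
- apply: h5 => a; rewrite sumP/= -[RHS](sum_dlt a.2 (fun _ => r a.1)); apply: eq_bigr => i _.
  by rewrite -mulr_suml mulrC.
- apply: h6 => a; rewrite sumP exchange_big/= sumM2//.
Qed.

Let remsq_ge0 : 0 <= remsq.
Proof. by do 2 (apply: sumr_ge0 => ? _); exact: sqr_ge0. Qed.

Let wsq_ge0 : 0 <= wsq.
Proof. by apply: sumr_ge0 => ? _; exact: sqr_ge0. Qed.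

Let GamE a b : Gamw Sg wt a b = (a == b)%:R * wt a + Gamrem a b.
Proof. by rewrite /Gamrem addrC subrK. Qed.

Let sumI a (F : I -> R) : \sum_b (a == b)%:R * F b = F a.
Proof.
rewrite (bigD1 a)//= eqxx mul1r big1 ?addr0// => k; rewrite eq_sym => /negPf ->.
by rewrite mul0r.
Qed.

Let le_sqrt (x y : R) : 0 <= y -> x ^+ 2 <= y -> `|x| <= Num.sqrt y.
Proof. by move=> y0 h; rewrite -sqrtr_sqr ler_wsqrtr. Qed.

(** Expand the square of diag(w) + Gamrem; the cross term only sees the diagonal of [Gamrem], and
    Cauchy-Schwarz bounds it. *)
Lemma tr2_approx : `|tr2 (Gamw Sg wt) - wsq| <= 2 * Num.sqrt (wsq * remsq) + remsq.
Proof.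
have -> : tr2 (Gamw Sg wt) - wsq = 2 * (\sum_a wt a * Gamrem a a) + remsq.
  rewrite /tr2 /wsq /remsq mulr_sumr -sumrB -big_split/=; apply: eq_bigr => a _.
  rewrite -[wt a ^+ 2](sumI a (fun _ => wt a ^+ 2)) -[2 * _](sumI a (fun b => 2 * (wt a * Gamrem a b))).
  rewrite -sumrB -big_split/=; apply: eq_bigr => b _; rewrite GamE.
  case: eqVneq => [<-|_]; rewrite ?mulr1n ?mulr0n; ring.
rewrite (le_trans (ler_normD _ _))// lerD//; last by rewrite ger0_norm.
rewrite normrM ger0_norm// ler_wpM2l// le_sqrt ?mulr_ge0//.
apply: le_trans (sum_CS _ _) _; rewrite ler_wpM2l//.
apply: ler_sum => a _; rewrite (bigD1 a)//= lerDl.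
by apply: sumr_ge0 => b _; exact: sqr_ge0.
Qed.

(** The square of diag(w) + Gamrem has four parts, hence the factor 4. Their squared Hilbert-Schmidt
    norms are at most W^2 wsq, twice W^2 remsq and, by submultiplicativity, remsq^2. *)
Lemma tr4_le_rem : (0 < p)%N ->
  tr4 (Gamw Sg wt) <= 4 * (W ^+ 2 * wsq + 2 * W ^+ 2 * remsq + remsq ^+ 2).
Proof.
move=> p0.
have w2 a : wt a ^+ 2 <= W ^+ 2.
  by rewrite ler_pXn2r// nnegrE ?(le_trans (wt0 a) (wtW a)).
pose FF a b := \sum_e Gamrem a e * Gamrem e b.
have sqE a b : sq (Gamw Sg wt) a b = (a == b)%:R * wt a ^+ 2 + wt a * Gamrem a b
    + Gamrem a b * wt b + FF a b.
  rewrite /sq /FF.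
  transitivity (\sum_e ((a == e)%:R * ((e == b)%:R * wt a * wt e + wt a * Gamrem e b)
      + (b == e)%:R * (Gamrem a e * wt e) + Gamrem a e * Gamrem e b)).
    apply: eq_bigr => e _; rewrite !GamE [b == e]eq_sym; ring.
  rewrite !big_split/= !sumI; congr (_ + _ + _); congr (_ + _).
  by rewrite expr2 mulrA.
have h a b : sq (Gamw Sg wt) a b ^+ 2 <= 4 * ((a == b)%:R * (W ^+ 2 * wt a ^+ 2) +
   W ^+ 2 * Gamrem a b ^+ 2 + W ^+ 2 * Gamrem a b ^+ 2 + FF a b ^+ 2).
  rewrite sqE.
  have k1 : ((a == b)%:R * wt a ^+ 2) ^+ 2 <= (a == b)%:R * (W ^+ 2 * wt a ^+ 2).
    case: eqP => _; rewrite ?mul0r ?expr0n// !mul1r expr2 ler_wpM2r ?sqr_ge0//.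
  have k2 : (wt a * Gamrem a b) ^+ 2 <= W ^+ 2 * Gamrem a b ^+ 2.
    by rewrite exprMn ler_wpM2r ?sqr_ge0.
  have k3 : (Gamrem a b * wt b) ^+ 2 <= W ^+ 2 * Gamrem a b ^+ 2.
    by rewrite exprMn mulrC ler_wpM2r ?sqr_ge0.
  move: k1 k2 k3; move: ((a == b)%:R * wt a ^+ 2) (wt a * _) (_ * wt b) (FF a b) => x y z t.
  move: (_ * (W ^+ 2 * _)) (W ^+ 2 * Gamrem _ _ ^+ 2) => X Y k1 k2 k3.
  have := sqr_ge0 (x - y); have := sqr_ge0 (x - z); have := sqr_ge0 (x - t).
  have := sqr_ge0 (y - z); have := sqr_ge0 (y - t); have := sqr_ge0 (z - t); nra.
apply: (@le_trans _ _ (\sum_a \sum_b 4 * ((a == b)%:R * (W ^+ 2 * wt a ^+ 2) +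
   W ^+ 2 * Gamrem a b ^+ 2 + W ^+ 2 * Gamrem a b ^+ 2 + FF a b ^+ 2))).
  by apply: ler_sum => a _; apply: ler_sum => b _; exact: h.
have FF_le : \sum_a \sum_b FF a b ^+ 2 <= remsq ^+ 2.
  have remC : remsq = \sum_b \sum_e Gamrem e b ^+ 2 by rewrite /remsq exchange_big.
  rewrite expr2 {2}remC /remsq sumM2.
  by apply: ler_sum => a _; apply: ler_sum => b _; rewrite sum_CS.
have -> : \sum_a \sum_b 4 * ((a == b)%:R * (W ^+ 2 * wt a ^+ 2) +
   W ^+ 2 * Gamrem a b ^+ 2 + W ^+ 2 * Gamrem a b ^+ 2 + FF a b ^+ 2) =
   4 * (W ^+ 2 * wsq + W ^+ 2 * remsq + W ^+ 2 * remsq + \sum_a \sum_b FF a b ^+ 2).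
  rewrite /wsq /remsq !mulr_sumr -!big_split/= mulr_sumr; apply: eq_bigr => a _.
  rewrite -mulr_sumr !big_split/= sumI -!mulr_sumr; ring.
by rewrite ler_wpM2l//; lra.
Qed.

Definition wS2 : R := \sum_a wt a * Sg a.1 a.2 ^+ 2.

(** The left side is <u, G u> with u_a = sqrt(w_a) s_a, whose squared norm is [wS2]; the diagonal
    part of G has norm at most W, the remainder at most its Hilbert-Schmidt norm. *)
Lemma lin_form_le : (0 < p)%N ->
  \sum_a \sum_b wt a * Sg a.1 a.2 * (wt b * Sg b.1 b.2) * Gam0 Sg a b <=
  (W + Num.sqrt remsq) * wS2.
Proof.
move=> p0; pose u a := Num.sqrt (wt a) * Sg a.1 a.2.
have uE a : u a ^+ 2 = wt a * Sg a.1 a.2 ^+ 2 by rewrite exprMn sqr_sqrtr.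
have wS0 : 0 <= wS2 by apply: sumr_ge0 => a _; rewrite mulr_ge0// sqr_ge0.
have -> : \sum_a \sum_b wt a * Sg a.1 a.2 * (wt b * Sg b.1 b.2) * Gam0 Sg a b =
   \sum_a wt a * u a ^+ 2 + \sum_a \sum_b u a * u b * Gamrem a b.
  rewrite -big_split/=; apply: eq_bigr => a _.
  have -> : wt a * u a ^+ 2 = \sum_b (a == b)%:R * (wt a * u a * u b).
    by rewrite (sumI a (fun b => wt a * u a * u b)) expr2 mulrA.
  rewrite -big_split/=.
  apply: eq_bigr => b _.
  transitivity (u a * u b * Gamw Sg wt a b); last by rewrite GamE; ring.
  rewrite /u /Gamw -{1}(sqr_sqrtr (wt0 a)) -{1}(sqr_sqrtr (wt0 b)); ring.
rewrite mulrDl lerD//.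
  rewrite /wS2 mulr_sumr; apply: ler_sum => a _; rewrite uE ler_wpM2r//.
  by rewrite mulr_ge0// sqr_ge0.
apply: le_trans (ler_norm _) _.
rewrite -(@ger0_norm _ wS2)// -[`|wS2|]sqrtr_sqr -sqrtrM// le_sqrt//.
  by rewrite mulr_ge0// sqr_ge0.
rewrite pair_bigA/=; apply: le_trans (sum_CS _ _) _.
rewrite mulrC /remsq pair_bigA/= ler_wpM2l//; first by apply: sumr_ge0 => ? _; exact: sqr_ge0.
rewrite le_eqVlt; apply/orP; left; apply/eqP.
rewrite /wS2 expr2 sumM2 pair_bigA/=; apply: eq_bigr => ab _.
by rewrite exprMn !uE.
Qed.

End frobenius.

(** * A Riemann sum for the profile of the weights *)

Section power_profile.
Context {R : realType}.
Variable s : R.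
Hypothesis s1 : 1 < s.

(** The integral of (1 - x^s)^2 over [0, 1]. *)
Definition profile_int : R := 2 * s ^+ 2 / ((s + 1) * (2 * s + 1)).

Let g (x : R) : R := (1 - x `^ s) ^+ 2.
Let G (x : R) : R := x - 2 / (s + 1) * x `^ (s + 1) + (2 * s + 1)^-1 * x `^ (2 * s + 1).

Let s0 : 0 < s. Proof. exact: lt_trans s1. Qed.

Let deriv_G (x : R) : 0 < x -> is_derive x 1 G (g x).
Proof.
move=> x0; rewrite /G.
apply: (is_derive_eq (derivD (derivB (is_derive_id x 1) (derivZ _ (is_derive1_powR _ x0)))
  (derivZ _ (is_derive1_powR _ x0)))).
rewrite !addrK /g (_ : 2 * s = s + s); last ring.
rewrite powRD; last by apply/implyP => _; rewrite gt_eqF.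
have n1 : s + 1 != 0 by rewrite gt_eqF// addr_gt0.
have n2 : s + s + 1 != 0 by rewrite gt_eqF// !addr_gt0.
by field; rewrite n1 n2.
Qed.

Let pow_le1 x : 0 <= x <= 1 -> 0 <= x `^ s <= 1.
Proof.
move=> /andP[x0 x1]; rewrite powR_ge0/=.
have <- : 1 `^ s = 1 :> R by rewrite powR1.
by rewrite ge0_ler_powR// ?nnegrE// ltW.
Qed.

Let g01 x : 0 <= x <= 1 -> 0 <= g x <= 1.
Proof. by move=> /pow_le1 /andP[a b]; rewrite /g; apply/andP; split; nra. Qed.

Let g_anti x y : 0 <= x -> x <= y -> y <= 1 -> g y <= g x.
Proof.
move=> x0 xy y1.
have /andP[_ y1'] : 0 <= y `^ s <= 1 by rewrite pow_le1// (le_trans x0).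
have xy' : x `^ s <= y `^ s by apply: ge0_ler_powR; rewrite ?nnegrE ?(ltW s0) ?(le_trans x0 xy).
have := powR_ge0 x s; rewrite /g; nra.
Qed.

(** Controls the first cell [0, 1/N], which the mean value argument avoids because [deriv_G]
    excludes 0. *)
Let G_small x : 0 < x <= 1 -> 0 <= G x <= x.
Proof.
move=> /andP[x0 x1]; have /andP[a b] : 0 <= x `^ s <= 1 by rewrite pow_le1// ltW.
have -> : G x = x * (1 - 2 / (s + 1) * x `^ s + (2 * s + 1)^-1 * (x `^ s) ^+ 2).
  rewrite /G (_ : 2 * s + 1 = s + s + 1); last ring.
  rewrite !powRD ?powRr1 ?ltW// ?(gt_eqF x0) ?implybT//; ring.
move: (x `^ s) a b => y y0 y1.
have s1' := s1.
have h1 : 2 / (s + 1) <= 1 by rewrite ler_pdivrMr; lra.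
have h2 : (2 * s + 1)^-1 <= 2 / (s + 1).
  rewrite ler_pdivlMr; last lra.
  by rewrite mulrC ler_pdivrMr; lra.
have h3 : 0 <= (2 * s + 1)^-1 by rewrite invr_ge0; lra.
move: (2 / (s + 1)) (2 * s + 1)^-1 h1 h2 h3 => u v h1 h2 h3.
apply/andP; split; first by apply: mulr_ge0; nra.
have yy : y ^+ 2 <= y by nra.
have vu : v * y ^+ 2 <= u * y by apply: ler_pM => //; exact: sqr_ge0.
by apply: ler_piMr; [exact: ltW|lra].
Qed.

Let G1 : G 1 = profile_int.
Proof.
rewrite /G /profile_int !powR1.
have n1 : s + 1 != 0 by rewrite gt_eqF// addr_gt0.
have n2 : 2 * s + 1 != 0 by rewrite gt_eqF// addr_gt0// mulr_gt0.
by field; rewrite n1 n2.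
Qed.

(** [g] decreases on [0, 1] with values in [0, 1], so its Riemann sum differs from N times the
    integral by at most one term. *)
Lemma sum_profile (N : nat) : (0 < N)%N ->
  `|\sum_(1 <= k < N) (1 - (k%:R / N%:R) `^ s) ^+ 2 - N%:R * profile_int| <= 1.
Proof.
move=> N0; have N0' : 0 < N%:R :> R by rewrite ltr0n.
pose x (k : nat) : R := k%:R / N%:R.
have x0 k : 0 <= x k by rewrite divr_ge0.
have xS k : x k.+1 - x k = N%:R^-1 by rewrite /x -mulrBl -natr1 addrAC subrr add0r mul1r.
have xle k : x k <= x k.+1 by rewrite -subr_ge0 xS invr_ge0 ltW.
have x1 k : (k <= N)%N -> x k <= 1 by move=> kN; rewrite ler_pdivrMr// mul1r ler_nat.
have step k : (0 < k)%N -> (k < N)%N ->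
    g (x k.+1) <= N%:R * (G (x k.+1) - G (x k)) <= g (x k).
  move=> k0 kN.
  have d t : x k <= t <= x k.+1 -> is_derive t 1 G (g t).
    by move=> /andP[xt _]; apply: deriv_G; rewrite (lt_le_trans _ xt)// divr_gt0// ltr0n.
  have [z /andP[z1 z2] ->] := deriv_MVT (xle k) d.
  rewrite xS mulrCA mulfV ?gt_eqF// mulr1; apply/andP; split; apply: g_anti => //.
  - exact: le_trans z1.
  - exact: x1.
  - exact: le_trans z2 (x1 _ _).
have tel : \sum_(1 <= k < N) (N%:R * (G (x k.+1) - G (x k))) = N%:R * (profile_int - G (x 1%N)).
  by rewrite -mulr_sumr telescope_sumr// /x divff ?gt_eqF// G1.
have x1E : x 1%N = N%:R^-1 by rewrite /x mul1r.
have /G_small/andP[Ga Gb] : 0 < x 1%N <= 1 by rewrite x1// x1E invr_gt0 N0'.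
have hG : 0 <= N%:R * G (x 1%N) <= 1.
  rewrite mulr_ge0//= -[X in _ <= X](mulfV (lt0r_neq0 N0')) -x1E.
  by rewrite ler_wpM2l.
have lo : N%:R * (profile_int - G (x 1%N)) <= \sum_(1 <= k < N) g (x k).
  by rewrite -tel; apply: ler_sum_nat => k /andP[k0 kN]; case/andP: (step k k0 kN).
have hi : \sum_(1 <= k < N) g (x k.+1) <= N%:R * (profile_int - G (x 1%N)).
  by rewrite -tel; apply: ler_sum_nat => k /andP[k0 kN]; case/andP: (step k k0 kN).
(* Shifting the index loses the first term, at most 1, and gains a nonnegative last one. *)
have shift : \sum_(1 <= k < N) g (x k) <= 1 + \sum_(1 <= k < N) g (x k.+1).
  have [N1|N1] := leqP N 1.
    by rewrite !big_geq// addr0 ler01.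
  rewrite big_ltn// lerD//; first by have /andP[] := @g01 (x 1%N) ltac:(by rewrite x0 x1).
  rewrite -[N in leLHS]prednK// big_add1/= -[N in leRHS]prednK// big_nat_recr/=; last by rewrite -ltnS prednK.
  by rewrite lerDl; have /andP[] := @g01 (x N.-1.+1) ltac:(by rewrite x0 x1// prednK).
rewrite -[\sum_(1 <= k < N) _]/(\sum_(1 <= k < N) g (x k)).
rewrite ler_norml; apply/andP; split; lra.
Qed.

End power_profile.

(** * Sums over pairs of a function of the gap *)

Section gap_sums.
Context {R : realType} {p : nat}.
Variables (h : nat -> R) (N : nat).
Hypothesis h_ge0 : forall d, 0 <= h d.
Hypothesis h0 : forall d, (N <= d)%N -> h d = 0.

Lemma sum_gap_row (i : 'I_p) :
  \sum_(j < p | (i < j)%N) h (j - i) = \sum_(1 <= d < p - i) h d.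
Proof.
rewrite -(big_mkord (fun j => (i < j)%N) (fun j => h (j - i))).
rewrite (big_cat_nat _ (n := i.+1))//= big_nat_cond big_pred0 ?add0r => [|j]; last first.
  by rewrite ltnS; case: leqP => //; rewrite andbF.
rewrite -[X in \sum_(X <= _ < _ | _) _]add1n big_addn.
rewrite big_nat_cond [RHS]big_nat_cond; apply: eq_big => [d|d _]; last by rewrite addnK.
by rewrite andbT; case: d => //= d; rewrite addSn ltnS leq_addl andbT.
Qed.

Lemma sum_gap_col (j : 'I_p) :
  \sum_(i < p | (i < j)%N) h (j - i) = \sum_(1 <= d < j.+1) h d.
Proof.
rewrite -(big_mkord (fun i => (i < j)%N) (fun i => h (j - i))).
have -> : \sum_(0 <= i < p | (i < j)%N) h (j - i) = \sum_(0 <= i < j) h (j - i).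
  by rewrite (big_nat_widen _ _ _ _ _ (ltnW (ltn_ord j))).
rewrite big_nat_rev/= add0n big_add1/=.
by apply: eq_big_nat => i /andP[_ ij]; rewrite subKn.
Qed.

Lemma gap_sum_le m : \sum_(1 <= d < m) h d <= \sum_(1 <= d < N) h d.
Proof.
have [mN|Nm] := leqP m N.
  have [m1|m1] := leqP m 1; first by rewrite big_geq//; apply: sumr_ge0.
  by rewrite [leRHS](big_cat_nat _ (n := m)) ?(ltnW m1)//= lerDl sumr_ge0.
have [N1|N1] := leqP N 1.
  rewrite big_nat_cond big1 ?sumr_ge0// => d /andP[/andP[d1 _] _].
  by rewrite h0// (leq_trans N1).
rewrite (big_cat_nat _ (n := N)) ?(ltnW N1) ?(ltnW Nm)//=.
rewrite [X in _ + X]big_nat_cond [X in _ + X]big1 ?addr0// => d /andP[/andP[d1 _] _].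
exact: h0.
Qed.

Lemma gap_sum_eq m : (N <= m)%N -> \sum_(1 <= d < m) h d = \sum_(1 <= d < N) h d.
Proof.
move=> Nm; apply/eqP; rewrite eq_le gap_sum_le/=.
have [N1|N1] := leqP N 1; first by rewrite big_geq// sumr_ge0.
by rewrite [leRHS](big_cat_nat _ (n := N)) ?(ltnW N1)//= lerDl sumr_ge0.
Qed.

Lemma gap_row_le (i : 'I_p) : \sum_(j < p | (i < j)%N) h (j - i) <= \sum_(1 <= d < N) h d.
Proof. by rewrite sum_gap_row gap_sum_le. Qed.

Lemma gap_col_le (j : 'I_p) : \sum_(i < p | (i < j)%N) h (j - i) <= \sum_(1 <= d < N) h d.
Proof. by rewrite sum_gap_col gap_sum_le. Qed.

Lemma gap_sum2_le : \sum_(i < p) \sum_(j < p | (i < j)%N) h (j - i) <=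
  p%:R * \sum_(1 <= d < N) h d.
Proof.
apply: (@le_trans _ _ (\sum_(i < p) \sum_(1 <= d < N) h d)).
  by apply: ler_sum => i _; exact: gap_row_le.
by rewrite sumr_const card_ord mulr_natl.
Qed.

(** The rows i < p - N contain every gap below N. *)
Lemma gap_sum2_ge : (p%:R - N%:R) * \sum_(1 <= d < N) h d <=
  \sum_(i < p) \sum_(j < p | (i < j)%N) h (j - i).
Proof.
set H := \sum_(1 <= d < N) _; have H0 : 0 <= H by apply: sumr_ge0.
have [pN|Np] := leqP p N.
  apply: (@le_trans _ _ 0); last by apply: sumr_ge0 => i _; apply: sumr_ge0.
  by rewrite mulr_le0_ge0// subr_le0 ler_nat.
apply: (@le_trans _ _ (\sum_(i < p | (i < p - N)%N) H)); last first.
  rewrite big_mkcond/=; apply: ler_sum => i _; case: ifP => [iN|_]; last exact: sumr_ge0.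
  by rewrite sum_gap_row gap_sum_eq//; move: iN Np; lia.
rewrite -(big_mkord (fun i => (i < p - N)%N) (fun=> H)).
have -> : \sum_(0 <= i < p | (i < p - N)%N) H = \sum_(0 <= i < p - N) H.
  by rewrite (big_nat_widen _ _ _ _ _ (leq_subr N p)).
by rewrite sumr_const_nat subn0 -natrB 1?ltnW// mulr_natl.
Qed.

End gap_sums.

(** * The weights of the statistic *)

Section weights.
Context {R : realType}.
Variables (alpha L phi : R).
Hypothesis halpha : 1 / 2 < alpha.
Hypothesis hL : 0 < L.
Hypothesis phi0 : 0 < phi.

Let s := 2 * alpha.
Let s1 : 1 < s. Proof. by rewrite /s; move: halpha; lra. Qed.
Let s0 : 0 < s. Proof. exact: lt_trans s1. Qed.
Let alpha0 : 0 < alpha. Proof. by move: halpha; lra. Qed.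

(** [bandwidth] is T before rounding, [wscale] the common factor of the weights and a bound for
    them; [kappa] is the value of wscale^2 * bandwidth, in which phi and L cancel. *)
Definition bandwidth : R := const_CT alpha L * phi `^ (- alpha^-1).
Definition wscale : R := lambda_phi alpha L phi / (2 * b_phi alpha L phi).
Definition Cscale : R := const_Clambda alpha L / (2 * Num.sqrt (const_C alpha L)).
Definition kappa : R := (s + 1) * (2 * s + 1) / (4 * s ^+ 2).

Lemma const_CT_gt0 : 0 < const_CT alpha L.
Proof. by apply: powR_gt0; apply: mulr_gt0 => //; move: alpha0; lra. Qed.

Lemma const_Clambda_gt0 : 0 < const_Clambda alpha L.
Proof.
apply: mulr_gt0; first by apply: divr_gt0; move: alpha0; lra.
by apply: powR_gt0; apply: mulr_gt0 => //; move: alpha0; lra.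
Qed.

Lemma const_C_gt0 : 0 < const_C alpha L.
Proof.
apply: mulr_gt0; last exact: powR_gt0.
apply: divr_gt0; first by move: alpha0; lra.
by apply: powR_gt0; move: alpha0; lra.
Qed.

Lemma Cscale_gt0 : 0 < Cscale.
Proof. by rewrite divr_gt0 ?const_Clambda_gt0// mulr_gt0// sqrtr_gt0 const_C_gt0. Qed.

Lemma b_phi_gt0 : 0 < b_phi alpha L phi.
Proof. by rewrite mulr_gt0 ?sqrtr_gt0 ?const_C_gt0// powR_gt0. Qed.

Lemma bandwidth_gt0 : 0 < bandwidth.
Proof. by rewrite mulr_gt0 ?const_CT_gt0// powR_gt0. Qed.

Let phiD x y : phi `^ (x + y) = phi `^ x * phi `^ y.
Proof. by rewrite powRD// (gt_eqF phi0) implybT. Qed.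

Lemma wscaleE : wscale = Cscale * phi `^ s^-1.
Proof.
rewrite /wscale /Cscale /lambda_phi /b_phi.
have -> : phi `^ ((2 * alpha + 1) / alpha) = phi `^ s^-1 * phi `^ (2 + (2 * alpha)^-1).
  by rewrite -phiD; congr (_ `^ _); rewrite /s; field; rewrite gt_eqF.
have : phi `^ (2 + (2 * alpha)^-1) != 0 by rewrite gt_eqF// powR_gt0.
have : Num.sqrt (const_C alpha L) != 0 by rewrite gt_eqF// sqrtr_gt0 const_C_gt0.
move: (phi `^ (2 + _)) (Num.sqrt _) => x y x0 y0; field; by rewrite x0 y0.
Qed.

Lemma wscale_gt0 : 0 < wscale.
Proof. by rewrite wscaleE mulr_gt0 ?Cscale_gt0// powR_gt0. Qed.

Lemma wscale_sqr : wscale ^+ 2 * bandwidth = kappa.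
Proof.
have q0 : 0 < 2 * s + 1 by move: s0; lra.
have qE : 4 * alpha + 1 = 2 * s + 1 by rewrite /s; ring.
rewrite wscaleE /bandwidth exprMn.
have -> : Cscale ^+ 2 * phi `^ s^-1 ^+ 2 * (const_CT alpha L * phi `^ (- alpha^-1)) =
    Cscale ^+ 2 * const_CT alpha L * (phi `^ s^-1 ^+ 2 * phi `^ (- alpha^-1)) by ring.
have -> : phi `^ s^-1 ^+ 2 * phi `^ (- alpha^-1) = 1.
  rewrite expr2 -!phiD (_ : _ - _ = 0) ?powRr0// /s; field; by rewrite gt_eqF.
rewrite mulr1 /Cscale expr_div_n [X in _ / X]exprMn sqr_sqrtr; last exact/ltW/const_C_gt0.
rewrite /const_Clambda /const_C /const_CT qE.
rewrite -[2 * alpha]/s !powRN powRD; last by rewrite (gt_eqF q0) implybT.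
rewrite powRr1 ?ltW// powRM ?ltW//.
have : (2 * s + 1) `^ s^-1 != 0 by rewrite gt_eqF// powR_gt0.
have : L `^ s^-1 != 0 by rewrite gt_eqF// powR_gt0.
have s0' : s != 0 by rewrite gt_eqF.
have s1' : s + 1 != 0 by rewrite gt_eqF// addr_gt0.
have q0' : 2 * s + 1 != 0 by rewrite gt_eqF.
rewrite /kappa; move: (_ `^ _) (L `^ _) s0' s1' q0' => x y s0' s1' q0' y0 x0; field.
by rewrite x0 y0 s0' s1' q0'.
Qed.

(** The calibration of the constants: a complete row contributes about wscale^2 * bandwidth times
    the integral of the squared profile, that is 1/2, to the sum of the squared weights. *)
Lemma kappa_profile : kappa * profile_int s = 1 / 2.
Proof.
have s0' : s != 0 by rewrite gt_eqF.
have s1' : s + 1 != 0 by rewrite gt_eqF// addr_gt0.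
have q0' : 2 * s + 1 != 0 by rewrite gt_eqF// addr_gt0// mulr_gt0.
by rewrite /kappa /profile_int; field; rewrite s0' s1' q0'.
Qed.

Lemma kappa_gt0 : 0 < kappa.
Proof. by rewrite divr_gt0 ?mulr_gt0 ?addr_gt0 ?mulr_gt0 ?exprn_gt0. Qed.

Definition band : nat := `|T_phi alpha L phi|.

Lemma bandE : (T_phi alpha L phi)%:~R = band%:R :> R.
Proof.
have T0 : 0 <= T_phi alpha L phi by rewrite floor_ge0; exact/ltW/bandwidth_gt0.
by rewrite /band -[in LHS](gez0_abs T0).
Qed.

Lemma band_le : band%:R <= bandwidth.
Proof. by rewrite -bandE ge_floor. Qed.

Lemma band_gt : bandwidth < band%:R + 1.
Proof. by rewrite -bandE -(@intrD1 R) floorD1_gt. Qed.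

Definition prof (d : nat) : R := Num.max 0 (1 - (d%:R / band%:R) `^ s).

Lemma prof01 d : 0 <= prof d <= 1.
Proof. by rewrite /prof le_max lexx/= ge_max ler01/= gerBl powR_ge0. Qed.

Hypothesis band0 : (0 < band)%N.

Lemma prof_out d : (band <= d)%N -> prof d = 0.
Proof.
move=> bd; apply/max_idPl; rewrite subr_le0 -[leLHS](congr1 (@^~ s) (@powR1 R)).
apply: ge0_ler_powR; rewrite ?nnegrE ?divr_ge0 ?(ltW s0)//.
by rewrite ler_pdivlMr ?ltr0n// mul1r ler_nat.
Qed.

Lemma prof_in d : (d < band)%N -> prof d = 1 - (d%:R / band%:R) `^ s.
Proof.
move=> db; apply/max_idPr; rewrite subr_ge0 -[leRHS](congr1 (@^~ s) (@powR1 R)).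
apply: ge0_ler_powR; rewrite ?nnegrE ?divr_ge0 ?(ltW s0)//.
by rewrite ler_pdivrMr ?ltr0n// mul1r ler_nat ltnW.
Qed.

(** For 0 <= x <= 1/2 and s >= 1, x^s <= x <= 1/2. Thus up to half the band away from the diagonal
    the weights are at least wscale / 2. *)
Lemma prof_near d : (2 * d <= band)%N -> 1 / 2 <= prof d.
Proof.
move=> db; have x2 : d%:R / band%:R <= 1 / 2 :> R.
  by rewrite ler_pdivrMr ?ltr0n// mulrAC mul1r ler_pdivlMr// mulrC -natrM ler_nat.
have x0 : 0 <= d%:R / band%:R :> R by rewrite divr_ge0.
rewrite /prof le_max; apply/orP; right.
move: (_ / band%:R) x0 x2 => x x0 x2.
have [->|xn0] := eqVneq x 0; first by rewrite powR0 ?gt_eqF//; lra.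
have := @ge1r_powR _ x s _ (ltW s1); rewrite lt_def xn0 x0/= => /(_ _); lra.
Qed.

Lemma weightE (i j : nat) : (i < j)%N -> weight alpha L phi i j = wscale * prof (j - i).
Proof.
move=> ij; rewrite /weight /prof bandE; congr (_ * Num.max _ (_ - (_ / _) `^ _)).
by rewrite distrC ger0_norm ?natrB 1?ltnW// subr_ge0 ler_nat ltnW.
Qed.

Variable p : nat.

Definition wt (a : 'I_p * 'I_p) : R :=
  if (a.1 < a.2)%N then weight alpha L phi a.1 a.2 else 0.

Lemma wtE a : wt a = if (a.1 < a.2)%N then wscale * prof (a.2 - a.1) else 0.
Proof. by rewrite /wt; case: ifP => // h; rewrite weightE. Qed.

Lemma wt_ge0 a : 0 <= wt a.
Proof.
rewrite wtE; case: ifP => // _; rewrite mulr_ge0 ?(ltW wscale_gt0)//.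
by case/andP: (prof01 (a.2 - a.1)).
Qed.

Lemma wt_le a : wt a <= wscale.
Proof.
rewrite wtE; case: ifP => _; last exact/ltW/wscale_gt0.
by apply: ler_piMr; [exact/ltW/wscale_gt0|case/andP: (prof01 (a.2 - a.1))].
Qed.

Lemma wt_neq0 a : wt a != 0 -> (a.1 < a.2)%N.
Proof. by rewrite wtE; case: ifP => //; rewrite eqxx. Qed.

Let hh d := wscale * prof d.
Let hh_ge0 d : 0 <= hh d.
Proof. by rewrite mulr_ge0 ?(ltW wscale_gt0)//; case/andP: (prof01 d). Qed.
Let hh0 d : (band <= d)%N -> hh d = 0.
Proof. by move=> /prof_out; rewrite /hh => ->; rewrite mulr0. Qed.

Let hh_sum : \sum_(1 <= d < band) hh d <= wscale * bandwidth.
Proof.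
apply: (@le_trans _ _ (\sum_(1 <= d < band) wscale)).
  apply: ler_sum_nat => d _; apply: ler_piMr; [exact/ltW/wscale_gt0|].
  by case/andP: (prof01 d).
rewrite sumr_const_nat -mulr_natr ler_wpM2l ?(ltW wscale_gt0)//.
by rewrite (le_trans _ band_le)// ler_nat leq_subr.
Qed.

Lemma wt_row i : \sum_j wt (i, j) <= wscale * bandwidth.
Proof.
apply: le_trans hh_sum; apply: le_trans (gap_row_le hh_ge0 hh0 i).
by rewrite [leRHS]big_mkcond/=; apply: ler_sum => j _; rewrite wtE.
Qed.

Lemma wt_col j : \sum_i wt (i, j) <= wscale * bandwidth.
Proof.
apply: le_trans hh_sum; apply: le_trans (gap_col_le hh_ge0 hh0 j).
by rewrite [leRHS]big_mkcond/=; apply: ler_sum => i _; rewrite wtE.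
Qed.

Let wsqE : wsq wt = \sum_(i < p) \sum_(j < p | (i < j)%N) hh (j - i) ^+ 2.
Proof.
rewrite /wsq -(pair_bigA _ (fun i j => wt (i, j) ^+ 2))/=; apply: eq_bigr => i _.
rewrite [RHS]big_mkcond/=; apply: eq_bigr => j _; rewrite wtE/=.
by case: ifP => _ //; rewrite expr0n.
Qed.

(** A complete row sums to S = wscale^2 V with V within 1 of band * profile_int, and [band] is
    within 1 of [bandwidth], whence |S - 1/2| <= 2 wscale^2. Incomplete rows cost a fraction
    bandwidth / p. *)
Lemma wsq_approx : (0 < p)%N ->
  `|wsq wt / p%:R - 1 / 2| <= 2 * wscale ^+ 2 + (1 / 2 + 2 * wscale ^+ 2) * (bandwidth / p%:R).
Proof.
move=> p0; have p0' : 0 < p%:R :> R by rewrite ltr0n.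
pose h2 d := hh d ^+ 2.
have h2_ge0 d : 0 <= h2 d by exact: sqr_ge0.
have h20 d : (band <= d)%N -> h2 d = 0 by rewrite /h2 => /hh0 ->; rewrite expr0n.
set S := \sum_(1 <= d < band) h2 d.
have up : wsq wt <= p%:R * S by rewrite wsqE; exact: gap_sum2_le.
have lo : (p%:R - band%:R) * S <= wsq wt by rewrite wsqE; exact: gap_sum2_ge.
have SE : S = wscale ^+ 2 * \sum_(1 <= k < band) (1 - (k%:R / band%:R) `^ s) ^+ 2.
  rewrite mulr_sumr; apply: eq_big_nat => k /andP[_ kb].
  by rewrite /h2 /hh prof_in// exprMn.
have := sum_profile s1 band0; rewrite ler_norml => /andP[].
move: SE; set V := \sum_(1 <= k < _) _ => SE Vlo Vup.
have I0 : 0 <= profile_int s.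
  by rewrite divr_ge0 ?mulr_ge0 ?sqr_ge0 ?addr_ge0 ?mulr_ge0// ltW.
have I1 : profile_int s <= 1.
  rewrite ler_pdivrMr ?mulr_gt0 ?addr_gt0 ?mulr_gt0// mul1r expr2.
  by move: s0; nra.
have w0 : 0 <= wscale ^+ 2 by exact: sqr_ge0.
have wk : wscale ^+ 2 * bandwidth * profile_int s = 1 / 2.
  by rewrite wscale_sqr kappa_profile.
have b1 := band_le; have b2 := band_gt.
have S_ge0 : 0 <= S by apply: sumr_ge0.
have Sb : `|S - 1 / 2| <= 2 * wscale ^+ 2.
  rewrite -wk SE -mulrA -mulrBr normrM (ger0_norm w0) mulrC ler_wpM2r//.
  rewrite ler_norml; apply/andP; split; nra.
have bp : 0 <= bandwidth / p%:R by rewrite divr_ge0 ?(ltW bandwidth_gt0) ?ltW.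
have up' : wsq wt / p%:R <= S by rewrite ler_pdivrMr// mulrC.
have lo' : S - S * (bandwidth / p%:R) <= wsq wt / p%:R.
  rewrite ler_pdivlMr// mulrBl mulrA divfK ?gt_eqF//.
  apply: le_trans lo; rewrite mulrBl [p%:R * S]mulrC lerB// [leLHS]mulrC.
  by rewrite ler_wpM2l.
move: Sb; rewrite ler_norml => /andP[S1 S2].
have Sbp : S * (bandwidth / p%:R) <= (1 / 2 + 2 * wscale ^+ 2) * (bandwidth / p%:R).
  by rewrite ler_wpM2r//; lra.
have : 0 <= (1 / 2 + 2 * wscale ^+ 2) * (bandwidth / p%:R) by apply: mulr_ge0 => //; lra.
rewrite ler_norml => ?; apply/andP; split; lra.
Qed.

End weights.

(** * The off-diagonal mass of Sigma *)

Section off_diagonal.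
Context {R : realType}.
Variables (alpha L phi : R) (p : nat) (Sg : 'M[R]_p).
Hypothesis halpha : 1 / 2 < alpha.
Hypothesis hL : 0 < L.
Hypothesis phi0 : 0 < phi.
Hypothesis hF : class_F alpha L Sg.

Let s := 2 * alpha.
Let s0 : 0 < s. Proof. by rewrite /s; move: halpha; lra. Qed.

(** The first summand comes from the pairs near the diagonal, the second from the distant ones; the
    outer 2 counts both triangles of the symmetric matrix. *)
Definition Coff (K : R) : R :=
  2 * (2 * K * (Num.sqrt (const_C alpha L) / Cscale alpha L) + (4 / const_CT alpha L) `^ s * L).

Let SgC i j : Sg i j = Sg j i.
Proof. by case: hF => SgT _ _ _; rewrite -{1}SgT mxE. Qed.

Let upper : R := \sum_(i < p) \sum_(j < p | (i < j)%N) Sg i j ^+ 2.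

Let offsumE : offsum Sg = 2 * upper.
Proof.
have uE : upper = \sum_(i < p) \sum_(j < p) (if (i < j)%N then Sg i j ^+ 2 else 0).
  by apply: eq_bigr => i _; rewrite -big_mkcond.
have uE' : upper = \sum_(i < p) \sum_(j < p) (if (j < i)%N then Sg i j ^+ 2 else 0).
  rewrite uE exchange_big/=; apply: eq_bigr => i _; apply: eq_bigr => j _.
  by rewrite SgC.
rewrite mulr2n mulrDl !mul1r {1}uE uE' -big_split/=; apply: eq_bigr => i _.
rewrite -big_split/=; apply: eq_bigr => j _; rewrite /off2.
case: (ltngtP i j) => [ij|ij|/val_inj ->]; rewrite ?addr0 ?add0r ?eqxx//;
  by rewrite -val_eqE/= ?(ltn_eqF ij) ?(gtn_eqF ij).
Qed.

Hypothesis bw2 : 2 <= bandwidth alpha L phi.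

Lemma band_ge : bandwidth alpha L phi / 2 <= (band alpha L phi)%:R.
Proof. by have := band_gt halpha hL phi0; move: bw2; lra. Qed.

Lemma band_gt0 : (0 < band alpha L phi)%N.
Proof. by rewrite -(ltr0n R); apply: lt_le_trans band_ge; move: bw2; lra. Qed.

(** Split at half the band. Near the diagonal the weights are bounded below, so the mass is at most
    2 / W times the weighted sum; farther out the factor gap^(2 alpha) of the class is at least
    (bandwidth / 4)^(2 alpha). *)
Lemma offsum_le K : (0 < p)%N ->
  wS2 Sg (wt alpha L phi (p:=p)) <= p%:R * (K * b_phi alpha L phi) ->
  offsum Sg <= Coff K * (p%:R * phi ^+ 2).
Proof.
move=> p0 hw; have p0' : 0 < p%:R :> R by rewrite ltr0n.
have [_ _ _ hsum] := hF.
pose W := wscale alpha L phi; pose bw := bandwidth alpha L phi.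
have W0 : 0 < W by exact: wscale_gt0.
have bw0 : 0 < bw by exact: bandwidth_gt0.
have pt (i j : 'I_p) : (i < j)%N -> Sg i j ^+ 2 <=
   2 / W * (wt alpha L phi (i, j) * Sg i j ^+ 2) +
   (4 / bw) `^ s * (Sg i j ^+ 2 * `|i%:R - j%:R| `^ s).
  move=> ij; have S0 := sqr_ge0 (Sg i j).
  have ijE : `|i%:R - j%:R| = (j - i)%:R :> R.
    by rewrite distrC ger0_norm ?natrB 1?ltnW// subr_ge0 ler_nat ltnW.
  have [near|far] := leqP (2 * (j - i)) (band alpha L phi).
    rewrite -[leLHS]addr0 lerD//; last by do 2 (apply: mulr_ge0; rewrite ?powR_ge0//).
    rewrite mulrA ler_peMl// wtE//= ij -/W mulrA mulfVK ?gt_eqF//.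
    by have := prof_near halpha band_gt0 near; lra.
  rewrite -[leLHS]add0r lerD//.
    by apply: mulr_ge0; [apply: divr_ge0; rewrite ?(ltW W0)|apply: mulr_ge0; rewrite ?wt_ge0].
  rewrite mulrCA ler_peMr// -powRM ?divr_ge0 ?(ltW bw0)//.
  rewrite -[leLHS](congr1 (@^~ s) (@powR1 R)); apply: ge0_ler_powR.
  - exact: ltW.
  - by rewrite nnegrE.
  - by rewrite nnegrE mulr_ge0 ?divr_ge0 ?(ltW bw0).
  rewrite ijE mulrAC ler_pdivlMr// mul1r.
  have : (band alpha L phi)%:R <= 2 * (j - i)%:R :> R by rewrite -natrM ler_nat ltnW.
  by have := band_ge; rewrite -/bw; lra.
have up : upper <= 2 / W * wS2 Sg (wt alpha L phi (p:=p)) + (4 / bw) `^ s * (p%:R * L).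
  apply: (@le_trans _ _ (\sum_(i < p) \sum_(j < p | (i < j)%N) (2 / W * (wt alpha L phi (i, j) * Sg i j ^+ 2) +
   (4 / bw) `^ s * (Sg i j ^+ 2 * `|i%:R - j%:R| `^ s)))).
    by apply: ler_sum => i _; apply: ler_sum => j; exact: pt.
  under eq_bigr do rewrite big_split/= -!mulr_sumr.
  rewrite big_split/= -!mulr_sumr lerD//.
    apply: ler_wpM2l; first by rewrite divr_ge0 ?(ltW W0).
    rewrite /wS2 [leRHS](_ : _ = \sum_i \sum_j wt alpha L phi (i, j) * Sg i j ^+ 2); last first.
      by rewrite pair_bigA; apply: eq_bigr => -[].
    apply: ler_sum => i _; rewrite big_mkcond/=; apply: ler_sum => j _.
    by case: ifP => // _; rewrite mulr_ge0 ?sqr_ge0// wt_ge0.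
  by rewrite ler_wpM2l ?powR_ge0// -ler_pdivrMl.
have bW : b_phi alpha L phi = Num.sqrt (const_C alpha L) / Cscale alpha L * (W * phi ^+ 2).
  rewrite /W wscaleE// -/s /b_phi -/s powRD; last by rewrite (gt_eqF phi0) implybT.
  rewrite -[phi ^+ 2]powR_mulrn ?(ltW phi0)//; field.
  by rewrite gt_eqF// Cscale_gt0.
(* bandwidth^(-2 alpha) is of order phi^2, the same order as b / W in [bW]. *)
have bws : (4 / bw) `^ s = (4 / const_CT alpha L) `^ s * phi ^+ 2.
  have -> : 4 / bw = 4 / const_CT alpha L * phi `^ alpha^-1.
    rewrite /bw /bandwidth powRN; field.
    by rewrite !gt_eqF ?const_CT_gt0 ?powR_gt0.
  rewrite powRM ?powR_ge0 ?divr_ge0 ?(ltW (const_CT_gt0 _ _))// -powRrM.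
  have -> : alpha^-1 * s = 2%:R by rewrite /s mulrCA mulVf ?mulr1// gt_eqF//; move: halpha; lra.
  by rewrite powR_mulrn// ltW.
rewrite offsumE /Coff -[_ * (p%:R * _)]mulrA ler_wpM2l//.
apply: le_trans up _; rewrite bws [leRHS]mulrDl; apply: lerD.
  apply: (@le_trans _ _ (2 / W * (p%:R * (K * b_phi alpha L phi)))).
    by rewrite ler_wpM2l// divr_ge0// ltW.
  rewrite bW le_eqVlt; apply/orP; left; apply/eqP; field.
  by rewrite !gt_eqF// Cscale_gt0.
by rewrite le_eqVlt; apply/orP; left; apply/eqP; ring.
Qed.

End off_diagonal.

(** * Asymptotics *)

Section null_sequences.
Context {R : realType}.
Implicit Types u v : nat -> R.

Definition null u : Prop := u m @[m --> \oo] --> (0 : R).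

Lemma null_le u v : (\forall m \near \oo, `|u m| <= v m) -> null v -> null u.
Proof.
move=> uv hv; apply/norm_cvg0P; apply: (squeeze_cvgr (f := fun=> 0) (h := v)) hv.
  by apply: filterS uv => m ->; rewrite normr_ge0.
exact: cvg_cst.
Qed.

Lemma nullD u v : null u -> null v -> null (fun m => u m + v m).
Proof. by move=> hu hv; rewrite /null -[X in _ --> X](addr0 0); exact: cvgD. Qed.

Lemma nullM u v : null u -> null v -> null (fun m => u m * v m).
Proof. by move=> hu hv; rewrite /null -[X in _ --> X](mulr0 0); exact: cvgM. Qed.

Lemma nullZ c u : null u -> null (fun m => c * u m).
Proof. by move=> hu; rewrite /null -[X in _ --> X](mulr0 c); exact: cvgMr. Qed.

Lemma null_norm u : null u -> null (fun m => `|u m|).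
Proof. by move=> hu; rewrite /null -[X in _ --> X](@normr0 _ R); exact: cvg_norm. Qed.

Lemma null_sqrt u : null u -> null (fun m => Num.sqrt (u m)).
Proof.
by move=> hu; rewrite /null -[X in _ --> X]sqrtr0; apply: continuous_cvg => //; exact: sqrt_continuous.
Qed.

Lemma null_near u e : 0 < e -> null u -> \forall m \near \oo, `|u m| <= e.
Proof. by move=> e0 hu; apply: cvgr0_norm_le. Qed.

Lemma null_inv_nat (n : nat -> nat) : n @ \oo --> \oo -> null (fun m => (n m)%:R^-1).
Proof.
move=> hn; have hn' : (n m)%:R @[m --> \oo] --> (+oo : set_system R).
  by apply: cvg_comp hn _; exact: cvgr_idn.
apply/(gtr0_cvgV0 _) => //.
have : \forall m \near \oo, (0 < n m)%N by have /cvgnyPge := hn; exact.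
by apply: filterS => m; rewrite ltr0n.
Qed.

End null_sequences.

(** * Limits of the traces and of the linear term *)

Section trace_asymptotics.
Context {R : realType}.
Variables (alpha L : R) (n p : nat -> nat) (phi : nat -> R).
Variable (Sigma : forall m, 'M[R]_(p m)).
Hypothesis halpha : 1 / 2 < alpha.
Hypothesis hL : 0 < L.
Hypothesis hn : n @ \oo --> \oo.
Hypothesis hp : p @ \oo --> \oo.
Hypothesis phi_gt0 : forall m, 0 < phi m.
Hypothesis phi_cvg0 : phi @ \oo --> 0.
Hypothesis hpphi : (p m)%:R * phi m `^ alpha^-1 @[m --> \oo] --> +oo.
Hypothesis hF : forall m, class_F alpha L (Sigma m).
Variables (C1 K : R).
Hypothesis K0 : 0 <= K.
Local Notation b m := (b_phi alpha L (phi m)).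
Local Notation w m := (wt alpha L (phi m) (p:=p m)).
Hypothesis hb : \forall m \near \oo, (n m)%:R ^+ 2 * (p m)%:R * b m ^+ 2 <= C1.
Hypothesis hE : \forall m \near \oo, wS2 (Sigma m) (w m) <= (p m)%:R * (K * b m).

Let s := 2 * alpha.
Let s0 : 0 < s. Proof. by rewrite /s; move: halpha; lra. Qed.
Let alpha0 : 0 < alpha. Proof. by move: halpha; lra. Qed.
Local Notation W m := (wscale alpha L (phi m)).
Local Notation bw m := (bandwidth alpha L (phi m)).
Local Notation G m := (Gamw (Sigma m) (w m)).

Let pow_null r : 0 < r -> null (fun m => phi m `^ r).
Proof. by move=> r0; have /cvg_at_rightP := powR_cvg0 r0; apply. Qed.

Let W_null : null (fun m => W m).
Proof.
rewrite (_ : (fun m => _) = fun m => Cscale alpha L * phi m `^ s^-1).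
  by apply: nullZ; apply: pow_null; rewrite invr_gt0.
by apply/funext => m; rewrite wscaleE.
Qed.

Let bw_p_null : null (fun m => bw m / (p m)%:R).
Proof.
have h : null (fun m => ((p m)%:R * phi m `^ alpha^-1)^-1).
  apply/(gtr0_cvgV0 _) => //; near=> m.
  rewrite mulr_gt0 ?powR_gt0// ltr0n; near: m.
  by have /cvgnyPge := hp; exact.
rewrite (_ : (fun m => _) = fun m => const_CT alpha L * ((p m)%:R * phi m `^ alpha^-1)^-1).
  exact: nullZ.
by apply/funext => m; rewrite invfM /bandwidth powRN mulrA mulrAC.
Unshelve. all: by end_near.
Qed.

Let near_bw : \forall m \near \oo, 2 <= bw m.
Proof.
have CT0 := const_CT_gt0 halpha hL.
have := null_near (e := const_CT alpha L / 2) _ (@pow_null alpha^-1 _).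
rewrite invr_gt0 divr_gt0// => /(_ isT alpha0); apply: filterS => m.
rewrite ger0_norm ?powR_ge0// => h.
by rewrite /bandwidth powRN ler_pdivlMr ?powR_gt0// mulrC -ler_pdivlMr.
Qed.

Let near_p : \forall m \near \oo, (0 < p m)%N.
Proof. by have /cvgnyPge := hp; exact. Qed.

Let near_n : \forall m \near \oo, (1 < n m)%N.
Proof. by have /cvgnyPge := hn; exact. Qed.

Let x m := remsq (Sigma m) (w m) / (p m)%:R.
Let y m := wsq (w m) / (p m)%:R.

Let y_null : null (fun m => y m - 1 / 2).
Proof.
apply: (null_le (v := fun m => 2 * (W m * W m) + (bw m / (p m)%:R + 2 * (W m * W m) * (bw m / (p m)%:R)))).
  near=> m.
  have b2 : 2 <= bw m by near: m; exact: near_bw.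
  have p0 : (0 < p m)%N by near: m; exact: near_p.
  have B0 : 0 <= bw m / (p m)%:R by rewrite divr_ge0// (le_trans _ b2).
  apply: le_trans (wsq_approx halpha hL (phi_gt0 m) (band_gt0 halpha hL (phi_gt0 m) b2) p0) _.
  by rewrite mulrDl expr2; lra.
have WW : null (fun m => 2 * (W m * W m)) by apply: nullZ; exact: nullM.
by do 2 (apply: nullD => //); apply: nullM.
Unshelve. all: by end_near.
Qed.

Let Sg1 m i : Sigma m i i = 1. Proof. by case: (hF m). Qed.

Let remsq_ge0 m : 0 <= remsq (Sigma m) (w m).
Proof. by do 2 (apply: sumr_ge0 => ? _); exact: sqr_ge0. Qed.

(** As offsum = O(p phi^2), the first term of [remsq_le], 8 kappa offsum, is O(phi^2) after division
    by p. For the second, W phi^2 is of order b, so W offsum = O(p b), and (p b)^2 / p = p b^2 is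
    O(1 / n^2). *)
Let x_null : null x.
Proof.
pose D := 4 * (Coff alpha L K * (Cscale alpha L / Num.sqrt (const_C alpha L))) ^+ 2 * C1.
apply: (null_le (v := fun m => 8 * kappa alpha * Coff alpha L K * (phi m * phi m) +
    D * ((n m)%:R^-1 * (n m)%:R^-1))); last first.
  by apply: nullD; apply: nullZ; apply: nullM => //; exact: null_inv_nat.
near=> m.
have b2 : 2 <= bw m by near: m; exact: near_bw.
have p0 : (0 < p m)%N by near: m; exact: near_p.
have n1 : (1 < n m)%N by near: m; exact: near_n.
have hbm : (n m)%:R ^+ 2 * (p m)%:R * b m ^+ 2 <= C1 by near: m; exact: hb.
have hEm : wS2 (Sigma m) (w m) <= (p m)%:R * (K * b m) by near: m; exact: hE.
have b0 := band_gt0 halpha hL (phi_gt0 m) b2.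
have off := offsum_le halpha hL (phi_gt0 m) (hF m) b2 p0 hEm.
have off0 : 0 <= offsum (Sigma m).
  by do 2 (apply: sumr_ge0 => ? _); rewrite /off2; case: ifP => // _; exact: sqr_ge0.
have p0' : 0 < (p m)%:R :> R by rewrite ltr0n.
have n0' : 0 < (n m)%:R :> R by rewrite ltr0n ltnW.
have W0 : 0 < W m by exact: wscale_gt0.
have rem := @remsq_le _ _ _ _ (W m) (W m * bw m) (@Sg1 m)
  (wt_ge0 halpha hL (phi_gt0 m) (p:=p m)) (wt_le halpha hL (phi_gt0 m) (p:=p m))
  (wt_neq0 halpha hL (phi_gt0 m) (p:=p m)) (wt_row halpha hL (phi_gt0 m) b0 (p:=p m))
  (wt_col halpha hL (phi_gt0 m) b0 (p:=p m)) p0.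
rewrite ger0_norm ?divr_ge0// /x ler_pdivrMr//.
apply: le_trans rem _; rewrite [leRHS]mulrDl lerD//.
  have -> : 8 * W m * (W m * bw m) = 8 * kappa alpha.
    by rewrite -(wscale_sqr halpha hL (phi_gt0 m)); ring.
  rewrite -[X in _ <= X * _]mulrA -[leRHS]mulrA.
  apply: ler_wpM2l; first by rewrite mulr_ge0// ltW// kappa_gt0.
  by apply: le_trans off _; rewrite le_eqVlt; apply/orP; left; apply/eqP; ring.
have WE : W m * phi m ^+ 2 = Cscale alpha L / Num.sqrt (const_C alpha L) * b m.
  rewrite wscaleE// /b_phi powRD; last by rewrite (gt_eqF (phi_gt0 m)) implybT.
  rewrite -[phi m ^+ 2]powR_mulrn ?(ltW (phi_gt0 m))//; field.
  by rewrite gt_eqF// sqrtr_gt0 const_C_gt0.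
have Woff : W m * offsum (Sigma m) <=
    Coff alpha L K * (Cscale alpha L / Num.sqrt (const_C alpha L)) * ((p m)%:R * b m).
  apply: (@le_trans _ _ (W m * (Coff alpha L K * ((p m)%:R * phi m ^+ 2)))).
    by rewrite ler_wpM2l// ltW.
  rewrite le_eqVlt; apply/orP; left; apply/eqP.
  have -> : W m * (Coff alpha L K * ((p m)%:R * phi m ^+ 2)) =
    Coff alpha L K * (p m)%:R * (W m * phi m ^+ 2) by ring.
  by rewrite WE; ring.
have sqle : (W m * offsum (Sigma m)) ^+ 2 <=
    (Coff alpha L K * (Cscale alpha L / Num.sqrt (const_C alpha L)) * ((p m)%:R * b m)) ^+ 2.
  have h0 : 0 <= W m * offsum (Sigma m) by rewrite mulr_ge0// ltW.
  by rewrite ler_pXn2r ?nnegrE// (le_trans h0 Woff).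
rewrite -mulrA -exprMn.
apply: (@le_trans _ _ (4 * (Coff alpha L K * (Cscale alpha L / Num.sqrt (const_C alpha L)) * ((p m)%:R * b m)) ^+ 2)).
  by rewrite ler_wpM2l.
rewrite /D; move: (Coff alpha L K * (Cscale _ _ / _)) => Q.
rewrite exprMn.
have -> : 4 * Q ^+ 2 * C1 * ((n m)%:R^-1 * (n m)%:R^-1) * (p m)%:R =
  4 * (Q ^+ 2 * (C1 * ((n m)%:R^-1 * ((n m)%:R^-1 * (p m)%:R)))) by ring.
rewrite ler_wpM2l// ler_wpM2l ?sqr_ge0//.
have -> : ((p m)%:R * b m) ^+ 2 = ((n m)%:R ^+ 2 * (p m)%:R * b m ^+ 2) *
    ((n m)%:R^-1 * ((n m)%:R^-1 * (p m)%:R)) by field; rewrite gt_eqF.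
by rewrite ler_wpM2r// !mulr_ge0.
Unshelve. all: by end_near.
Qed.

Lemma tr2_null : null (fun m => tr2 (G m) / (p m)%:R - 1 / 2).
Proof.
apply: (null_le (v := fun m => 2 * Num.sqrt (x m) + x m + `|y m - 1 / 2|)); last first.
  apply: nullD; last exact: null_norm.
  by apply: nullD => //; apply: nullZ; exact: null_sqrt.
near=> m.
have p0 : (0 < p m)%N by near: m; exact: near_p.
have p0' : 0 < (p m)%:R :> R by rewrite ltr0n.
have y1 : y m <= 1.
  have : `|y m - 1 / 2| <= 1 / 2 by near: m; apply: null_near.
  by rewrite ler_norml => /andP[_]; lra.
have h := tr2_approx (Sigma m) (w m).
have -> : tr2 (G m) / (p m)%:R - 1 / 2 = (tr2 (G m) - wsq (w m)) / (p m)%:R + (y m - 1 / 2).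
  by rewrite /y; field; rewrite gt_eqF.
rewrite (le_trans (ler_normD _ _))// lerD2r normrM [`|_^-1|]ger0_norm ?invr_ge0 ?(ltW p0')//.
rewrite ler_pdivrMr//; apply: le_trans h _; rewrite [leRHS]mulrDl /x divfK ?gt_eqF// lerD2r -mulrA ler_wpM2l//.
have y0 : 0 <= y m by rewrite divr_ge0 ?(ltW p0')//; apply: sumr_ge0 => ? _; exact: sqr_ge0.
have x0 : 0 <= x m by rewrite divr_ge0 ?(ltW p0').
have -> : wsq (w m) * remsq (Sigma m) (w m) = y m * x m * (p m)%:R ^+ 2.
  by rewrite /x /y; field; rewrite gt_eqF.
have -> : Num.sqrt (y m * x m * (p m)%:R ^+ 2) = Num.sqrt (y m * x m) * (p m)%:R.
  by rewrite (sqrtrM _ (mulr_ge0 y0 x0)) sqrtr_sqr ger0_norm.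
rewrite ler_wpM2r ?(ltW p0')//.
by rewrite ler_wsqrtr// ler_piMl.
Unshelve. all: by end_near.
Qed.

Lemma tr4_null : null (fun m => tr4 (G m) / (p m)%:R ^+ 2).
Proof.
apply: (null_le (v := fun m => 4 * (W m * W m + 2 * (W m * W m) * x m + x m * x m))); last first.
  have WW : null (fun m => W m * W m) by exact: nullM.
  apply: nullZ; apply: nullD; last exact: nullM.
  by apply: nullD => //; apply: nullM => //; exact: nullZ.
near=> m.
have p0 : (0 < p m)%N by near: m; exact: near_p.
have p0' : 0 < (p m)%:R :> R by rewrite ltr0n.
have p1 : 1 <= (p m)%:R :> R by rewrite ler1n.
have b2 : 2 <= bw m by near: m; exact: near_bw.
have b0 := band_gt0 halpha hL (phi_gt0 m) b2.
have y1 : y m <= 1.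
  have : `|y m - 1 / 2| <= 1 / 2 by near: m; apply: null_near.
  by rewrite ler_norml => /andP[_]; lra.
have x0 : 0 <= x m by rewrite divr_ge0 ?(ltW p0').
have h := @tr4_le_rem _ _ (Sigma m) _ _ (wt_ge0 halpha hL (phi_gt0 m) (p:=p m))
  (wt_le halpha hL (phi_gt0 m) (p:=p m)) p0.
rewrite ger0_norm; last first.
  by rewrite divr_ge0 ?sqr_ge0//; do 2 (apply: sumr_ge0 => ? _); exact: sqr_ge0.
rewrite ler_pdivrMr ?exprn_gt0//; apply: le_trans h _.
have -> : wsq (w m) = y m * (p m)%:R by rewrite /y divfK ?gt_eqF.
have -> : remsq (Sigma m) (w m) = x m * (p m)%:R by rewrite /x divfK ?gt_eqF.
rewrite -[leRHS]mulrA ler_wpM2l//.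
have W2 := sqr_ge0 (W m); have pp : (p m)%:R <= (p m)%:R ^+ 2 :> R by rewrite expr2 ler_peMl// ltW.
have k1 : W m ^+ 2 * (y m * (p m)%:R) <= W m ^+ 2 * (p m)%:R ^+ 2.
  by rewrite ler_wpM2l// (le_trans _ pp)// ler_piMl// ltW.
have k2 : 2 * W m ^+ 2 * (x m * (p m)%:R) <= 2 * W m ^+ 2 * (x m * (p m)%:R ^+ 2).
  by rewrite !ler_wpM2l// mulr_ge0.
have -> : (W m * W m + 2 * (W m * W m) * x m + x m * x m) * (p m)%:R ^+ 2 =
  W m ^+ 2 * (p m)%:R ^+ 2 + 2 * W m ^+ 2 * (x m * (p m)%:R ^+ 2) + (x m * (p m)%:R) ^+ 2 by ring.
by rewrite lerD// lerD.
Unshelve. all: by end_near.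
Qed.

(** The left side, the variance of the linear term, is at most 4 K n b (W + sqrt remsq). Since n b
    sqrt p is bounded and sqrt remsq = sqrt p sqrt x with x null, it vanishes. *)
Lemma lin_null : exists2 v : nat -> R, null v & \forall m \near \oo,
  4 / (p m)%:R * ((n m)%:R * \sum_a \sum_b0 w m a * Sigma m a.1 a.2 *
    (w m b0 * Sigma m b0.1 b0.2) * Gam0 (Sigma m) a b0) <= v m.
Proof.
exists (fun m => 4 * K * Num.sqrt C1 * (W m + Num.sqrt (x m))).
  by apply: nullZ; apply: nullD => //; exact: null_sqrt.
near=> m.
have p0 : (0 < p m)%N by near: m; exact: near_p.
have p0' : 0 < (p m)%:R :> R by rewrite ltr0n.
have p1 : 1 <= (p m)%:R :> R by rewrite ler1n.
have n1 : (1 < n m)%N by near: m; exact: near_n.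
have b2 : 2 <= bw m by near: m; exact: near_bw.
have b0 := band_gt0 halpha hL (phi_gt0 m) b2.
have bm0 := b_phi_gt0 halpha hL (phi_gt0 m).
have hbm : (n m)%:R ^+ 2 * (p m)%:R * b m ^+ 2 <= C1 by near: m; exact: hb.
have hEm : wS2 (Sigma m) (w m) <= (p m)%:R * (K * b m) by near: m; exact: hE.
have W0 : 0 < W m by exact: wscale_gt0.
have h := @lin_form_le _ _ (Sigma m) _ (W m) (wt_ge0 halpha hL (phi_gt0 m) (p:=p m))
  (wt_le halpha hL (phi_gt0 m) (p:=p m)) p0.
set LF := \sum_a _ in h *.
have sp1 : 1 <= Num.sqrt (p m)%:R :> R by rewrite -[leLHS]sqrtr1 ler_wsqrtr.
have sr : Num.sqrt (remsq (Sigma m) (w m)) = Num.sqrt (p m)%:R * Num.sqrt (x m).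
  by rewrite -sqrtrM ?(ltW p0')// /x mulrCA mulfV ?mulr1// gt_eqF.
have nbp : (n m)%:R * b m * Num.sqrt (p m)%:R <= Num.sqrt C1.
  have nb0 : 0 <= (n m)%:R * b m * Num.sqrt (p m)%:R by rewrite mulr_ge0// mulr_ge0// ltW.
  rewrite -(ger0_norm nb0) -sqrtr_sqr ler_wsqrtr//; apply: le_trans hbm.
  rewrite -[X in _ <= _ * X * _](sqr_sqrtr (ltW p0')).
  by rewrite le_eqVlt; apply/orP; left; apply/eqP; ring.
have C0 : 0 <= W m + Num.sqrt (remsq (Sigma m) (w m)) by rewrite addr_ge0// ltW.
have h2 : LF <= (W m + Num.sqrt (remsq (Sigma m) (w m))) * ((p m)%:R * (K * b m)).
  by apply: le_trans h _; rewrite ler_wpM2l.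
apply: (@le_trans _ _ (4 / (p m)%:R * ((n m)%:R * ((W m + Num.sqrt (remsq (Sigma m) (w m))) * ((p m)%:R * (K * b m)))))).
  by rewrite ler_wpM2l ?divr_ge0 ?(ltW p0')// ler_wpM2l.
have -> : 4 / (p m)%:R * ((n m)%:R * ((W m + Num.sqrt (remsq (Sigma m) (w m))) * ((p m)%:R * (K * b m)))) =
  4 * K * ((n m)%:R * b m * (W m + Num.sqrt (remsq (Sigma m) (w m)))).
  by field; rewrite gt_eqF.
rewrite -[leRHS]mulrA ler_wpM2l ?mulr_ge0//.
apply: (@le_trans _ _ ((n m)%:R * b m * (Num.sqrt (p m)%:R * (W m + Num.sqrt (x m))))).
  rewrite sr; apply: ler_wpM2l; first by rewrite mulr_ge0// ltW.
  by rewrite mulrDr lerD2r ler_peMl// ltW.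
by rewrite mulrA ler_wpM2r// addr_ge0// ltW.
Unshelve. all: by end_near.
Qed.

End trace_asymptotics.

(** * The Stein error tends to zero *)

Section stein_error.
Context {R : realType}.

(** The bound of [Ux_bound] with [A] and [D] for the two traces. The choice delta = n^(-1/2)
    balances delta against 1 / (n delta). *)
Definition stein_err (M1 M2 : R) (n p : nat) (A D : R) : R :=
  let c := ((n%:R - 1) * Num.sqrt p%:R)^-1 in let delta := Num.sqrt n%:R^-1 in
  M1 * (`|1 - 2 * c ^+ 2 * n%:R * (n%:R - 1) * A| +
    2 * c ^+ 2 * n%:R * (Num.sqrt (n%:R * (27 * A ^+ 2)) + Num.sqrt (2 * n%:R ^+ 2 * D)))
  + M2 * (2 * (c ^+ 2 * n%:R ^+ 2 * A) * delta +
     4 * (4 * 27 + 8) * (27 + 1) * (c ^+ 2 * n%:R ^+ 2 * A) ^+ 2 / (n%:R * delta)).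

Variables (n p : nat -> nat) (A D : nat -> R).
Hypothesis hn : n @ \oo --> \oo.
Hypothesis hp : p @ \oo --> \oo.
Hypothesis D0 : forall m, 0 <= D m.
Hypothesis hA : null (fun m => A m / (p m)%:R - 1 / 2).
Hypothesis hD : null (fun m => D m / (p m)%:R ^+ 2).

Let c m : R := (((n m)%:R - 1) * Num.sqrt (p m)%:R)^-1.
Let y m : R := A m / (p m)%:R.
Let z m : R := D m / (p m)%:R ^+ 2.
Let k m : R := (n m)%:R / ((n m)%:R - 1).
Let i m : R := (n m)%:R^-1.

Let nearby : \forall m \near \oo, [/\ 0 < (p m)%:R :> R, 2 <= (n m)%:R :> R & 0 <= y m <= 1].
Proof.
near=> m; split.
- by rewrite ltr0n; near: m; have /cvgnyPge := hp; exact.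
- by rewrite ler_nat; near: m; have /cvgnyPge := hn; exact.
- have : `|y m - 1 / 2| <= 1 / 2 by near: m; exact: null_near.
  by rewrite ler_norml => /andP[h1 h2]; apply/andP; split; lra.
Unshelve. all: by end_near.
Qed.

Let kle m : 2 <= (n m)%:R :> R -> [/\ 0 <= k m, k m <= 2 & k m - 1 <= 2 * i m].
Proof.
move=> n2; have n1 : 0 < (n m)%:R - 1 :> R by lra.
split.
- by rewrite divr_ge0 ?ltW//; lra.
- by rewrite ler_pdivrMr//; lra.
- have -> : k m - 1 = ((n m)%:R - 1)^-1 by rewrite /k; field; rewrite gt_eqF.
  by rewrite -ler_pdivrMl// -invfM lef_pV2 ?posrE; lra.
Qed.

(** Reduces the normalisation to k = n / (n - 1), which stays below 2 and tends to 1. *)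
Let c2 m : 0 < (p m)%:R :> R -> 2 <= (n m)%:R :> R ->
  c m ^+ 2 * (n m)%:R ^+ 2 * (p m)%:R = k m ^+ 2.
Proof.
move=> p0 n2; rewrite /c exprVn exprMn sqr_sqrtr ?ltW// /k.
by field; rewrite !gt_eqF//; lra.
Qed.

Let null_i : null i. Proof. exact: null_inv_nat. Qed.
Let null_si : null (fun m => Num.sqrt (i m)). Proof. exact: null_sqrt. Qed.

Let variance_null : null (fun m => 1 - 2 * c m ^+ 2 * (n m)%:R * ((n m)%:R - 1) * A m).
Proof.
apply: (null_le (v := fun m => 2 * `|y m - 1 / 2| + 4 * i m)); last first.
  by apply: nullD; apply: nullZ => //; exact: null_norm.
near=> m; have [p0 n2 /andP[y0 y1]] : [/\ 0 < (p m)%:R :> R, 2 <= (n m)%:R :> R & 0 <= y m <= 1].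
  by near: m; exact: nearby.
have [k0 k2 ki] := kle n2.
have -> : 1 - 2 * c m ^+ 2 * (n m)%:R * ((n m)%:R - 1) * A m = - (2 * (y m - 1 / 2)) - 2 * y m * (k m - 1).
  rewrite /c exprVn exprMn sqr_sqrtr ?(ltW p0)// /k /y.
  by field; rewrite !gt_eqF//; lra.
rewrite (le_trans (ler_normB _ _))// normrN normrM (ger0_norm (ler0n _ 2)) lerD2l.
have k1 : 0 <= k m - 1.
  by rewrite subr_ge0 ler_pdivlMr; lra.
rewrite ger0_norm; last by rewrite mulr_ge0// mulr_ge0.
have : y m * (k m - 1) <= 1 * (2 * i m) by apply: ler_pM.
lra.
Unshelve. all: by end_near.
Qed.

Let fluct_null : null (fun m => 2 * c m ^+ 2 * (n m)%:R *
  (Num.sqrt ((n m)%:R * (27 * A m ^+ 2)) + Num.sqrt (2 * (n m)%:R ^+ 2 * D m))).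
Proof.
(* The 8 is 2 k^2 at the bound k = 2. *)
apply: (null_le (v := fun m => 8 * (Num.sqrt 27 * Num.sqrt (i m) + Num.sqrt 2 * Num.sqrt (z m)))); last first.
  by apply: nullZ; apply: nullD; apply: nullZ => //; exact: null_sqrt.
near=> m; have [p0 n2 /andP[y0 y1]] : [/\ 0 < (p m)%:R :> R, 2 <= (n m)%:R :> R & 0 <= y m <= 1].
  by near: m; exact: nearby.
have [k0 k2 _] := kle n2.
have n0 : 0 < (n m)%:R :> R by lra.
have np0 : 0 <= (n m)%:R * (p m)%:R :> R by rewrite mulr_ge0// ltW.
rewrite ger0_norm; last by rewrite mulr_ge0 ?addr_ge0// mulr_ge0// mulr_ge0// sqr_ge0.
have -> : Num.sqrt ((n m)%:R * (27 * A m ^+ 2)) =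
    Num.sqrt 27 * (Num.sqrt (i m) * y m) * ((n m)%:R * (p m)%:R).
  have -> : (n m)%:R * (27 * A m ^+ 2) = 27 * i m * (y m * ((n m)%:R * (p m)%:R)) ^+ 2.
    by rewrite /i /y; field; rewrite !gt_eqF.
  have i0 : 0 <= 27 * i m by rewrite mulr_ge0// invr_ge0 ltW.
  rewrite (sqrtrM _ i0) sqrtr_sqr (ger0_norm (mulr_ge0 y0 np0)) (sqrtrM (i m) (ler0n _ 27)); ring.
have -> : Num.sqrt (2 * (n m)%:R ^+ 2 * D m) = Num.sqrt 2 * Num.sqrt (z m) * ((n m)%:R * (p m)%:R).
  have -> : 2 * (n m)%:R ^+ 2 * D m = 2 * z m * ((n m)%:R * (p m)%:R) ^+ 2.
    by rewrite /z; field; rewrite !gt_eqF.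
  have i0 : 0 <= 2 * z m by rewrite mulr_ge0// divr_ge0// sqr_ge0.
  by rewrite (sqrtrM _ i0) sqrtr_sqr ger0_norm// (sqrtrM (z m) (ler0n _ 2)).
have -> : 2 * c m ^+ 2 * (n m)%:R * (Num.sqrt 27 * (Num.sqrt (i m) * y m) * ((n m)%:R * (p m)%:R) +
    Num.sqrt 2 * Num.sqrt (z m) * ((n m)%:R * (p m)%:R)) =
  2 * k m ^+ 2 * (Num.sqrt 27 * (Num.sqrt (i m) * y m) + Num.sqrt 2 * Num.sqrt (z m)).
  by rewrite -c2//; ring.
apply: ler_pM => //.
- by rewrite mulr_ge0// sqr_ge0.
- by apply: addr_ge0; apply: mulr_ge0 => //; apply: mulr_ge0.
- nra.
- by rewrite lerD2r ler_wpM2l// ler_piMr.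
Unshelve. all: by end_near.
Qed.

Let u_le m : 0 < (p m)%:R :> R -> 2 <= (n m)%:R :> R -> 0 <= y m <= 1 ->
  0 <= c m ^+ 2 * (n m)%:R ^+ 2 * A m <= 4.
Proof.
move=> p0 n2 /andP[y0 y1]; have [k0 k2 _] := kle n2.
have -> : c m ^+ 2 * (n m)%:R ^+ 2 * A m = k m ^+ 2 * y m.
  by rewrite -c2// /y; field; rewrite gt_eqF.
by rewrite mulr_ge0 ?sqr_ge0//=; nra.
Qed.

Let taylor_null : null (fun m => 2 * (c m ^+ 2 * (n m)%:R ^+ 2 * A m) * Num.sqrt (i m)).
Proof.
apply: (null_le (v := fun m => 8 * Num.sqrt (i m))); last exact: nullZ.
near=> m; have [p0 n2 y01] : [/\ 0 < (p m)%:R :> R, 2 <= (n m)%:R :> R & 0 <= y m <= 1].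
  by near: m; exact: nearby.
have /andP[u0 u4] := u_le p0 n2 y01.
rewrite ger0_norm; last by rewrite mulr_ge0// mulr_ge0.
rewrite ler_wpM2r//; lra.
Unshelve. all: by end_near.
Qed.

Let cubic_null : null (fun m => 4 * (4 * 27 + 8) * (27 + 1) * (c m ^+ 2 * (n m)%:R ^+ 2 * A m) ^+ 2 /
  ((n m)%:R * Num.sqrt (i m))).
Proof.
apply: (null_le (v := fun m => 4 * (4 * 27 + 8) * (27 + 1) * 16 * Num.sqrt (i m))); last exact: nullZ.
near=> m; have [p0 n2 y01] : [/\ 0 < (p m)%:R :> R, 2 <= (n m)%:R :> R & 0 <= y m <= 1].
  by near: m; exact: nearby.
have /andP[u0 u4] := u_le p0 n2 y01.
have n0 : 0 < (n m)%:R :> R by lra.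
have i0 : 0 < i m by rewrite invr_gt0.
have -> : (n m)%:R * Num.sqrt (i m) = (Num.sqrt (i m))^-1.
  rewrite -[(n m)%:R]invrK -/(i m) -{1}(sqr_sqrtr (ltW i0)); field.
  by rewrite gt_eqF// sqrtr_gt0.
rewrite invrK ger0_norm; last by rewrite mulr_ge0// mulr_ge0 ?sqr_ge0.
rewrite ler_wpM2r// ler_wpM2l//; nra.
Unshelve. all: by end_near.
Qed.

Lemma stein_err_null (M1 M2 : R) :
  null (fun m => stein_err M1 M2 (n m) (p m) (A m) (D m)).
Proof.
apply: nullD; apply: nullZ; apply: nullD; [exact: null_norm|exact: fluct_null|exact: taylor_null|exact: cubic_null].
Qed.

End stein_error.

(** * Normal approximation for one sample *)

Section one_sample.
Context {R : realType}.
Variables (alpha L phi : R).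
Hypothesis halpha : 1 / 2 < alpha.
Hypothesis hL : 0 < L.
Hypothesis phi0 : 0 < phi.
Context d (T : measurableType d) (P : probability T R) (n p : nat).
Variables (Sg : 'M[R]_p) (X : 'I_n -> {RV P >-> p.-tuple R}).
Hypothesis hF : class_F alpha L Sg.
Hypothesis hX : iid_gaussian P Sg X.
Hypothesis n1 : (1 < n)%N.
Hypothesis p0 : (0 < p)%N.
Local Notation w := (wt alpha L phi (p:=p)).
Local Notation E := (E P).
Local Notation hT := (@subset_refl _ (@measurable _ T)).

Let SgT : Sg^T = Sg. Proof. by case: hF. Qed.
Let Sg0 (u : 'rV[R]_p) : 0 <= (u *m Sg *m u^T) 0 0. Proof. by case: hF. Qed.
Let w0 a : 0 <= w a. Proof. exact: wt_ge0. Qed.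
Let c : R := ((n%:R - 1) * Num.sqrt p%:R)^-1.
Let sp : Num.sqrt p%:R != 0 :> R. Proof. by rewrite sqrtr_eq0 -ltNge ltr0n. Qed.
Let pp : p%:R != 0 :> R. Proof. by rewrite pnatr_eq0 -lt0n. Qed.
Let nn : n%:R - 1 != 0 :> R. Proof. by rewrite subr_eq0 pnatr_eq1 gtn_eqF. Qed.
Let n0 : n%:R != 0 :> R. Proof. by rewrite pnatr_eq0 -lt0n ltnW. Qed.

Definition Zstat (x : T) : R := n%:R * Num.sqrt p%:R *
  (Dhat alpha L phi X x - fine 'E_P[Dhat alpha L phi X]).

Let DhatE : Dhat alpha L phi X = fun x => (n%:R * (n%:R - 1) * p%:R)^-1 * Dsum X w x.
Proof.
apply/funext => x; rewrite /Dhat /Dsum; congr (_ * _).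
apply: eq_bigr => k _; apply: eq_bigr => l _.
transitivity (\sum_(i < p) \sum_(j < p) w (i, j) * (tnth (X k x) i * tnth (X k x) j) *
   (tnth (X l x) i * tnth (X l x) j)); last by rewrite pair_bigA; apply: eq_bigr => -[].
apply: eq_bigr => i _; rewrite big_mkcond/=; apply: eq_bigr => j _.
by rewrite /wt/=; case: ifP => _; rewrite ?mul0r// !mulrA.
Qed.

Lemma mean_Dhat : fine 'E_P[Dhat alpha L phi X] = wS2 Sg w / p%:R.
Proof.
rewrite unlock -[LHS]/(E (Dhat alpha L phi X)) DhatE EZ; last exact: (mom_Dsum Sg0 hX w).
rewrite (E_Dsum SgT Sg0 hX w (ltnW n1)) -/(wS2 Sg w).
by field; rewrite n0 nn pp.
Qed.

Lemma Zstat_decomp x : Zstat x = Ux Sg X w c x + Lin Sg X w x.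
Proof.
rewrite -(Dsum_decomp Sg X w0 x n1 p0 erefl) /Zstat mean_Dhat DhatE -/(wS2 Sg w).
have spE : p%:R = Num.sqrt p%:R ^+ 2 :> R by rewrite sqr_sqrtr.
move: (Dsum X w x) (wS2 Sg w) => D S.
move: sp spE; rewrite /c; move: (Num.sqrt _) => q q0 ->; field.
by rewrite n0 nn q0.
Qed.

Lemma mom_Zstat : mom P measurable Zstat.
Proof.
rewrite (_ : Zstat = fun x => Ux Sg X w c x + Lin Sg X w x); last first.
  by apply/funext => x; exact: Zstat_decomp.
by apply: momD => //; [exact: mom_Ux|exact: mom_Lin].
Qed.

Variables (a b : R).
Hypothesis ab : a < b.

(** Dropping the linear term costs the Lipschitz constant of the ramp times E |Lin|, at most the
    root of its second moment; for the quadratic form that is left, Stein's equation and [Ux_bound]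
    apply. *)
Lemma ramp_Zstat (M0 M1 M2 v : R) : (forall x, `|stein_f a b x| <= M0) ->
  (forall x, `|stein_df a b x| <= M1) ->
  (forall x y, `|stein_df a b x - stein_df a b y| <= M2 * `|x - y|) ->
  4 / p%:R * (n%:R * \sum_a1 \sum_b1 w a1 * Sg a1.1 a1.2 *
    (w b1 * Sg b1.1 b1.2) * Gam0 Sg a1 b1) <= v ->
  `|E (fun x => ramp a b (Zstat x)) - stein_mean a b| <=
  stein_err M1 M2 n p (tr2 (Gamw Sg w)) (tr4 (Gamw Sg w)) + (b - a)^-1 * Num.sqrt v.
Proof.
move=> hM0 hM1 hM2 hv.
pose f := stein_f a b; pose f' := stein_df a b.
pose U := Ux Sg X w c; pose Li := Lin Sg X w.
have cf : continuous f by exact: continuous_stein_f.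
have cf' : continuous f' by exact: lip_continuous hM2.
have ft x h : `|f (x + h) - f x - h * f' x| <= M2 * h ^+ 2.
  by apply: deriv_taylor => // t; exact: deriv_stein_f.
have d0 : 0 < Num.sqrt n%:R^-1 :> R by rewrite sqrtr_gt0 invr_gt0 ltr0n ltnW.
have hU := Ux_bound SgT Sg0 hX w cf cf' hM0 hM1 hM2 ft c d0 (ltnW n1).
have mU : mom P measurable U by exact: mom_Ux.
have mL : mom P measurable Li by exact: mom_Lin.
have cr := continuous_ramp ab.
have r1 x : `|ramp a b x| <= 1 by have /andP[h1 h2] := ramp01 a b x; rewrite ger0_norm.
have mr Z : mom P measurable Z -> mom P measurable (fun x => ramp a b (Z x)).
  by move=> mZ; exact: (mom_comp hT cr r1 mZ).
have EU : E (fun x => ramp a b (U x)) - stein_mean a b = E (fun x => f' (U x) - U x * f (U x)).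
  rewrite -[stein_mean a b in LHS](E_cst P) -EB; [|exact: mr|exact: mom_cst].
  by apply: eqE => x; rewrite /f' /f /stein_df; ring.
have mZ := mom_Zstat.
have dist : `|E (fun x => ramp a b (Zstat x)) - E (fun x => ramp a b (U x))| <= (b - a)^-1 * Num.sqrt v.
  rewrite -EB; [|exact: mr|exact: mr].
  have mB : mom P measurable (fun x => ramp a b (Zstat x) - ramp a b (U x)).
    by apply: momB => //; exact: mr.
  apply: le_trans (normE mB) _.
  apply: (@le_trans _ _ (E (fun x => (b - a)^-1 * `|Li x|))).
    apply: leE => [||x]; first exact: mom_norm.
      by apply: momZ => //; exact: mom_norm.
    apply: le_trans (ramp_lip ab _ _) _; rewrite Zstat_decomp -/U -/Li.
    by rewrite addrAC subrr add0r.
  rewrite EZ; last exact: mom_norm.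
  rewrite ler_wpM2l ?invr_ge0 ?subr_ge0 ?(ltW ab)//.
  apply: le_trans (E_norm_sqrt mL) _; apply: ler_wsqrtr.
  by rewrite (E_sqr_Lin SgT Sg0 hX w).
rewrite -[X in `|X|](subrKA (E (fun x => ramp a b (U x)))).
rewrite (le_trans (ler_normD _ _))// addrC lerD// EU.
exact: hU.
Qed.

Let prob_integral : forall A : set T, measurable A -> P A = (\int[P]_x (\1_A x)%:E)%E.
Proof. by move=> A mA; rewrite integral_indic ?setIT. Qed.

Let EE Z : mom P measurable Z -> (E Z)%:E = (\int[P]_x (Z x)%:E)%E.
Proof.
move=> mZ; rewrite /E /Rintegral fineK//; apply: integrable_fin_num => //.
exact: (mom_integrable hT mZ).
Qed.

Let mramp : mom P measurable (fun x => ramp a b (Zstat x)).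
Proof.
have r1 x : `|ramp a b x| <= 1 by have /andP[h1 h2] := ramp01 a b x; rewrite ger0_norm.
exact: (mom_comp hT (continuous_ramp ab) r1 mom_Zstat).
Qed.

Lemma measurable_Zstat_le t : measurable (Zstat @^-1` `]-oo, t]%classic).
Proof.
have mZ := mom_measurable hT mom_Zstat.
by rewrite -[X in measurable X]setTI; apply: mZ.
Qed.

Lemma prob_le_ramp : (P (Zstat @^-1` `]-oo, a]%classic) <= (E (fun x => ramp a b (Zstat x)))%:E)%E.
Proof.
rewrite (prob_integral (measurable_Zstat_le _)) EE//; apply: ge0_le_integral => //.
- by apply/measurable_EFinP/measurable_indic; exact: measurable_Zstat_le.
- by apply/measurable_EFinP; exact: (mom_measurable hT mramp).
move=> x _; rewrite lee_fin indicE; case: (boolP (x \in _)) => [|_]; last first.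
  by have /andP[] := ramp01 a b (Zstat x).
by rewrite inE/= in_itv/= => /(ramp_left ab) ->.
Qed.

Lemma prob_ge_ramp : ((E (fun x => ramp a b (Zstat x)))%:E <= P (Zstat @^-1` `]-oo, b]%classic))%E.
Proof.
rewrite (prob_integral (measurable_Zstat_le _)) EE//; apply: ge0_le_integral => //.
- by move=> x _; rewrite lee_fin; have /andP[] := ramp01 a b (Zstat x).
- by apply/measurable_EFinP; exact: (mom_measurable hT mramp).
- by apply/measurable_EFinP/measurable_indic; exact: measurable_Zstat_le.
move=> x _; rewrite lee_fin indicE; have /andP[_ r1] := ramp01 a b (Zstat x).
case: (boolP (x \in _)) => //; rewrite notin_setE/= in_itv/= => /negP; rewrite -ltNge => /ltW.
by move=> /(ramp_right ab) ->.
Qed.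

End one_sample.

(** * Convergence in distribution *)

Section clt.
Context {R : realType}.

(** A bound on the upper limit holds eventually only up to some slack, here 1. *)
Lemma near_le_limn_esup (u : nat -> R) (C : R) :
  (limn_esup (fun m => (u m)%:E) <= C%:E)%E -> \forall m \near \oo, u m <= C + 1.
Proof.
move=> h; have : (limn_esup (fun m => (u m)%:E) < (C + 1)%:E)%E.
  by apply: le_lt_trans h _; rewrite lte_fin ltrDl.
move=> /ereal_inf_lt[_ [V Voo <-] hV]; apply: filterS Voo => m Vm.
rewrite -lee_fin; apply: le_trans (ltW hV); apply: ereal_sup_ubound.
by exists m.
Qed.

Lemma Phi_near (x e : R) : 0 < e -> exists2 r : R, 0 < r &
  `|Phi (x + r) - Phi x| <= e /\ `|Phi (x - r) - Phi x| <= e.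
Proof.
move=> e0; have /(_ x) := deriv_cont (@deriv_Phi R).
move=> /cvgrPdist_le/(_ e e0)/nbhs_ballP[r /= r0 hr].
have r2 : 0 < r / 2 by rewrite divr_gt0.
exists (r / 2) => //; rewrite ![`|_ - Phi x|]distrC; split; apply: hr => /=.
  by rewrite /ball/= opprD addrA subrr add0r normrN gtr0_norm// ltr_pdivrMr// ltr_pMr// ltr1n.
by rewrite /ball/= opprB addrC subrK gtr0_norm// ltr_pdivrMr// ltr_pMr// ltr1n.
Qed.

End clt.

Theorem proposition2 (R : realType) (alpha L : R)
    (halpha : 1 / 2 < alpha) (hL : 0 < L)
    (n p : nat -> nat) (phi : nat -> R)
    (hn : n @ \oo --> \oo) (hp : p @ \oo --> \oo)
    (phi_gt0 : forall m, 0 < phi m)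
    (phi_cvg0 : phi @ \oo --> 0)
    (hpphi : (p m)%:R * phi m `^ alpha^-1 @[m --> \oo] --> +oo)
    (hb : asymp (fun m => (n m)%:R ^+ 2 * (p m)%:R * b_phi alpha L (phi m) ^+ 2)
                (fun=> 1))
    (Sigma : forall m, 'M[R]_(p m))
    (hSigma : forall m, class_Q alpha L (phi m) (Sigma m))
    (d : nat -> measure_display) (Omega : forall m, measurableType (d m))
    (P : forall m, probability (Omega m) R)
    (X : forall m, 'I_(n m) -> {RV (P m) >-> (p m).-tuple R})
    (hX : forall m, iid_gaussian (P m) (Sigma m) (X m))
    (hE : (fun m => fine 'E_(P m)[Dhat alpha L (phi m) (X m)]) =O_\oo
          (fun m => b_phi alpha L (phi m))) :
  cvg_in_distribution P
    (fun m w => (n m)%:R * Num.sqrt (p m)%:R *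
      (Dhat alpha L (phi m) (X m) w -
       fine 'E_(P m)[Dhat alpha L (phi m) (X m)]))
    (normal_prob 0 1).
Proof.
have hF m : class_F alpha L (Sigma m) by case: (hSigma m).
have near_p : \forall m \near \oo, (0 < p m)%N by have /cvgnyPge := hp; exact.
have near_n : \forall m \near \oo, (1 < n m)%N by have /cvgnyPge := hn; exact.
have [C1 hC1] : exists C1, \forall m \near \oo,
    (n m)%:R ^+ 2 * (p m)%:R * b_phi alpha L (phi m) ^+ 2 <= C1.
  have [c [C [_ _ _ /near_le_limn_esup hC]]] := hb.
  by exists (C + 1); apply: filterS hC => m; rewrite divr1.
have [K K0 hK] := (eqO_exP _ _ _).1 hE.
pose w m := wt alpha L (phi m) (p:=p m).
(* E Dhat is wS2 / p, so the assumption E Dhat = O(b) becomes a bound on [wS2]. *)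
have hwS : \forall m \near \oo, wS2 (Sigma m) (w m) <= (p m)%:R * (K * b_phi alpha L (phi m)).
  near=> m.
  have p0 : (0 < p m)%N by near: m; exact: near_p.
  have n1 : (1 < n m)%N by near: m; exact: near_n.
  have : `|fine 'E_(P m)[Dhat alpha L (phi m) (X m)]| <= K * `|b_phi alpha L (phi m)|.
    by near: m; exact: hK.
  rewrite (mean_Dhat (phi m) (hF m) (hX m) n1 p0).
  rewrite (gtr0_norm (b_phi_gt0 halpha hL (phi_gt0 m))) => /(le_trans (ler_norm _)).
  by rewrite ler_pdivrMr ?ltr0n// mulrC.
have hA := tr2_null halpha hL hn hp phi_gt0 phi_cvg0 hpphi hF hC1 hwS.
have hD := tr4_null halpha hL hn hp phi_gt0 phi_cvg0 hpphi hF hC1 hwS.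
have [v v0 hv] := lin_null halpha hL hn hp phi_gt0 phi_cvg0 hF (ltW K0) hC1 hwS.
have D0 m : 0 <= tr4 (Gamw (Sigma m) (w m)).
  by do 2 (apply: sumr_ge0 => ? _); exact: sqr_ge0.
pose Z m := Zstat alpha L (phi m) (X m).
(* Convergence of the means of ramps; it remains to pass to half-lines. *)
have hramp a b : a < b -> null (fun m => E (P m) (fun x => ramp a b (Z m x)) - stein_mean a b).
  move=> ab; have [M0 hM0] := stein_f_bounded ab.
  have [M1 hM1] := stein_df_bounded ab; have [M2 hM2] := stein_df_lip ab.
  apply: (null_le (v := fun m => stein_err M1 M2 (n m) (p m) (tr2 (Gamw (Sigma m) (w m)))
     (tr4 (Gamw (Sigma m) (w m))) + (b - a)^-1 * Num.sqrt (v m))); last first.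
    apply: nullD; first exact: stein_err_null.
    by apply: nullZ; exact: null_sqrt.
  near=> m.
  have p0 : (0 < p m)%N by near: m; exact: near_p.
  have n1 : (1 < n m)%N by near: m; exact: near_n.
  apply: (ramp_Zstat halpha hL (phi_gt0 m) (hF m) (hX m) n1 p0 ab hM0 hM1 hM2).
  by near: m; exact: hv.
move=> x _; rewrite [X in _ --> X](_ : _ = (Phi x)%:E); last by rewrite Phi_fin.
have hfin m : (0 < p m)%N -> (1 < n m)%N -> P m (Z m @^-1` `]-oo, x]%classic) \is a fin_num.
  move=> p0 n1; apply: fin_num_measure.
  exact: (measurable_Zstat_le halpha hL (phi_gt0 m) (hF m) (hX m) n1 p0).
apply/fine_cvgP; split.
  near=> m; apply: hfin; near: m; [exact: near_p|exact: near_n].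
apply/cvgrPdist_le => e e0.
have e2 : 0 < e / 2 by rewrite divr_gt0.
(* The half-line up to x is sandwiched between the ramps on [x - r, x] and [x, x + r]. By continuity
   of [Phi] their Gaussian means lie within e / 2 of Phi x, which leaves e / 2 for the convergence
   of the means. *)
have [r r0 [hr1 hr2]] := Phi_near x e2.
have xr : x < x + r by rewrite ltrDl.
have rx : x - r < x by rewrite ltrBlDr ltrDl.
near=> m.
have p0 : (0 < p m)%N by near: m; exact: near_p.
have n1 : (1 < n m)%N by near: m; exact: near_n.
have u1 : `|E (P m) (fun t => ramp x (x + r) (Z m t)) - stein_mean x (x + r)| <= e / 2.
  by near: m; apply: null_near => //; exact: hramp.
have l1 : `|E (P m) (fun t => ramp (x - r) x (Z m t)) - stein_mean (x - r) x| <= e / 2.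
  by near: m; apply: null_near => //; exact: hramp.
have := prob_le_ramp halpha hL (phi_gt0 m) (hF m) (hX m) n1 p0 xr.
have := prob_ge_ramp halpha hL (phi_gt0 m) (hF m) (hX m) n1 p0 rx.
rewrite -/(Z m) -[P m _]fineK ?hfin// !lee_fin => lo up.
have m1 := stein_mean_le xr; have m2 := stein_mean_ge rx.
change (`|Phi x - fine (P m (Z m @^-1` `]-oo, x]%classic))| <= e).
move: u1 l1 hr1 hr2; rewrite !ler_norml.
by move=> /andP[? ?] /andP[? ?] /andP[? ?] /andP[? ?]; apply/andP; split; lra.
Unshelve. all: by end_near.
Qed.
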